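(* Let $\mu$ be a finite positive Borel measure on $(-1,1)$ that is regular. Let $I$ be a closed subinterval of $(-1,1)$ such that $\mu$ is absolutely continuous in an open interval containing $I$. Assume that $w$ is positive and continuous in $I$ (that is, $w$, regarded as a function on $(-1,1)$, is continuous at every point of $I$). Let $m\ge 1$ and let $$R_m(y_1,y_2,\dots,y_m)=\det\left(\widetilde K_n(y_i,y_j)\right)_{i,j=1}^m$$ denote the $m$-point correlation function. Then for given real $\xi_1,\dots,\xi_m$, uniformly for $x\in I$, $$\lim_{n\to\infty}\frac{1}{\widetilde K_n(x,x)^m}R_m\left(x+\frac{\xi_1}{\widetilde K_n(x,x)},\,x+\frac{\xi_2}{\widetilde K_n(x,x)},\dots,x+\frac{\xi_m}{\widetilde K_n(x,x)}\right)=\det\left(\frac{\sin\pi(\xi_i-\xi_j)}{\pi(\xi_i-\xi_j)}\right)_{i,j=1}^m.$$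
   Context: For a finite positive Borel measure $\mu$ on $(-1,1)$ with infinite support, the orthonormal polynomials are $p_n(x)=\gamma_n x^n+\cdots$, $\gamma_n>0$, $n\ge 0$, with $\int_{-1}^1 p_np_m\,d\mu=\delta_{mn}$. The measure $\mu$ is called regular (on $[-1,1]$) if $\lim_{n\to\infty}\gamma_n^{1/n}=2$. The function $w=d\mu/dx$ denotes (a fixed version of) the density of the absolutely continuous part of $\mu$. The reproducing kernel is $K_n(x,y)=\sum_{k=0}^{n-1}p_k(x)p_k(y)$ and the normalized kernel is $\widetilde K_n(x,y)=w(x)^{1/2}w(y)^{1/2}K_n(x,y)$. The quantity $\frac{\sin\pi t}{\pi t}$ is interpreted as $1$ at $t=0$. The function $R_m$ depends on $n$. *)

(* Defs.v *)
From HB Require Import structures.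
From mathcomp Require Export all_boot all_order all_algebra.
From mathcomp Require Export all_classical all_reals all_analysis.
Export Order.TTheory GRing.Theory Num.Theory.
Export numFieldNormedType.Exports.
#[export] Set Implicit Arguments.
#[export] Unset Strict Implicit.
#[export] Unset Printing Implicit Defensive.

Local Open Scope classical_set_scope.
Local Open Scope ring_scope.

Definition msupport (R : realType)
    (mu : {measure set (measurableTypeR R) -> \bar R}) : set R :=
  [set x | forall U : set R, open U -> U x -> (0 < mu U)%E].

Definition orthonormal_polys (R : realType)
    (mu : {measure set (measurableTypeR R) -> \bar R})
    (p : nat -> {poly R}) : Prop :=
  [/\ forall n, size (p n) = n.+1,
      forall n, 0 < lead_coef (p n)
    & forall n m,
        \int[mu]_(x in `]-1, 1[) ((p n).[x] * (p m).[x]) = (n == m)%:R].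

(* The orthonormal polynomials of [mu] are unique, and they exist exactly when
   its support is infinite; [exists2] thus speaks of the leading coefficients
   of the orthonormal polynomials of [mu]. *)
Definition regular_measure (R : realType)
    (mu : {measure set (measurableTypeR R) -> \bar R}) : Prop :=
  exists2 p : nat -> {poly R}, orthonormal_polys mu p &
    (fun n : nat => lead_coef (p n) `^ n%:R^-1) @ \oo --> (2 : R).

Definition mutually_singular (R : realType)
    (mu nu : {measure set (measurableTypeR R) -> \bar R}) : Prop :=
  exists N : set (measurableTypeR R),
    [/\ measurable N, mu N = 0%E & nu (~` N) = 0%E].

(* [w] is a version of the density of the absolutely continuous part in the
   Lebesgue decomposition of [mu] on ]-1, 1[. The values of [w] outside
   ]-1, 1[ are unconstrained. *)
Definition ac_density (R : realType)
    (mu : {measure set (measurableTypeR R) -> \bar R}) (w : R -> R) : Prop :=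
  [/\ measurable_fun (`]-1, 1[ : set (measurableTypeR R)) w,
      forall x, x \in `]-1, 1[ -> 0 <= w x
    & exists2 sing : {measure set (measurableTypeR R) -> \bar R},
        mutually_singular (@lebesgue_measure R) sing &
        forall A : set (measurableTypeR R), measurable A -> A `<=` `]-1, 1[ ->
          mu A = (\int[@lebesgue_measure R]_(x in A) (w x)%:E + sing A)%E].

Definition repro_kernel (R : realType) (p : nat -> {poly R}) (n : nat)
    (x y : R) : R :=
  \sum_(k < n) (p k).[x] * (p k).[y].

Definition norm_kernel (R : realType) (p : nat -> {poly R}) (w : R -> R)
    (n : nat) (x y : R) : R :=
  Num.sqrt (w x) * Num.sqrt (w y) * repro_kernel p n x y.

Definition corr_fun (R : realType) (p : nat -> {poly R}) (w : R -> R)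
    (n m : nat) (y : 'I_m -> R) : R :=
  \det (\matrix_(i < m, j < m) norm_kernel p w n (y i) (y j)).

Definition sinc_pi (R : realType) (t : R) : R :=
  if t == 0 then 1 else sin (pi * t) / (pi * t).

(* Main.v *)
(** Put L(P) = \int P dmu and K(x,y) = K_n(x,y). The Christoffel function
    1/K(y,y) is the minimum of L(P^2) over the polynomials P of size at most n with
    P(y) = 1, and a trial polynomial S with S(y) = 1 whose L(S^2) nearly attains it
    must be close to the minimizer K(y,.)/K(y,y).  Compare mu with the Chebyshev
    weight of the second kind, whose kernel is an explicit sum of cosines: near I the
    two differ by a nearly constant factor, and away from y they are decoupled by
    multiplying test polynomials by a factor (1 - (t - y)^2/4)^k with k << n, which is
    exponentially small there.  This factor wins because K_n(t,t) grows
    subexponentially on [-1,1]: regularity gives this through lower bounds for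
    |p_n| at complex points, averaged over the roots of unity.  The comparison yields
    the asymptotics of K(y,y), hence a near-extremal S, namely the Chebyshev kernel
    times such a factor, and so K(y,z)/K(y,y) tends to the sinc limit of S(z). *)
From HB Require Import structures.
Require Import Defs.
From mathcomp Require Import measurable_realfun complex ring lra.
Local Open Scope classical_set_scope.
Local Open Scope ring_scope.

(** The obstacle is the part of [-1,1] away from I, where mu is only known to be regular, a
    statement about leading coefficients. To reach values on [-1,1], take z = (u + 1/u)/2 with |u| =
    r < 1: each |p_n(z)| is at least r^(-n) up to powers of n, whatever the argument of u, while the
    product of |p_n|^2 over N + 1 such points, u times the roots of unity, is bounded above in terms
    of the leading coefficient. Dividing by N of the lower bounds isolates one value, whose
    exponential rate is close to 1 once r is close to 1 and N is large. The exponent k is n / h with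
    h fixed: the degree changes by a proportion of at most 2/h, while the factor still decays
    exponentially in n, at a rate depending on h. The admissible growth rate of K_n(t,t) is
    therefore chosen after h. Estimates keep two points apart: x in I, where the density is frozen,
    and y nearby, possibly outside I, because the shifted points may leave I. Uniformity in x is
    obtained by letting x run along an arbitrary sequence in I, so that the final limits are limits
    of real sequences. *)

(** * Orthonormal expansions, reproducing kernel and Christoffel function *)

Section Orthonormal.
Variables (R : realType) (L : {scalar {poly R}}) (p : nat -> {poly R}).
Hypothesis size_p : forall n, size (p n) = n.+1.
Hypothesis orth_p : forall n m, L (p n * p m) = (n == m)%:R.

Lemma graded_expansion n (P : {poly R}) : (size P <= n)%N ->
  exists c : nat -> R, P = \sum_(k < n) c k *: p k.
Proof.
elim: n P => [|n IH] P sP.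
  by exists (fun=> 0); rewrite big_ord0; apply/eqP; rewrite -size_poly_leq0.
have lp : lead_coef (p n) != 0 by rewrite lead_coef_eq0 -size_poly_gt0 size_p.
pose a := P`_n / lead_coef (p n).
have [|c Pc] := IH (P - a *: p n).
  apply/leq_sizeP => j; rewrite leq_eqVlt => /orP[/eqP <-|nj].
    rewrite coefB coefZ /a.
    have -> : (p n)`_n = lead_coef (p n) by rewrite lead_coefE size_p.
    by rewrite divfK// subrr.
  rewrite coefB coefZ !nth_default ?mulr0 ?subrr//.
    by rewrite size_p.
  by apply: leq_trans sP _.
exists (fun k => if k == n then a else c k).
rewrite big_ord_recr/= eqxx -[LHS](subrK (a *: p n)) Pc; congr (_ + _).
by apply: eq_bigr => i _; rewrite ltn_eqF.
Qed.

Lemma fourier_expansion n (P : {poly R}) : (size P <= n)%N ->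
  P = \sum_(k < n) L (P * p k) *: p k.
Proof.
move=> /graded_expansion [c Pc].
rewrite {1}Pc; apply: eq_bigr => j _; congr (_ *: _).
rewrite Pc mulr_suml linear_sum (bigD1 j)//= -scalerAl linearZ/= orth_p eqxx.
rewrite mulr1 big1 ?addr0// => i ij.
by rewrite -scalerAl linearZ/= orth_p val_eqE (negbTE ij) mulr0.
Qed.

Lemma parseval n (P Q : {poly R}) : (size P <= n)%N ->
  L (P * Q) = \sum_(k < n) L (P * p k) * L (Q * p k).
Proof.
move=> /fourier_expansion sP; rewrite {1}sP mulr_suml linear_sum.
by apply: eq_bigr => k _; rewrite -scalerAl linearZ/= [p k * Q]mulrC.
Qed.

Definition kernel_poly n (y : R) : {poly R} := \sum_(k < n) (p k).[y] *: p k.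

Lemma size_kernel_poly n y : (size (kernel_poly n y) <= n)%N.
Proof.
apply: (leq_trans (size_sum _ _ _)); apply/bigmax_leqP => i _.
by rewrite (leq_trans (size_scale_leq _ _))// size_p.
Qed.

Lemma horner_kernel_poly n y z : (kernel_poly n y).[z] = repro_kernel p n y z.
Proof.
rewrite /kernel_poly horner_sum; apply: eq_bigr => k _.
by rewrite hornerZ.
Qed.

Lemma reproducing n (P : {poly R}) y : (size P <= n)%N ->
  L (P * kernel_poly n y) = P.[y].
Proof.
move=> sP; rewrite mulr_sumr linear_sum {2}(fourier_expansion sP) horner_sum.
by apply: eq_bigr => k _; rewrite -scalerAr linearZ/= hornerZ mulrC.
Qed.

Lemma form_kernel_poly n y :
  L (kernel_poly n y * kernel_poly n y) = repro_kernel p n y y.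
Proof. by rewrite reproducing ?size_kernel_poly// horner_kernel_poly. Qed.

Lemma repro_kernel_ge0 n y : 0 <= repro_kernel p n y y.
Proof. by apply: sumr_ge0 => k _; rewrite -expr2 sqr_ge0. Qed.

Lemma repro_kernel_gt0 n y : (0 < n)%N -> 0 < repro_kernel p n y y.
Proof.
case: n => // n _; rewrite /repro_kernel big_ord_recl/=.
rewrite ltr_wpDr ?sumr_ge0// => [k _|]; first by rewrite -expr2 sqr_ge0.
rewrite -expr2 lt_def sqr_ge0 andbT sqrf_eq0.
have /eqP/size_poly1P [c c0 ->] := size_p 0.
by rewrite hornerC.
Qed.

Lemma sum_cauchy_schwarz n (u v : 'I_n -> R) :
  (\sum_k u k * v k) ^+ 2 <= (\sum_k u k ^+ 2) * (\sum_k v k ^+ 2).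
Proof.
set A := \sum_k u k ^+ 2; set B := \sum_k _ ^+ 2; set C := \sum_k _ * _.
have A0 : 0 <= A by apply: sumr_ge0 => k _; exact: sqr_ge0.
(* A (A B - C^2) is the squared length of A v - C u; the extra factor A avoids dividing by a
   possibly zero A. *)
have key : 0 <= A * (A * B - C ^+ 2).
  have -> : A * (A * B - C ^+ 2) = \sum_k (A * v k - C * u k) ^+ 2.
    have E (a c : R) : \sum_k (a * v k - c * u k) ^+ 2 =
        a ^+ 2 * B - (2 * a * c) * C + c ^+ 2 * A.
      rewrite !mulr_sumr -sumrB -big_split/=.
      by apply: eq_bigr => k _; ring.
    by rewrite E; ring.
  by apply: sumr_ge0 => k _; exact: sqr_ge0.
have [A_gt0|] := ltP 0 A.
  by move: key; rewrite pmulr_rge0// subr_ge0.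
move=> Ale0; have /eqP A00 : A == 0 by rewrite eq_le Ale0 A0.
have u0 k : u k = 0.
  apply/eqP; rewrite -sqrf_eq0; apply/eqP.
  by apply: (psumr_eq0P _ A00) => // i _; exact: sqr_ge0.
by rewrite A00 mul0r /C big1 ?expr0n// => k _; rewrite u0 mul0r.
Qed.

(** Cauchy-Schwarz between the coefficients of P and the values p_k(y): the half of the extremal
    property saying that no trial polynomial goes below 1/K(y,y). *)
Lemma christoffel_ineq n (P : {poly R}) y : (size P <= n)%N ->
  P.[y] ^+ 2 <= repro_kernel p n y y * L (P * P).
Proof.
move=> sP; rewrite (parseval _ sP) {1}(fourier_expansion sP) horner_sum.
under eq_bigr do rewrite hornerZ mulrC.
apply: le_trans (sum_cauchy_schwarz _ _) _.
by rewrite /repro_kernel; under eq_bigr do rewrite expr2;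
   under [X in _ * X <= _]eq_bigr do rewrite expr2.
Qed.

(* [S] and the extremal polynomial [K(y,.)/K(y,y)] of the Christoffel function
   differ, in the norm of [L], by exactly the excess [L(S^2) - 1/K(y,y)]. *)
Lemma near_extremal_approx n (S : {poly R}) y z : (0 < n)%N ->
  (size S <= n)%N -> S.[y] = 1 ->
  (S.[z] - repro_kernel p n y z / repro_kernel p n y y) ^+ 2 <=
  repro_kernel p n z z * (L (S * S) - (repro_kernel p n y y)^-1).
Proof.
move=> n0 sS Sy; set K := repro_kernel p n y y.
have K0 : K != 0 by rewrite gt_eqF// repro_kernel_gt0.
pose P := S - K^-1 *: kernel_poly n y.
have sP : (size P <= n)%N.
  rewrite (leq_trans (size_polyD _ _))// geq_max sS size_polyN.
  by rewrite (leq_trans (size_scale_leq _ _))// size_kernel_poly.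
have -> : S.[z] - repro_kernel p n y z / K = P.[z].
  by rewrite /P hornerD hornerN hornerZ horner_kernel_poly mulrC.
apply: le_trans (christoffel_ineq z sP) _; rewrite ler_wpM2l//.
  exact: repro_kernel_ge0.
have -> : P * P = S * S - (2 * K^-1) *: (S * kernel_poly n y)
     + (K^-1 ^+ 2) *: (kernel_poly n y * kernel_poly n y).
  rewrite /P !mulrBl !mulrBr -!scalerAr -!scalerAl scalerA -expr2.
  rewrite [kernel_poly n y * S]mulrC mulrDl mul1r scalerDl.
  by rewrite opprB opprD -!addrA; congr (_ + _); rewrite addrC -!addrA addrC !addrA.
have form_scale a X : L (a *: X) = a * L X by exact: linearZ.
rewrite linearD raddfB/= !form_scale form_kernel_poly reproducing// -/K Sy.
have -> : K^-1 ^+ 2 * K = K^-1 by rewrite expr2 -mulrA mulVf// mulr1.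
lra.
Qed.

(** Orthogonality to the earlier members leaves a single term a p_n in the expansion of q_n; then
    a^2 = 1, and the positive leading coefficients fix the sign. This identifies the sequence hidden
    in [regular_measure] with the given one. *)
Lemma orthonormal_unique (q : nat -> {poly R}) :
  (forall n, size (q n) = n.+1) ->
  (forall n m, L (q n * q m) = (n == m)%:R) ->
  (forall n, 0 < lead_coef (p n)) -> (forall n, 0 < lead_coef (q n)) ->
  forall n, q n = p n.
Proof.
move=> size_q orth_q lp lq; elim/ltn_ind => n IH.
have sq : (size (q n) <= n.+1)%N by rewrite size_q.
have E := fourier_expansion sq; rewrite big_ord_recr/= big1 in E; last first.
  by move=> i _; rewrite -(IH i)// orth_q gtn_eqF// scale0r.
rewrite add0r in E; set a := L _ in E.
have a2 : a ^+ 2 = 1.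
  have := orth_q n n; rewrite eqxx {1 2}E -scalerAl -scalerAr !linearZ/=.
  by rewrite orth_p eqxx mulr1 expr2.
have a0 : 0 < a.
  by have := lq n; rewrite E lead_coefZ pmulr_lgt0.
have /eqP a1 : a == 1 by rewrite -sqrp_eq1 ?ltW// a2.
by rewrite E a1 scale1r.
Qed.

End Orthonormal.

(** * Chebyshev polynomials of the second kind *)

Section ChebyshevU.
Variable R : comNzRingType.

(** Two consecutive polynomials are carried along to make the three-term recurrence structural. The
    ring is arbitrary because the polynomials are evaluated at real and at complex points. *)
Fixpoint chebU_pair (n : nat) : {poly R} * {poly R} :=
  if n is n'.+1 then
    let q := chebU_pair n' in (q.2, 2%:P * 'X * q.2 - q.1)
  else (1, 2%:P * 'X).

Definition chebU (n : nat) : {poly R} := (chebU_pair n).1.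

Lemma chebU0 : chebU 0 = 1. Proof. by []. Qed.

Lemma chebU1 : chebU 1 = 2%:P * 'X. Proof. by []. Qed.

Lemma chebUSS n : chebU n.+2 = 2%:P * 'X * chebU n.+1 - chebU n.
Proof. by []. Qed.

Lemma horner_chebUSS n x :
  (chebU n.+2).[x] = 2 * x * (chebU n.+1).[x] - (chebU n).[x].
Proof. by rewrite chebUSS hornerD hornerN !hornerM hornerC hornerX. Qed.

End ChebyshevU.

Arguments chebU {R}.

Lemma map_chebU (R S : comNzRingType) (f : {rmorphism R -> S}) n :
  map_poly f (chebU n) = chebU n.
Proof.
suff : map_poly f (chebU n) = chebU n /\ map_poly f (chebU n.+1) = chebU n.+1.
  by case.
elim: n => [|n [IH1 IH2]].
  by split; rewrite ?chebU0 ?chebU1 ?rmorph1// rmorphM/= map_polyC map_polyX/= rmorph_nat.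
split=> //; rewrite !chebUSS rmorphB !rmorphM/= map_polyC map_polyX/= rmorph_nat.
by rewrite IH1 IH2.
Qed.

(** * Orthogonality for the semicircle weight on [-1,1] *)

Section ChebyshevReal.
Variable R : realType.
Implicit Types (x t th : R).

Lemma size_chebU n : size (chebU n : {poly R}) = n.+1.
Proof.
elim/ltn_ind: n => -[|[|n]] IH.
- by rewrite chebU0 size_poly1.
- by rewrite chebU1 mul_polyC size_scale ?size_polyX// pnatr_eq0.
have S : size (2 *: ('X * chebU n.+1) : {poly R}) = n.+3.
  rewrite size_scale ?pnatr_eq0// mulrC size_mulX ?IH//.
  by rewrite -size_poly_gt0 IH.
rewrite chebUSS -mulrA mul_polyC size_polyDl S// size_polyN IH//.
Qed.

Lemma chebU_sin n th : (chebU n).[cos th] * sin th = sin (n.+1%:R * th).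
Proof.
elim/ltn_ind: n => -[|[|n]] IH.
- by rewrite chebU0 hornerC !mul1r.
- rewrite chebU1 hornerM hornerC hornerX.
  rewrite [2%:R * th]mulr_natl sin_mulr2n -mulr_natl; ring.
rewrite horner_chebUSS mulrBl -(mulrA (2 * cos th)) (IH n.+1)// (IH n)//.
have -> : n.+3%:R * th = n.+2%:R * th + th by rewrite -[n.+3]addn1 natrD mulrDl mul1r.
have -> : n.+1%:R * th = n.+2%:R * th - th.
  by rewrite -[n.+2]addn1 natrD mulrDl mul1r addrK.
rewrite sinB sinD; ring.
Qed.

(** A recurrence of first order without division by sin th: each step adds at most 1 to the modulus,
    which gives the bound n + 1 on all of [-1,1], endpoints included. *)
Lemma chebU_cos n th :
  (chebU n.+1).[cos th] = cos th * (chebU n).[cos th] + cos (n.+1%:R * th).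
Proof.
elim/ltn_ind: n => -[|[|n]] IH.
- by rewrite chebU1 chebU0 hornerM !hornerC hornerX mul1r mulr1; ring.
- rewrite horner_chebUSS chebU1 chebU0 hornerM !hornerC hornerX.
  by rewrite [2%:R * th]mulr_natl cos_mulr2n -mulr_natl; ring.
have H := horner_chebUSS n (cos th).
have E1 := IH n.+1 (ltnSn _); have E2 := IH n (ltnW (ltnSn _)).
rewrite horner_chebUSS.
have -> : n.+3%:R * th = n.+2%:R * th + th by rewrite -[n.+3]addn1 natrD mulrDl mul1r.
have F : n.+1%:R * th = n.+2%:R * th - th.
  by rewrite -[n.+2]addn1 natrD mulrDl mul1r addrK.
rewrite F cosB in E2; rewrite cosD.
have eC : cos (n.+2%:R * th) = (chebU n.+2).[cos th] - cos th * (chebU n.+1).[cos th].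
  by rewrite E1; ring.
have eS : sin (n.+2%:R * th) * sin th = (chebU n.+1).[cos th]
    - cos th * (chebU n).[cos th] - cos (n.+2%:R * th) * cos th by rewrite {1}E2; ring.
by rewrite eS eC H; ring.
Qed.

Lemma chebU_bound n t : t \in `[-1, 1] -> `|(chebU n).[t]| <= n.+1%:R.
Proof.
move=> t1; rewrite -[t]acosK//; set th := acos t.
elim: n => [|n IH]; first by rewrite chebU0 hornerC normr1.
rewrite chebU_cos (le_trans (ler_normD _ _))// -[n.+2%:R]natr1 lerD ?cos_max//.
by rewrite normrM (le_trans _ IH)// ler_piMl// cos_max.
Qed.

Local Notation leb := (@lebesgue_measure R).

Definition chebU_form (P : {poly R}) : R :=
  \int[leb]_(t in `[-1, 1]) (P.[t] * Num.sqrt (1 - t ^+ 2)).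

Lemma continuous_semicircle : continuous (fun t : R => Num.sqrt (1 - t ^+ 2)).
Proof.
move=> t; apply: continuous_comp; last exact: sqrt_continuous.
by apply: cvgB; [exact: cvg_cst|exact: exprn_continuous].
Qed.

Lemma continuous_poly_semicircle (P : {poly R}) :
  continuous (fun t : R => P.[t] * Num.sqrt (1 - t ^+ 2)).
Proof.
by move=> t; apply: cvgM; [exact: continuous_horner|exact: continuous_semicircle].
Qed.

Lemma integrable_poly_semicircle (P : {poly R}) :
  leb.-integrable `[-1, 1] (EFin \o (fun t : R => P.[t] * Num.sqrt (1 - t ^+ 2))).
Proof.
apply: continuous_compact_integrable; first exact: segment_compact.
by apply: continuous_subspaceT; exact: continuous_poly_semicircle.
Qed.

Lemma chebU_form_is_scalar : scalar chebU_form.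
Proof.
move=> a P Q; rewrite /chebU_form.
under eq_Rintegral do rewrite hornerD hornerZ mulrDl -mulrA.
rewrite RintegralD//=; last 2 first.
- have := integrable_poly_semicircle (a *: P).
  apply: eq_integrable => // x _ /=; by rewrite hornerZ mulrA.
- exact: integrable_poly_semicircle.
by rewrite RintegralZl//; exact: integrable_poly_semicircle.
Qed.

HB.instance Definition _ :=
  GRing.isLinear.Build R {poly R} R *%R chebU_form chebU_form_is_scalar.

Lemma sin_natpi n : sin (n%:R * pi : R) = 0.
Proof.
elim: n => [|n IH]; first by rewrite mul0r sin0.
by rewrite -natr1 mulrDl mul1r sinDpi IH oppr0.
Qed.

Lemma integral_cos (c : R) : c != 0 -> sin (c * pi) = 0 ->
  \int[leb]_(t in `[0, pi]) cos (c * t) = 0.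
Proof.
move=> c0 sc; rewrite /Rintegral.
have D (x : R) : is_derive x 1 (fun t : R => sin (c * t) / c) (cos (c * x)).
  have -> : (fun t : R => sin (c * t) / c) = c^-1 \*: (sin \o (c \*: id)).
    by apply/funext => t /=; rewrite mulrC.
  have D1 : is_derive x 1 (c \*: @id R) c.
    by apply: is_derive_eq; rewrite [LHS]mulr1.
  have D2 := is_deriveZ c^-1 (is_derive1_comp (is_derive_sin (c * x)) D1).
  by apply: (is_derive_eq D2); rewrite [LHS]mulrCA mulVf// mulr1.
have C : continuous (fun t : R => cos (c * t)).
  move=> t; apply: continuous_comp; last exact: continuous_cos.
  by apply: cvgM; [exact: cvg_cst|exact: cvg_id].
rewrite (@continuous_FTC2 _ _ (fun t => sin (c * t) / c)) ?pi_gt0//.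
- by rewrite /= sc mulr0 sin0 !mul0r subrr.
- exact: continuous_subspaceT.
- have cts x : {for x, continuous (fun t : R => sin (c * t) / c)}.
    apply: differentiable_continuous; apply/derivable1_diffP; exact: ex_derive.
  split.
  + by move=> x _; exact: ex_derive.
  + exact: cvg_at_right_filter (cts _).
  + exact: cvg_at_left_filter (cts _).
- by move=> x _; rewrite derive1E; exact: derive_val.
Qed.

(** With t = cos th the integrand becomes sin((k+1) th) sin((l+1) th), half the difference of the
    cosines of frequencies c = k - l and d = k + l + 2. Over [0,pi] a cosine of nonzero integer
    frequency integrates to 0. *)
Lemma chebU_form_orth k l :
  chebU_form (chebU k * chebU l) = (k == l)%:R * (pi / 2).
Proof.
have derive_cos : (@cos R)^`()%classic = - @sin R.
  by apply/funext => t; rewrite derive1E; exact: derive_val.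
rewrite /chebU_form /Rintegral.
have := @integration_by_substitution_decreasing R cos
  (fun t => (chebU k * chebU l).[t] * Num.sqrt (1 - t ^+ 2)) 0 pi (pi_ge0 R).
rewrite cospi cos0 => ->; last first.
- by apply: continuous_subspaceT; exact: continuous_poly_semicircle.
- split.
  + by move=> x _; exact: ex_derive.
  + by apply: cvg_at_right_filter; exact: continuous_cos.
  + by apply: cvg_at_left_filter; exact: continuous_cos.
- rewrite derive_cos; apply/cvg_ex; exists (- sin pi).
  by apply: cvg_at_left_filter; apply: cvgN; exact: continuous_sin.
- rewrite derive_cos; apply/cvg_ex; exists (- sin 0).
  by apply: cvg_at_right_filter; apply: cvgN; exact: continuous_sin.
- by move=> x _; rewrite derive_cos; apply: cvgN; exact: continuous_sin.
- by move=> x y x0 y0; rewrite ltr_cos.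
pose c : R := k.+1%:R - l.+1%:R; pose d : R := k.+1%:R + l.+1%:R.
have I (a : R) : leb.-integrable `[0, pi] (EFin \o (fun t : R => cos (a * t))).
  apply: continuous_compact_integrable; first exact: segment_compact.
  apply: continuous_subspaceT => t; apply: continuous_comp; last exact: continuous_cos.
  by apply: cvgM; [exact: cvg_cst|exact: cvg_id].
transitivity (\int[leb]_(t in `[0, pi]) ((cos (c * t) - cos (d * t)) * 2^-1)).
  congr fine; apply: eq_integral => t; rewrite inE/= in_itv/= => t0; congr EFin.
  rewrite !fctE derive_cos/= opprK -sin2cos2 sqrtr_sqr ger0_norm; last exact: sin_ge0_pi.
  rewrite hornerM; set s := sin t.
  transitivity (((chebU k).[cos t] * s) * ((chebU l).[cos t] * s)); first ring.
  have -> : c * t = k.+1%:R * t - l.+1%:R * t by rewrite /c mulrBl.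
  have -> : d * t = k.+1%:R * t + l.+1%:R * t by rewrite /d mulrDl.
  by rewrite !chebU_sin cosB cosD; field.
rewrite RintegralZr//=; last by exact: (integrableB _ (I c) (I d)).
rewrite RintegralB//.
have d0 : d != 0 by rewrite gt_eqF// addr_gt0// ltr0n.
rewrite (integral_cos d0) ?subr0; last by rewrite mulrDl sinD !sin_natpi !mul0r mulr0 addr0.
have [kl|kl] := eqVneq k l.
  rewrite /c kl subrr; under eq_Rintegral do rewrite mul0r cos0.
  rewrite Rintegral_cst//= lebesgue_measure_itv/= lte_fin pi_gt0 -EFinB/=; ring.
rewrite integral_cos ?mul0r//.
  by rewrite subr_eq0 eqr_nat eqSS.
by rewrite mulrBl sinB !sin_natpi !mul0r mulr0 subr0.
Qed.

(** The factor normalizes the squared norm pi / 2 of [chebU n]. *)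
Definition chebU_on (n : nat) : {poly R} := Num.sqrt (2 / pi) *: chebU n.

Lemma size_chebU_on n : size (chebU_on n) = n.+1.
Proof.
rewrite size_scale ?size_chebU// sqrtr_eq0 -ltNge divr_gt0//.
by rewrite pi_gt0.
Qed.

Lemma chebU_on_orth n m : chebU_form (chebU_on n * chebU_on m) = (n == m)%:R.
Proof.
rewrite -scalerAl -scalerAr !linearZ/= chebU_form_orth mulrA -expr2 sqr_sqrtr.
  have p0 : pi != 0 :> R by rewrite gt_eqF// pi_gt0.
  by rewrite mulrCA (mulrA (2 / pi)) divfK// divff ?mulr1// pnatr_eq0.
by rewrite divr_ge0// pi_ge0.
Qed.

End ChebyshevReal.

(** * From setwise comparison of measures to integrals *)

Section MeasureComparison.
Local Open Scope ereal_scope.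
Context d (T : measurableType d) (R : realType).
Import HBNNSimple.

(** The level sets of g leave integrals of h alone over measurable subsets of J, the quantities that
    a setwise comparison controls. *)
Lemma integral_nnsfunM (mu : {measure set T -> \bar R}) (J : set T)
    (g : {nnsfun T >-> R}) (h : T -> R) :
  measurable J -> measurable_fun setT h -> (forall x, (0 <= h x)%R) ->
  \int[mu]_(x in J) ((g x * h x)%R)%:E =
  \sum_(y \in range g) (y%:E * \int[mu]_(x in J `&` g @^-1` [set y]) (h x)%:E).
Proof.
move=> mJ mh h0.
transitivity (\int[mu]_(x in J) (\sum_(y \in range g)
    (y * \1_(g @^-1` [set y]) x)%:E * (h x)%:E)).
  apply: eq_integral => x _; rewrite EFinM [in LHS](fimfunE g x) -fsumEFin//.
  by rewrite ge0_mule_fsuml// => y; exact: nnfun_muleindic_ge0.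
have mind r : measurable_fun J (fun x => ((r * \1_(g @^-1` [set r]) x)%R)%:E).
  by apply/measurable_EFinP; apply: measurable_funTS; exact: measurable_funM.
have mhJ (A : set T) : measurable_fun A (fun x => (h x)%:E).
  by apply/measurable_EFinP; exact: measurable_funTS.
rewrite ge0_integral_fsum//; last 2 first.
- by move=> y; exact: emeasurable_funM.
- by move=> y x _; apply: mule_ge0; [exact: nnfun_muleindic_ge0|rewrite lee_fin].
apply: eq_fsbigr => y; rewrite inE => -[t _ <-].
under eq_integral do rewrite EFinM -muleA.
rewrite ge0_integralZl//; last 3 first.
- by apply: emeasurable_funM => //; apply/measurable_EFinP; exact: measurable_funTS.
- by move=> x _; rewrite mule_ge0 ?lee_fin.
- by rewrite lee_fin.
congr (_ * _); rewrite [RHS]integral_mkcondr; apply: eq_integral => x _.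
by rewrite muleC epatch_indic.
Qed.

(** The setwise inequality passes to simple functions by level sets and to f by monotone
    convergence. Two densities are allowed so that mu, with density 1, can be compared in either
    direction with a multiple of the semicircle weight. *)
Lemma le_integral_density (mu1 mu2 : {measure set T -> \bar R}) (J : set T)
    (f h1 h2 : T -> R) :
  measurable J -> measurable_fun J f -> (forall x, J x -> (0 <= f x)%R) ->
  measurable_fun setT h1 -> (forall x, (0 <= h1 x)%R) ->
  measurable_fun setT h2 -> (forall x, (0 <= h2 x)%R) ->
  (forall A, measurable A -> A `<=` J ->
    \int[mu1]_(x in A) (h1 x)%:E <= \int[mu2]_(x in A) (h2 x)%:E) ->
  \int[mu1]_(x in J) ((f x * h1 x)%R)%:E <= \int[mu2]_(x in J) ((f x * h2 x)%R)%:E.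
Proof.
move=> mJ mf f0 mh1 h10 mh2 h20 H.
have mfE : measurable_fun J (EFin \o f) by exact/measurable_EFinP.
pose g := nnsfun_approx mJ mfE.
have E (mu : {measure set T -> \bar R}) (h : T -> R) : measurable_fun setT h ->
    (forall x, (0 <= h x)%R) -> \int[mu]_(x in J) ((f x * h x)%R)%:E =
    limn (fun n => \int[mu]_(x in J) ((g n x * h x)%R)%:E)
    /\ cvgn (fun n => \int[mu]_(x in J) ((g n x * h x)%R)%:E).
  move=> mh h0.
  have mgh n : measurable_fun J (fun x => ((g n x * h x)%R)%:E).
    apply/measurable_EFinP; apply: measurable_funM; last exact: measurable_funTS.
    by apply: measurable_funTS.
  have gh0 n x : J x -> 0 <= ((g n x * h x)%R)%:E.
    by move=> _; rewrite lee_fin mulr_ge0.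
  have nd x : J x -> {homo (fun n => ((g n x * h x)%R)%:E) : a b / (a <= b)%N >-> a <= b}.
    move=> _ a b ab; rewrite lee_fin ler_wpM2r//.
    exact/lefP/nd_nnsfun_approx.
  have fE x : J x -> ((f x * h x)%R)%:E = limn (fun n => ((g n x * h x)%R)%:E).
    move=> Jx; apply/esym/cvg_lim => //.
    under eq_fun do rewrite EFinM.
    rewrite EFinM; apply: cvgeZr => //.
    have fE0 y : J y -> 0 <= (EFin \o f) y by move=> Jy; rewrite lee_fin f0.
    exact: (cvg_nnsfun_approx mJ mfE fE0 Jx).
  split.
    rewrite -(monotone_convergence _ mJ mgh gh0 nd).
    by apply: eq_integral => x; rewrite inE => /fE.
  apply: ereal_nondecreasing_is_cvgn => a b ab.
  by apply: ge0_le_integral => // x Jx; [exact: gh0|exact: nd].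
have [-> c1] := E mu1 h1 mh1 h10; have [-> c2] := E mu2 h2 mh2 h20.
apply: lee_lim => //; apply: nearW => n.
rewrite !integral_nnsfunM//; apply: lee_fsum => // _ [t _ <-].
rewrite lee_wpmul2l ?lee_fin//; apply: H.
- exact: measurableI.
- exact: subIsetl.
Qed.

End MeasureComparison.

(** * The form of mu and its local comparison with the Chebyshev form *)

Section MuForm.
Variables (R : realType) (mu : {finite_measure set (measurableTypeR R) -> \bar R}).
Local Notation leb := (@lebesgue_measure R).
Local Notation rootw := (fun t : R => Num.sqrt (1 - t ^+ 2)).

Definition mu_form (P : {poly R}) : R := \int[mu]_(x in `]-1, 1[) P.[x].

Lemma integrable_poly (P : {poly R}) (A : set R) : measurable A ->
  A `<=` `[-1, 1] -> mu.-integrable A (EFin \o (fun x => P.[x])).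
Proof.
move=> mA A1; apply: measurable_bounded_integrable => //.
- by rewrite ltey_eq fin_num_measure.
- apply: measurable_funTS; apply: continuous_measurable_fun; exact: continuous_horner.
- have : {within `[-1, 1], continuous (fun x : R => P.[x])}.
    by apply: continuous_subspaceT; exact: continuous_horner.
  move=> /continuous_compact /(_ (@segment_compact R (-1) 1)) /compact_bounded.
  move=> [M [Mr HM]]; exists M; split=> // y My x Ax.
  by apply: HM => //; exists x => //; exact: A1.
Qed.

Lemma mu_form_is_scalar : scalar mu_form.
Proof.
have I (P : {poly R}) : mu.-integrable `]-1, 1[ (EFin \o (fun x => P.[x])).
  by apply: integrable_poly => //; exact: subset_itv_oo_cc.
move=> a P Q; rewrite /mu_form.
under eq_Rintegral do rewrite hornerD hornerZ.
rewrite RintegralD//=; last first.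
  rewrite (_ : (fun x : R => a * P.[x]) = (fun x => (a *: P).[x])); first exact: I.
  by apply/funext => x; rewrite hornerZ.
by rewrite RintegralZl//; exact: I.
Qed.

HB.instance Definition _ :=
  GRing.isLinear.Build R {poly R} R *%R mu_form mu_form_is_scalar.

Lemma mu_form_ge0 (P : {poly R}) : (forall x, x \in `[-1, 1] -> 0 <= P.[x]) ->
  0 <= mu_form P.
Proof.
move=> P0; apply: Rintegral_ge0 => x /= x1; apply: P0.
by move: x1; rewrite !in_itv/= => /andP[/ltW -> /ltW ->].
Qed.

Section Compare.
Variables (u v c : R).
Hypothesis uv : `]u, v[ `<=` (`]-1, 1[ : set R).
Hypothesis c0 : 0 <= c.
Local Notation J := [set` `]u, v[].

Lemma semicircle_ge0 (t : R) : 0 <= rootw t. Proof. exact: sqrtr_ge0. Qed.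

Lemma semicircle_le1 (t : R) : rootw t <= 1.
Proof. by rewrite -[leRHS]sqrtr1 ler_sqrt// lerBlDr lerDl sqr_ge0. Qed.

Let mroot : measurable_fun setT (fun t : R => c * rootw t).
Proof.
apply: measurable_funM => //.
by apply: continuous_measurable_fun; exact: continuous_semicircle.
Qed.

Let root0 (t : R) : 0 <= c * rootw t.
Proof. by rewrite mulr_ge0// semicircle_ge0. Qed.

Let mP (P : {poly R}) : measurable_fun J (fun x => P.[x]).
Proof.
by apply: measurable_funTS; apply: continuous_measurable_fun; exact: continuous_horner.
Qed.

Let J1 : J `<=` `[-1, 1].
Proof. by move=> x /uv; exact: subset_itv_oo_cc. Qed.

Let intJ (P : {poly R}) (A : set R) : measurable A -> A `<=` `[-1, 1] ->
  leb.-integrable A (EFin \o (fun t : R => P.[t] * rootw t)).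
Proof.
move=> mA A1; apply: (@integrableS _ _ _ leb _ _ _ (measurable_itv `[-1, 1]) mA A1).
exact: integrable_poly_semicircle.
Qed.

(** On J the measure dominates c times the Chebyshev weight. Off J the integrand is at most B, and 2
    is the length of [-1,1], the semicircle being at most 1. *)
Lemma chebU_form_le (P : {poly R}) (B : R) :
  (forall A, measurable A -> A `<=` J ->
     (\int[leb]_(x in A) (c * rootw x)%:E <= mu A)%E) ->
  (forall x, x \in `[-1, 1] -> 0 <= P.[x]) -> 0 <= B ->
  (forall x, x \in `[-1, 1] -> x \notin `]u, v[ -> P.[x] <= B) ->
  c * chebU_form P <= mu_form P + c * (2 * B).
Proof.
move=> H P0 B0 PB.
have P0J x : J x -> 0 <= P.[x] by move=> /J1; exact: P0.
have -> : chebU_form P = \int[leb]_(x in J) (P.[x] * rootw x)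
    + \int[leb]_(x in `[-1, 1] `\` J) (P.[x] * rootw x).
  rewrite -Rintegral_setU//.
  - by rewrite /chebU_form setDUK.
  - exact: measurableD.
  - by rewrite setDUK//; exact: integrable_poly_semicircle.
  - by apply/disj_setPS; rewrite setIC setDKI.
rewrite mulrDr lerD//.
  rewrite -RintegralZl//; last exact: intJ.
  apply: (@le_trans _ _ (\int[mu]_(x in J) P.[x])); last first.
    rewrite /mu_form /Rintegral fine_le//.
    - by apply: integrable_fin_num => //; exact: integrable_poly.
    - apply: integrable_fin_num => //; apply: integrable_poly => //.
      exact: subset_itv_oo_cc.
    - apply: ge0_subset_integral => //.
      + apply/measurable_EFinP; apply: measurable_funTS.
        by apply: continuous_measurable_fun; exact: continuous_horner.
      + by move=> x /subset_itv_oo_cc x1; rewrite lee_fin P0.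
  have -> : \int[leb]_(x in J) (c * (P.[x] * rootw x)) =
      \int[leb]_(x in J) (P.[x] * (c * rootw x)).
    by apply: eq_Rintegral => x _; rewrite mulrCA.
  have -> : \int[mu]_(x in J) P.[x] = \int[mu]_(x in J) (P.[x] * 1).
    by apply: eq_Rintegral => x _; rewrite mulr1.
  rewrite /Rintegral fine_le//.
  - apply: integrable_fin_num => //.
    have := intJ (c *: P) (measurable_itv `]u, v[) J1.
    by apply: eq_integrable => // x _ /=; rewrite hornerZ mulrCA mulrA.
  - apply: integrable_fin_num => //.
    have := integrable_poly P (measurable_itv `]u, v[) J1.
    by apply: eq_integrable => // x _ /=; rewrite mulr1.
  - apply: le_integral_density => //; first exact: mP.
    by move=> A mA AJ; rewrite integral_cst// mul1e; exact: H.
rewrite ler_wpM2l//.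
set D := (X in \int[leb]_(x in X) _).
have mD : measurable D by exact: measurableD.
have lD : (leb D <= 2%:E)%E.
  apply: (@le_trans _ _ (leb `[-1, 1])).
    by apply: le_measure; rewrite ?inE//; exact: subDsetl.
  by rewrite lebesgue_measure_itv/= lte_fin gt0_cp// -EFinB lee_fin opprK.
apply: (@le_trans _ _ (\int[leb]_(x in D) B)).
  apply: le_Rintegral => //.
  - by apply: intJ => //; exact: subDsetl.
  - apply: (@integrableS _ _ _ leb _ _ _ (measurable_itv `[-1, 1]) mD).
      exact: subDsetl.
    apply: continuous_compact_integrable; first exact: segment_compact.
    by apply: continuous_subspaceT => ?; exact: cvg_cst.
  - move=> x [x1 xJ]; rewrite (@le_trans _ _ (P.[x] * 1))//.
      by rewrite ler_wpM2l ?P0// semicircle_le1.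
    by rewrite mulr1 PB//; apply/negP.
rewrite Rintegral_cst// mulrC ler_wpM2r// -[leRHS]/(fine 2%:E) fine_le//.
by rewrite ge0_fin_numE// (le_lt_trans lD)// ltry.
Qed.

(** Mirror image of [chebU_form_le]: off J the bound B now meets the total mass of mu. *)
Lemma mu_form_le (P : {poly R}) (B : R) :
  (forall A, measurable A -> A `<=` J ->
     (mu A <= \int[leb]_(x in A) (c * rootw x)%:E)%E) ->
  (forall x, x \in `[-1, 1] -> 0 <= P.[x]) -> 0 <= B ->
  (forall x, x \in `[-1, 1] -> x \notin `]u, v[ -> P.[x] <= B) ->
  mu_form P <= c * chebU_form P + B * fine (mu setT).
Proof.
move=> H P0 B0 PB.
have mD : measurable (`]-1, 1[ `\` J : set R) by exact: measurableD.
have D1 : (`]-1, 1[ `\` J : set R) `<=` `[-1, 1].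
  by move=> x [x1 _]; exact: subset_itv_oo_cc.
have -> : mu_form P = \int[mu]_(x in J) P.[x]
    + \int[mu]_(x in `]-1, 1[ `\` J) P.[x].
  rewrite -Rintegral_setU//.
  - by rewrite /mu_form setDUK.
  - rewrite setDUK//; apply: integrable_poly => //; exact: subset_itv_oo_cc.
  - by apply/disj_setPS; rewrite setIC setDKI.
rewrite lerD//.
  apply: (@le_trans _ _ (\int[leb]_(x in J) (c * (P.[x] * rootw x)))).
    have -> : \int[leb]_(x in J) (c * (P.[x] * rootw x)) =
        \int[leb]_(x in J) (P.[x] * (c * rootw x)).
      by apply: eq_Rintegral => x _; rewrite mulrCA.
    have -> : \int[mu]_(x in J) P.[x] = \int[mu]_(x in J) (P.[x] * 1).
      by apply: eq_Rintegral => x _; rewrite mulr1.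
    rewrite /Rintegral fine_le//.
    - apply: integrable_fin_num => //.
      have := integrable_poly P (measurable_itv `]u, v[) J1.
      by apply: eq_integrable => // x _ /=; rewrite mulr1.
    - apply: integrable_fin_num => //.
      have := intJ (c *: P) (measurable_itv `]u, v[) J1.
      by apply: eq_integrable => // x _ /=; rewrite hornerZ mulrCA mulrA.
    - have P0J x : J x -> 0 <= P.[x] by move=> /J1; exact: P0.
      apply: le_integral_density => //; first exact: mP.
      + move=> A mA AJ; by rewrite integral_cst// mul1e; exact: H.
  rewrite RintegralZl//; last exact: intJ.
  rewrite ler_wpM2l// /chebU_form /Rintegral fine_le//.
  - by apply: integrable_fin_num => //; exact: intJ.
  - by apply: integrable_fin_num => //; exact: intJ.
  - apply: ge0_subset_integral => //.
    + by apply: (measurable_int leb); exact: intJ.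
    + by move=> x x1; rewrite lee_fin mulr_ge0 ?P0 ?semicircle_ge0.
apply: (@le_trans _ _ (\int[mu]_(x in `]-1, 1[ `\` J) B)).
  apply: le_Rintegral => //.
  - exact: integrable_poly.
  - have := integrable_poly B%:P mD D1.
    by apply: eq_integrable => // x _ /=; rewrite hornerC.
  - move=> x [x1 xJ]; apply: PB; first exact: subset_itv_oo_cc.
    by apply/negP.
rewrite Rintegral_cst// ler_wpM2l// fine_le ?fin_num_measure//.
by apply: le_measure; rewrite ?inE.
Qed.

End Compare.

(** The singular part can only add mass. *)
Lemma density_lower_bound (w : R -> R) (u v c : R) :
  ac_density mu w -> `]u, v[ `<=` (`]-1, 1[ : set R) -> 0 <= c ->
  (forall t, t \in `]u, v[ -> c * rootw t <= w t) ->
  forall A, measurable A -> A `<=` `]u, v[ ->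
     (\int[leb]_(x in A) (c * rootw x)%:E <= mu A)%E.
Proof.
move=> [mw w0 [sing _ muE]] uv c0 cw A mA AJ.
rewrite (muE A mA); last exact: subset_trans AJ uv.
apply: (@le_trans _ _ (\int[leb]_(x in A) (w x)%:E)%E); last by rewrite leeDl.
apply: ge0_le_integral => //.
- by move=> x _; rewrite lee_fin mulr_ge0// sqrtr_ge0.
- apply/measurable_EFinP; apply: measurable_funTS; apply: measurable_funM => //.
  by apply: continuous_measurable_fun; exact: continuous_semicircle.
- apply/measurable_EFinP; apply: (measurable_funS _ _ mw) => //.
  exact: subset_trans AJ uv.
- by move=> x Ax; rewrite lee_fin cw//; exact: AJ.
Qed.

(** Here the singular part has to vanish on A: it lives on a Lebesgue-null set N, is at most mu, and
    mu is absolutely continuous on ]a, b[. *)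
Lemma density_upper_bound (w : R -> R) (u v c a b : R) :
  ac_density mu w -> `]u, v[ `<=` (`]-1, 1[ : set R) ->
  mrestr mu (measurable_itv `]a, b[) `<< leb ->
  `]u, v[ `<=` (`]a, b[ : set R) ->
  (forall t, t \in `]u, v[ -> w t <= c * rootw t) ->
  forall A, measurable A -> A `<=` `]u, v[ ->
     (mu A <= \int[leb]_(x in A) (c * rootw x)%:E)%E.
Proof.
move=> [mw w0 [sing [N [mN lebN singN]] muE]] uv ac uvab cw A mA AJ.
have A1 : A `<=` `]-1, 1[ by exact: subset_trans AJ uv.
have sA : sing A = 0%E.
  apply/eqP; rewrite eq_le measure_ge0 andbT.
  apply: (@le_trans _ _ (sing (A `&` N) + sing (A `\` N))%E).
    by rewrite (measureDI sing mA mN) addeC.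
  have -> : sing (A `\` N) = 0%E.
    apply/eqP; rewrite eq_le measure_ge0 andbT -singN.
    apply: le_measure; rewrite ?inE//; first by apply: measurableD.
      exact: measurableC.
  rewrite adde0; have mAN : measurable (A `&` N) by exact: measurableI.
  apply: (@le_trans _ _ (mu (A `&` N))).
    rewrite (muE _ mAN); last by move=> x [/A1].
    by rewrite leeDr// integral_ge0// => x [/A1 x1 _]; rewrite lee_fin w0.
  have /null_content_dominatesP := ac.
  move=> /(_ (A `&` N) mAN).
  have AN : A `&` N `&` `]a, b[ = A `&` N.
    by apply: setIidl => x [/AJ /uvab].
  rewrite /mrestr AN.
  move=> -> //; apply/eqP; rewrite eq_le measure_ge0 andbT -lebN.
  by apply: le_measure; rewrite ?inE//; exact: subIsetr.
rewrite (muE A mA A1) sA adde0.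
apply: ge0_le_integral => //.
- by move=> x Ax; rewrite lee_fin w0//; exact: A1.
- by apply/measurable_EFinP; apply: (measurable_funS _ A1 mw).
- apply/measurable_EFinP; apply: measurable_funTS; apply: measurable_funM => //.
  by apply: continuous_measurable_fun; exact: continuous_semicircle.
- by move=> x Ax; rewrite lee_fin cw//; exact: AJ.
Qed.

End MuForm.

(** * Elementary exponential growth *)

Section GrowthRates.
Variable R : realType.

(** Take N successive square roots, since N <= 2^N. This splits a growth rate into N equal shares
    without real exponents. *)
Lemma root_gt1 (a : R) N : 1 < a -> exists2 t, 1 < t & t ^+ N <= a.
Proof.
move=> a1; have [t t1 ta] : exists2 t, 1 < t & t ^+ (2 ^ N) = a.
  elim: N => [|N [t t1 ta]]; first by exists a; rewrite ?expn0 ?expr1.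
  exists (Num.sqrt t); first by rewrite -[ltLHS]sqrtr1 ltr_sqrt// (lt_trans _ t1).
  by rewrite expnS exprM sqr_sqrtr// ltW// (lt_trans _ t1).
exists t => //; rewrite -ta ler_eXn2l// ltnW// ltn_expl//.
Qed.

(** C = 1 + 1/(a - 1) comes from Bernoulli's inequality a^n >= 1 + n (a - 1). *)
Lemma linear_le_exp (a : R) : 1 < a -> exists2 C, 0 < C & forall n, n.+1%:R <= C * a ^+ n.
Proof.
move=> a1; have h0 : 0 < a - 1 by rewrite subr_gt0.
have B n : 1 + n%:R * (a - 1) <= a ^+ n.
  elim: n => [|n IH]; first by rewrite mul0r addr0 expr0.
  rewrite exprS; apply: (@le_trans _ _ (a * (1 + n%:R * (a - 1)))).
    rewrite -natr1 -subr_ge0.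
    have -> : a * (1 + n%:R * (a - 1)) - (1 + (n%:R + 1) * (a - 1)) =
      n%:R * (a - 1) ^+ 2 by ring.
    by rewrite mulr_ge0// sqr_ge0.
  by rewrite ler_wpM2l// ltW// (lt_trans _ a1).
exists (1 + (a - 1)^-1); first by rewrite addr_gt0// invr_gt0.
move=> n; apply: (@le_trans _ _ ((1 + (a - 1)^-1) * (1 + n%:R * (a - 1)))).
  have -> : (1 + (a - 1)^-1) * (1 + n%:R * (a - 1)) =
     n%:R + 1 + ((a - 1)^-1 + n%:R * (a - 1)).
    have : a - 1 != 0 by rewrite gt_eqF.
    by move=> ?; field.
  by rewrite natr1 lerDl addr_ge0 ?invr_ge0 ?mulr_ge0 ?ler0n// ltW.
by rewrite ler_wpM2l// addr_ge0// invr_ge0 ltW.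
Qed.

Lemma poly_le_exp (a : R) k : 1 < a ->
  exists2 C, 0 < C & forall n, n.+1%:R ^+ k <= C * a ^+ n.
Proof.
move=> a1; have [t t1 ta] := root_gt1 k a1.
have [C C0 HC] := linear_le_exp t1.
exists (C ^+ k); first exact: exprn_gt0.
move=> n; apply: (@le_trans _ _ ((C * t ^+ n) ^+ k)).
  by rewrite lerXn2r// ?nnegrE// mulr_ge0 ?exprn_ge0// ltW// (lt_trans _ t1).
rewrite exprMn ler_pM2l ?exprn_gt0// -exprM mulnC exprM lerXn2r// nnegrE ?exprn_ge0// ltW//.
  by rewrite (lt_trans _ t1).
by rewrite (lt_trans _ a1).
Qed.

Lemma exp_small (r e : R) : 0 < r < 1 -> 0 < e -> exists N, r ^+ N.+1 <= e.
Proof.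
move=> /andP[r0 r1] e0.
have : (GRing.exp r) @ \oo --> (0 : R) by apply: cvg_expr; rewrite gtr0_norm.
move=> /cvgrPdist_le /(_ e e0) [N _ HN]; exists N.
have := HN N.+1 (leqnSn _); rewrite /= sub0r normrN ger0_norm// exprn_ge0// ltW//.
Qed.

End GrowthRates.

(** * Squared modulus and the Joukowski map *)

Section SquaredModulus.
Variable R : realType.
Local Notation C := (R[i]).
Implicit Types (u v w z : C).

(** The modulus is squared and real-valued, so that products, inverses and comparisons stay in R
    without square roots. *)
Definition sqmod z : R := complex.Re z ^+ 2 + complex.Im z ^+ 2.

Lemma sqmodM u v : sqmod (u * v) = sqmod u * sqmod v.
Proof. by case: u v => [a b] [c d]; rewrite /sqmod /=; ring. Qed.

Lemma sqmod1 : sqmod 1 = 1.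
Proof. by rewrite /sqmod /= expr0n addr0 expr1n. Qed.

Lemma sqmod_ge0 z : 0 <= sqmod z. Proof. by rewrite addr_ge0// sqr_ge0. Qed.

Lemma sqmod_eq0 z : (sqmod z == 0) = (z == 0).
Proof.
by case: z => a b; rewrite /sqmod/= eq_complex/= paddr_eq0 ?sqr_ge0// !sqrf_eq0.
Qed.

Lemma sqmod_gt0 z : (0 < sqmod z) = (z != 0).
Proof. by rewrite lt_def sqmod_ge0 andbT sqmod_eq0. Qed.

Lemma sqmodN z : sqmod (- z) = sqmod z.
Proof. by case: z => a b; rewrite /sqmod/= !sqrrN. Qed.

Lemma sqmodX z n : sqmod (z ^+ n) = sqmod z ^+ n.
Proof. by elim: n => [|n IH]; rewrite ?sqmod1// !exprS sqmodM IH. Qed.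

Lemma sqmodV z : sqmod z^-1 = (sqmod z)^-1.
Proof.
have [->|z0] := eqVneq z 0; first by rewrite invr0 /sqmod/= expr0n addr0 invr0.
apply: (mulfI (x := sqmod z)); first by rewrite sqmod_eq0.
by rewrite -sqmodM !mulfV ?sqmod1// sqmod_eq0.
Qed.

Lemma sqmod_prod (I : Type) (s : seq I) (F : I -> C) :
  sqmod (\prod_(i <- s) F i) = \prod_(i <- s) sqmod (F i).
Proof. exact: (big_morph sqmod sqmodM sqmod1). Qed.

Lemma sqmod_real (x : R) : sqmod x%:C%C = x ^+ 2.
Proof. by rewrite /sqmod/= expr0n addr0. Qed.

Lemma sqmod_sub_real z (x : R) :
  sqmod (z - x%:C%C) = (complex.Re z - x) ^+ 2 + complex.Im z ^+ 2.
Proof. by case: z => a b; rewrite /sqmod/= subr0. Qed.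

Lemma Re_bound z s : 0 <= s -> sqmod z = s ^+ 2 -> `|complex.Re z| <= s.
Proof.
move=> s0 zs; rewrite -[s]ger0_norm// -ler_sqr ?nnegrE// !real_normK ?num_real//.
by rewrite -zs lerDl sqr_ge0.
Qed.

Lemma sqmod_1sub_le z s : 0 <= s -> sqmod z = s ^+ 2 -> sqmod (1 - z) <= (1 + s) ^+ 2.
Proof.
move=> s0 zs; have := Re_bound s0 zs; rewrite ler_norml => /andP[h _].
have -> : sqmod (1 - z) = 1 - 2 * complex.Re z + sqmod z.
  by case: z {zs h} => a b; rewrite /sqmod /=; ring.
by rewrite zs; lra.
Qed.

Lemma sqmod_1sub_ge z s : 0 <= s -> sqmod z = s ^+ 2 -> (1 - s) ^+ 2 <= sqmod (1 - z).
Proof.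
move=> s0 zs; have := Re_bound s0 zs; rewrite ler_norml => /andP[_ h].
have -> : sqmod (1 - z) = 1 - 2 * complex.Re z + sqmod z.
  by case: z {zs h} => a b; rewrite /sqmod /=; ring.
by rewrite zs; lra.
Qed.

(** For 0 < r < 1 it maps the circle |u| = r onto an ellipse with foci -1 and 1 surrounding
    [-1,1]. *)
Definition joukowski u : C := (u + u^-1) / 2.

(** The point exp(i acos c), for c in [-1,1]. *)
Definition unit_circle (c : R) : C := Complex c (Num.sqrt (1 - c ^+ 2)).

Lemma itv_sqr_le1 (c : R) : c \in `[-1, 1] -> c ^+ 2 <= 1.
Proof. by rewrite in_itv/= => /andP[c1 c2]; nra. Qed.

Lemma sqmod_unit_circle c : c \in `[-1, 1] -> sqmod (unit_circle c) = 1.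
Proof.
by move=> /itv_sqr_le1 c1; rewrite /sqmod/= sqr_sqrtr ?subrKC// subr_ge0.
Qed.

(** Writing c = (w + 1/w)/2 with w on the unit circle separates u from c multiplicatively: for |u| =
    r < 1 both factors have modulus between 1 - r and 1 + r, and their products over roots of unity
    are explicit. *)
Lemma joukowski_sub u (c : R) : u != 0 -> c \in `[-1, 1] ->
  joukowski u - c%:C%C =
  (1 - u * unit_circle c) * (1 - u * (unit_circle c)^-1) / (2 * u).
Proof.
move=> u0 c1; set w := unit_circle c.
have w0 : w != 0 by rewrite -sqmod_gt0 sqmod_unit_circle.
have wV : w^-1 = Complex c (- Num.sqrt (1 - c ^+ 2)).
  apply: (mulfI w0); rewrite mulfV//; apply/eqP; rewrite eq_complex/=.
  have := sqmod_unit_circle c1; rewrite /sqmod/= => E.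
  by apply/andP; split; apply/eqP; [rewrite -[LHS]E|]; ring.
have wc : w + w^-1 = 2 * c%:C%C.
  by rewrite wV; apply/eqP; rewrite eq_complex/=; apply/andP; split; apply/eqP; ring.
have -> : (1 - u * w) * (1 - u * w^-1) = 1 - u * (w + w^-1) + u ^+ 2.
  by field.
rewrite wc /joukowski; field.
exact: u0.
Qed.

Lemma sqmod_joukowski_sub u (c r : R) : 0 < r -> sqmod u = r ^+ 2 -> c \in `[-1, 1] ->
  sqmod (joukowski u - c%:C%C) =
  sqmod (1 - u * unit_circle c) * sqmod (1 - u * (unit_circle c)^-1) / (2 * r) ^+ 2.
Proof.
move=> r0 ur c1; have u0 : u != 0 by rewrite -sqmod_gt0 ur exprn_gt0.
rewrite joukowski_sub// !sqmodM sqmodV sqmodM ur exprMn; congr (_ / (_ * _)).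
by rewrite /sqmod/= addr0 expr0n addr0.
Qed.

Lemma sqmod_unit_mul u (c r : R) k : sqmod u = r ^+ 2 -> c \in `[-1, 1] ->
  sqmod ((u * unit_circle c) ^+ k) = (r ^+ k) ^+ 2
  /\ sqmod ((u / unit_circle c) ^+ k) = (r ^+ k) ^+ 2.
Proof.
move=> ur c1; rewrite !sqmodX !sqmodM sqmodV sqmod_unit_circle// invr1 mulr1 ur.
by rewrite -!exprM mulnC.
Qed.

Lemma sqmod_joukowski_sub_ge u (c r : R) : 0 < r < 1 -> sqmod u = r ^+ 2 ->
  c \in `[-1, 1] -> (1 - r) ^+ 4 / (2 * r) ^+ 2 <= sqmod (joukowski u - c%:C%C).
Proof.
move=> /andP[r0 r1] ur c1; rewrite (sqmod_joukowski_sub r0)//.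
have [] := sqmod_unit_mul 1 ur c1; rewrite !expr1 => e1 e2.
rewrite ler_pM2r ?invr_gt0 ?exprn_gt0 ?mulr_gt0// (exprD _ 2 2).
by apply: ler_pM; rewrite ?sqr_ge0//; apply: sqmod_1sub_ge => //; exact: ltW.
Qed.

Lemma sqmod_joukowski_sub_le u (c r : R) : 0 < r < 1 -> sqmod u = r ^+ 2 ->
  c \in `[-1, 1] -> sqmod (joukowski u - c%:C%C) <= (1 + r) ^+ 4 / (2 * r) ^+ 2.
Proof.
move=> /andP[r0 r1] ur c1; rewrite (sqmod_joukowski_sub r0)//.
have [] := sqmod_unit_mul 1 ur c1; rewrite !expr1 => e1 e2.
rewrite ler_pM2r ?invr_gt0 ?exprn_gt0 ?mulr_gt0// (exprD _ 2 2).
by apply: ler_pM; rewrite ?sqmod_ge0//; apply: sqmod_1sub_le => //; exact: ltW.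
Qed.

(** Evaluate the factorization of X^N - 1 at 1/v and multiply by v^N. *)
Lemma prod_1sub_roots (s : seq C) N v : (0 < N)%N ->
  'X^N - 1 = \prod_(x <- s) ('X - x%:P) -> \prod_(x <- s) (1 - v * x) = 1 - v ^+ N.
Proof.
move=> N0 sE; have [->|v0] := eqVneq v 0.
  by rewrite expr0n gtn_eqF// subr0 big1// => x _; rewrite mul0r subr0.
have sN : size s = N.
  have := congr1 (fun q : {poly C} => size q) sE.
  by rewrite size_XnsubC// size_prod_XsubC => -[].
have := congr1 (fun q : {poly C} => v ^+ N * q.[v^-1]) sE.
rewrite hornerD hornerN hornerXn hornerC mulrBr mulr1 exprVn mulfV ?expf_neq0// => ->.
rewrite -[in v ^+ N]sN horner_prod.
elim: {sE sN} s => [|x s IH]; first by rewrite !big_nil mulr1.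
rewrite !big_cons exprS mulrACA -IH; congr (_ * _).
by rewrite hornerXsubC mulrBr mulfV.
Qed.

Lemma sqmod_unity x N : (0 < N)%N -> x ^+ N = 1 -> sqmod x = 1.
Proof.
move=> N0 xN; apply/eqP; rewrite -(@pexpr_eq1 _ _ N) ?sqmod_ge0//.
by rewrite -sqmodX xN sqmod1.
Qed.

(* Over the N-th roots of unity the factors of [joukowski_sub] multiply up to
   [1 - (uw)^N] and [1 - (u/w)^N], which are close to 1. *)
Lemma prod_joukowski_sub_le (s : seq C) N u (c r : R) : (0 < N)%N ->
  'X^N - 1 = \prod_(x <- s) ('X - x%:P) -> 0 < r -> sqmod u = r ^+ 2 ->
  c \in `[-1, 1] ->
  \prod_(x <- s) sqmod (joukowski (u * x) - c%:C%C) <=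
  (1 + r ^+ N) ^+ 4 / (2 * r) ^+ (2 * N).
Proof.
move=> N0 sE r0 ur c1.
have sN : size s = N.
  have := congr1 (fun q : {poly C} => size q) sE.
  by rewrite size_XnsubC// size_prod_XsubC => -[].
have s1 x : x \in s -> sqmod x = 1.
  move=> xs; apply: (sqmod_unity N0); apply/eqP; rewrite -subr_eq0.
  have := congr1 (fun q : {poly C} => q.[x]) sE.
  rewrite hornerD hornerN hornerXn hornerC => ->.
  by rewrite horner_prod prodf_seq_eq0; apply/hasP; exists x => //; rewrite hornerXsubC subrr eqxx.
have -> : \prod_(x <- s) sqmod (joukowski (u * x) - c%:C%C) =
    \prod_(x <- s) (sqmod (1 - (u * unit_circle c) * x) *
       sqmod (1 - (u / unit_circle c) * x)) / (2 * r) ^+ (2 * N).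
  rewrite -sN; elim: {sE sN} s s1 => [|x s IH] s1.
    by rewrite !big_nil muln0 expr0 divr1.
  rewrite !big_cons IH; last by move=> y ys; rewrite s1// inE ys orbT.
  rewrite /= mulnS exprD invfM mulrACA; congr (_ * _).
  rewrite (sqmod_joukowski_sub r0)//; last by rewrite sqmodM (s1 x (mem_head _ _)) mulr1.
  by rewrite ![u * x * _]mulrAC.
rewrite ler_pM2r ?invr_gt0 ?exprn_gt0 ?mulr_gt0// big_split/= -!sqmod_prod.
rewrite !(prod_1sub_roots _ N0 sE) (exprD _ 2 2).
have [e1 e2] := sqmod_unit_mul N ur c1.
by apply: ler_pM; rewrite ?sqmod_ge0//; apply: sqmod_1sub_le; rewrite ?exprn_ge0// ltW.
Qed.

(** The image is A t + i B y with A^2 - B^2 = 1, and the excess of the right side is at least (A^2 -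
    1) - 2 (A - 1) = (A - 1)^2. Moving from t to the ellipse therefore brings it no closer to any
    zero of p_n. *)
Lemma sqmod_joukowski_circle (r t c : R) : 0 < r -> t \in `[-1, 1] ->
  c \in `[-1, 1] ->
  (t - c) ^+ 2 <= sqmod (joukowski (r%:C%C * unit_circle t) - c%:C%C).
Proof.
move=> r0 t1 c1; set A := (r + r^-1) / 2; set B := (r - r^-1) / 2.
have AB : A ^+ 2 - B ^+ 2 = 1 by rewrite /A /B; field; rewrite gt_eqF.
have A1 : 1 <= A.
  rewrite -subr_ge0 /A; have -> : (r + r^-1) / 2 - 1 = (r - 1) ^+ 2 / (2 * r).
    by field; rewrite gt_eqF.
  by rewrite divr_ge0 ?sqr_ge0// mulr_ge0// ltW.
have E := sqmod_unit_circle t1; rewrite /sqmod/= in E.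
set y := Num.sqrt (1 - t ^+ 2) in E *.
have -> : joukowski (r%:C%C * unit_circle t) = Complex (A * t) (B * y).
  have rt0 : r%:C%C * unit_circle t != 0.
    by rewrite -sqmod_gt0 sqmodM sqmod_real sqmod_unit_circle// mulr1 exprn_gt0.
  have rtV : (r%:C%C * unit_circle t)^-1 = Complex (r^-1 * t) (- (r^-1 * y)).
    apply: (mulfI rt0); rewrite mulfV//; apply/eqP; rewrite eq_complex/= -/y.
    by apply/andP; split; apply/eqP; [rewrite -[LHS]E|]; field; rewrite gt_eqF.
  rewrite /joukowski rtV.
  apply: (mulIf (x := 2)); first by rewrite pnatr_eq0.
  rewrite mulfVK ?pnatr_eq0//; apply/eqP; rewrite eq_complex/= -/y.
  by apply/andP; split; apply/eqP; rewrite /A /B; field; rewrite gt_eqF.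
rewrite /sqmod/= subr0.
have y2 : y ^+ 2 = 1 - t ^+ 2 by rewrite -[in RHS]E addrAC subrr add0r.
rewrite exprMn y2; have tc : t * c <= 1.
  by move: t1 c1; rewrite !in_itv/= => /andP[? ?] /andP[? ?]; nra.
have -> : (A * t - c) ^+ 2 + B ^+ 2 * (1 - t ^+ 2) =
  (t - c) ^+ 2 + (t ^+ 2 * (A ^+ 2 - B ^+ 2 - 1)
     + (B ^+ 2 - 2 * (A - 1) * (t * c))) by ring.
rewrite AB subrr mulr0 add0r lerDl.
have -> : B ^+ 2 = A ^+ 2 - 1 by rewrite -AB; ring.
by nra.
Qed.

End SquaredModulus.

(** * Real and imaginary parts of a complex polynomial *)

Section ComplexPoly.
Variable R : realType.
Local Notation C := (R[i]).
Local Notation toC := (map_poly (real_complex R)).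
Implicit Types (F : {poly C}) (z : C).

Definition Re_poly F : {poly R} := map_poly (@complex.Re R) F.
Definition Im_poly F : {poly R} := map_poly (@complex.Im R) F.

Lemma coef_Re_poly F k : (Re_poly F)`_k = complex.Re F`_k.
Proof. by rewrite coef_map_id0. Qed.

Lemma coef_Im_poly F k : (Im_poly F)`_k = complex.Im F`_k.
Proof. by rewrite coef_map_id0. Qed.

Lemma size_Re_poly F : (size (Re_poly F) <= size F)%N.
Proof. exact: size_poly. Qed.

Lemma size_Im_poly F : (size (Im_poly F) <= size F)%N.
Proof. exact: size_poly. Qed.

(** As p and U are real, the identity splits into real and imaginary parts. The second, with 0 on
    the left, later cancels the mixed products of the two parts of F. *)
Lemma real_factorization (p U : {poly R}) F z (k : C) :
  toC p = F * ('X - z%:P) + k *: toC U ->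
  p = ('X - (complex.Re z)%:P) * Re_poly F + complex.Im z *: Im_poly F
      + complex.Re k *: U
  /\ 0 = ('X - (complex.Re z)%:P) * Im_poly F - complex.Im z *: Re_poly F
      + complex.Im k *: U.
Proof.
move=> /polyP E.
have E' j : (p`_j)%:C%C = (F * 'X)`_j - F`_j * z + k * (U`_j)%:C%C.
  by have := E j; rewrite mulrBr coefD coefB coefMC coefZ !coef_map.
move=> {E}; split; apply/polyP => j; have := E' j; rewrite !mulrBl !(coefD,coefN,coefZ,coefCM) => Ej.
- rewrite [p`_j](_ : _ = complex.Re (p`_j)%:C%C)// Ej coefXM coef_Re_poly coef_Im_poly.
  rewrite coefMX; case: j {E' Ej} => [|j] /=; rewrite ?coef_Re_poly.
    by case: z k F`_0 => [a b] [c d] [e f] /=; ring.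
  by case: z k F`_j F`_j.+1 => [a b] [c d] [e f] [g h] /=; ring.
- rewrite coef0 [LHS](_ : _ = complex.Im (p`_j)%:C%C)// Ej coefXM coef_Re_poly coef_Im_poly.
  rewrite coefMX; case: j {E' Ej} => [|j] /=; rewrite ?coef_Im_poly.
    by case: z k F`_0 => [a b] [c d] [e f] /=; ring.
  by case: z k F`_j F`_j.+1 => [a b] [c d] [e f] [g h] /=; ring.
Qed.

End ComplexPoly.

(** * From leading coefficients to growth on [-1,1] *)

Section Regularity.
Variables (R : realType) (L : {scalar {poly R}}) (p : nat -> {poly R}).
Hypothesis size_p : forall n, size (p n) = n.+1.
Hypothesis orth_p : forall n m, L (p n * p m) = (n == m)%:R.
Hypothesis L_ge0 : forall P : {poly R},
  (forall x, x \in `[-1, 1] -> 0 <= P.[x]) -> 0 <= L P.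
Local Notation C := (R[i]).
Local Notation toC := (map_poly (real_complex R)).

Lemma form_scale a P : L (a *: P) = a * L P. Proof. exact: linearZ. Qed.

Lemma form_mono (P Q : {poly R}) : (forall x, x \in `[-1, 1] -> P.[x] <= Q.[x]) ->
  L P <= L Q.
Proof.
move=> PQ; rewrite -subr_ge0 -raddfB/=; apply: L_ge0 => x x1.
by rewrite hornerD hornerN subr_ge0 PQ.
Qed.

Lemma form_sqr_ge0 P : 0 <= L (P * P).
Proof. by apply: L_ge0 => x _; rewrite hornerM -expr2 sqr_ge0. Qed.

Lemma form_cauchy_schwarz P Q : L (P * Q) ^+ 2 <= L (P * P) * L (Q * Q).
Proof.
set n := maxn (size P) (size Q).
have sP : (size P <= n)%N by rewrite leq_maxl.
have sQ : (size Q <= n)%N by rewrite leq_maxr.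
rewrite !(parseval size_p orth_p _ sP) (parseval size_p orth_p _ sQ).
apply: le_trans (sum_cauchy_schwarz _ _) _.
by under eq_bigr do rewrite expr2; under [X in _ * X <= _]eq_bigr do rewrite expr2.
Qed.

Lemma form_orth n (P : {poly R}) : (size P <= n)%N -> L (p n * P) = 0.
Proof.
move=> sP; rewrite (fourier_expansion size_p orth_p sP) mulr_sumr linear_sum big1// => k _.
by rewrite -scalerAr form_scale orth_p gtn_eqF// mulr0.
Qed.

(* With [p_n = (X - z) F + k U] and [F = A + i B], orthogonality of [p_n] to [A]
   and [B] expresses [L ((X - z) (A^2 + B^2))] through [k], while its modulus is at
   least [dist(z, [-1, 1]) L (A^2 + B^2)]. *)
Lemma orthonormal_lower_bound n (U : {poly R}) (z k : C) (d2 D2 : R) :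
  (size U <= n.+1)%N -> (toC (p n)).[z] = k * (toC U).[z] ->
  0 < d2 ->
  (forall s : R, s \in `[-1, 1] -> d2 <= sqmod (z - s%:C%C)) ->
  (forall s : R, s \in `[-1, 1] -> sqmod (z - s%:C%C) <= D2) ->
  1 <= 2 * sqmod k * L (U * U) * (D2 / d2 + 1).
Proof.
move=> sU pz d0 Hd HD.
have [F FE] : exists F, toC (p n) - k *: toC U = F * ('X - z%:P).
  apply/factor_theorem; rewrite /root hornerD hornerN hornerZ pz; exact/eqP/subrr.
have sF : (size F <= n)%N.
  have [->|F0] := eqVneq F 0; first by rewrite size_poly0.
  have := congr1 (fun q : {poly C} => size q) FE.
  rewrite size_Mmonic ?monicXsubC// size_XsubC addn2 => sE.
  rewrite -ltnS -[X in (X <= _)%N]/((size F).+2.-1) -sE.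
  rewrite (leq_trans (size_polyD _ _))// geq_max size_polyN size_map_poly size_p leqnn/=.
  by rewrite (leq_trans (size_scale_leq _ _))// size_map_poly.
set A := Re_poly F; set B := Im_poly F.
have sA : (size A <= n)%N by exact: leq_trans (size_Re_poly _) sF.
have sB : (size B <= n)%N by exact: leq_trans (size_Im_poly _) sF.
have [] := @real_factorization R (p n) U F z k; first by rewrite -FE subrK.
rewrite -/A -/B; set a := complex.Re z; set b := complex.Im z.
set k1 := complex.Re k; set k2 := complex.Im k => pE zE.
pose S := A * A + B * B; set N := L S; set u := L (U * U).
have N0 : 0 <= N by rewrite /N /S raddfD addr_ge0 ?form_sqr_ge0.
have u0 : 0 <= u by exact: form_sqr_ge0.
pose V1 := k1 *: A + k2 *: B; pose V2 := k1 *: B - k2 *: A.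
have E1 : L (('X - a%:P) * S) = - L (U * V1).
  apply/eqP; rewrite -addr_eq0 -raddfD/= -(form_orth sA); apply/eqP; congr (L _).
  have -> : p n * A = (('X - a%:P) * A + b *: B + k1 *: U) * A
      + (('X - a%:P) * B - b *: A + k2 *: U) * B by rewrite -pE -zE mul0r addr0.
  by rewrite /S /V1 -!mul_polyC; ring.
have E2 : b * N = - L (U * V2).
  apply/eqP; rewrite -addr_eq0 -form_scale -raddfD/= -(form_orth sB); apply/eqP; congr (L _).
  have -> : p n * B = (('X - a%:P) * A + b *: B + k1 *: U) * B
      - (('X - a%:P) * B - b *: A + k2 *: U) * A by rewrite -pE -zE mul0r subr0.
  by rewrite /S /V2 -!mul_polyC; ring.
set tau := L ('X * S).
have E1' : tau - a * N = - L (U * V1) by rewrite -E1 mulrBl raddfB/= mul_polyC form_scale.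
have V12 : L (V1 * V1) + L (V2 * V2) = sqmod k * N.
  rewrite -raddfD -form_scale; congr (L _).
  rewrite /S /V1 /V2 /sqmod -/k1 -/k2 -!mul_polyC rmorphD !rmorphXn/=; ring.
have CS : (tau - a * N) ^+ 2 + (b * N) ^+ 2 <= u * (sqmod k * N).
  rewrite E1' E2 !sqrrN -V12 (mulrDr u) lerD//; exact: form_cauchy_schwarz.
have S_ge0 (x : R) : 0 <= S.[x].
  by rewrite hornerD !hornerM -!expr2 addr_ge0 ?sqr_ge0.
have tauN : `|tau| <= N.
  rewrite ler_norml -[- N]mulN1r -form_scale; apply/andP; split.
    apply: form_mono => x; rewrite in_itv/= hornerZ hornerM hornerX => /andP[x1 _].
    exact: ler_wpM2r.
  apply: form_mono => x; rewrite in_itv/= hornerM hornerX => /andP[_ x1].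
  by rewrite ler_piMl.
have dN : d2 * N <= u * sqmod k.
  have [->|Nn0] := eqVneq N 0; first by rewrite mulr0 mulr_ge0// sqmod_ge0.
  have Np : 0 < N by rewrite lt_def Nn0.
  (* tau / N is the mean of x for the weight S, hence a point of [-1,1], and the left side of [CS]
     is N^2 times its squared distance to z. *)
  have sI : tau / N \in `[-1, 1].
    by rewrite in_itv/= -ler_norml normrM normfV (ger0_norm N0) ler_pdivrMr ?mul1r.
  rewrite -(ler_pM2r Np) -[leRHS]mulrA; apply: le_trans CS.
  rewrite -mulrA mulrC.
  have -> : (tau - a * N) ^+ 2 + (b * N) ^+ 2 = N * N * sqmod (z - (tau / N)%:C%C).
    by rewrite sqmod_sub_real -/a -/b; field.
  by rewrite ler_wpM2l ?mulr_ge0// Hd.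
have pp : L (p n * p n) = 1 by rewrite orth_p eqxx.
(* On the real line p_n is Re((x - z) F) + k1 U. The first term is at most |x - z| |F|, and (q +
   e)^2 <= 2 q^2 + 2 e^2. *)
have pL : 1 <= 2 * (D2 * N) + 2 * (k1 ^+ 2 * u).
  rewrite -[leLHS]pp -!form_scale -raddfD; apply: form_mono => x x1.
  have px : (p n).[x] = (x - a) * A.[x] + b * B.[x] + k1 * U.[x].
    by rewrite {1}pE !(hornerD, hornerM, hornerZ, hornerN, hornerX, hornerC).
  rewrite !(hornerD, hornerM, hornerZ) px.
  set f := A.[x]; set g := B.[x]; set h := U.[x].
  have H1 : ((x - a) * f + b * g) ^+ 2 <= D2 * (f * f + g * g).
    apply: (@le_trans _ _ (sqmod (z - x%:C%C) * (f * f + g * g))); last first.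
      by rewrite ler_wpM2r ?HD// addr_ge0// -expr2 sqr_ge0.
    rewrite -subr_ge0.
    have -> : sqmod (z - x%:C%C) * (f * f + g * g) - ((x - a) * f + b * g) ^+ 2
        = (b * f - (x - a) * g) ^+ 2.
      by rewrite sqmod_sub_real -/a -/b; ring.
    exact: sqr_ge0.
  have := sqr_ge0 ((x - a) * f + b * g - k1 * h).
  move: H1; set q := (x - a) * f + b * g; set e := k1 * h => H1 H2.
  have -> : k1 ^+ 2 * (h * h) = e ^+ 2 by rewrite /e; ring.
  nra.
have D2_ge0 : 0 <= D2.
  by apply: le_trans (HD 0 _); rewrite ?sqmod_ge0// in_itv/= lerN10 ler01.
apply: (le_trans pL).
have kk : k1 ^+ 2 <= sqmod k by rewrite lerDl sqr_ge0.
have H1 : D2 * N <= D2 / d2 * (u * sqmod k).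
  rewrite -mulrA; apply: ler_wpM2l => //.
  by rewrite [leRHS]mulrC ler_pdivlMr// mulrC.
have H2 : k1 ^+ 2 * u <= sqmod k * u by rewrite ler_wpM2r.
nra.
Qed.

(** At a zero z of p_n, the choice U = 1, k = 0 in [orthonormal_lower_bound] would give 1 <= 0 if z
    were at positive distance from [-1,1]. That distance is at least |Im z|, and at least |Re z| - 1
    when |Re z| > 1. *)
Lemma orthonormal_roots n : exists s : seq R,
  [/\ size s = n, forall c, c \in s -> c \in `[-1, 1] &
   forall z : C, sqmod (toC (p n)).[z] =
     lead_coef (p n) ^+ 2 * \prod_(c <- s) sqmod (z - c%:C%C)].
Proof.
have [r rE] := closed_field_poly_normal (toC (p n)).
have lE : lead_coef (toC (p n)) = (lead_coef (p n))%:C%C by rewrite lead_coef_map.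
have ln0 : lead_coef (p n) != 0 by rewrite lead_coef_eq0 -size_poly_gt0 size_p.
have rP z : z \in r -> z = (complex.Re z)%:C%C /\ complex.Re z \in `[-1, 1].
  move=> zr; have pz : (toC (p n)).[z] = 0 * (toC 1).[z].
    rewrite mul0r rE hornerZ horner_prod; apply/eqP; rewrite mulf_eq0; apply/orP; right.
    by rewrite prodf_seq_eq0; apply/hasP; exists z => //; rewrite hornerXsubC subrr eqxx.
  pose a := complex.Re z; pose b := complex.Im z.
  have HD (t : R) : t \in `[-1, 1] -> sqmod (z - t%:C%C) <= (`|a| + 1) ^+ 2 + b ^+ 2.
    rewrite in_itv/= -ler_norml => t1; rewrite sqmod_sub_real lerD2r -/a.
    rewrite -real_normK ?num_real// lerXn2r ?nnegrE ?addr_ge0//.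
    by rewrite (le_trans (ler_normB _ _))// lerD2l.
  have absurd (d2 : R) : 0 < d2 ->
      (forall t : R, t \in `[-1, 1] -> d2 <= sqmod (z - t%:C%C)) -> False.
    move=> d0 Hd.
    have := orthonormal_lower_bound (leq_trans (size_polyC_leq1 _) (ltn0Sn n)) pz d0 Hd HD.
    by rewrite /sqmod/= expr0n addr0 mulr0 !mul0r ler10.
  have b0 : b = 0.
    apply/eqP; apply: contrapT => /negP bn0; apply: (absurd (b ^+ 2)).
      by rewrite lt_def sqr_ge0 sqrf_eq0 bn0.
    by move=> t _; rewrite sqmod_sub_real lerDr sqr_ge0.
  split; first by apply/eqP; rewrite eq_complex/= eqxx; apply/eqP.
  rewrite in_itv/= -ler_norml leNgt; apply/negP => a1.
  apply: (absurd ((`|a| - 1) ^+ 2)); first by rewrite exprn_gt0// subr_gt0.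
  move=> t; rewrite in_itv/= -ler_norml => t1; rewrite sqmod_sub_real -/a.
  rewrite (@le_trans _ _ ((a - t) ^+ 2)) ?lerDl ?sqr_ge0//.
  rewrite -[leRHS]real_normK ?num_real// lerXn2r ?nnegrE ?subr_ge0 ?(ltW a1)//.
  by rewrite (le_trans _ (lerB_dist _ _))// lerB.
exists [seq complex.Re z | z <- r]; split.
- rewrite size_map; have := congr1 (fun q : {poly C} => size q) rE.
  rewrite size_map_poly size_p size_scale ?size_prod_XsubC ?lE => [[]//|].
  by rewrite -sqmod_eq0 sqmod_real sqrf_eq0.
- by move=> c /mapP[z /rP [_ zI] ->].
- move=> z; rewrite {1}rE hornerZ sqmodM lE sqmod_real horner_prod sqmod_prod.
  congr (_ * _); rewrite big_map; apply: eq_big_seq => x /rP [xE _].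
  by rewrite hornerXsubC {1}xE.
Qed.

(** Compare p_n with U_n by taking U = [chebU n] and k = p_n(z)/U_n(z) in [orthonormal_lower_bound].
    On [-1,1] the modulus of U_n is at most n + 1, whereas at z its value (u^(n+1) - u^(-n-1)) / (u
    - 1/u) is at least of order r^(-n), for every argument of u. *)
Lemma sqmod_orthonormal_ge (r : R) : 0 < r < 1 -> exists2 c, 0 < c &
  forall n u, sqmod u = r ^+ 2 ->
  c / n.+1%:R ^+ 2 / (r ^+ 2) ^+ n <= sqmod (toC (p n)).[joukowski u].
Proof.
move=> r01; have /andP[r0 r1] := r01.
set K := (1 + r) ^+ 4 / (1 - r) ^+ 4 + 1.
have rp : 0 < 1 + r by rewrite addr_gt0.
have rm : 0 < 1 - r by rewrite subr_gt0.
have K0 : 0 < K by rewrite addr_gt0// divr_gt0// exprn_gt0.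
have M0 : 0 <= L 1 by apply: L_ge0 => x _; rewrite hornerC.
pose M := L 1 + 1; have Mp : 0 < M by rewrite ltr_wpDl.
have r2 : 0 < 1 - r ^+ 2 by rewrite subr_gt0 exprn_ilt1// ltW.
exists ((1 - r ^+ 2) ^+ 2 / (4 * (2 * M * K))).
  by rewrite divr_gt0 ?exprn_gt0// !mulr_gt0.
move=> n u ur; set z := joukowski u.
have u0 : u != 0 by rewrite -sqmod_gt0 ur exprn_gt0.
have r20 : 0 < (2 * r) ^+ 2 by rewrite exprn_gt0// mulr_gt0.
set d2 := (1 - r) ^+ 4 / (2 * r) ^+ 2; set D2 := (1 + r) ^+ 4 / (2 * r) ^+ 2.
have d20 : 0 < d2 by rewrite divr_gt0// exprn_gt0// subr_gt0.
have rr0 : r != 0 by rewrite gt_eqF.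
have rr1 : 1 - r != 0 by rewrite gt_eqF// subr_gt0.
have KE : D2 / d2 + 1 = K by rewrite /K /D2 /d2; field; rewrite rr0 rr1.
have Uz : (chebU n).[z] * (u - u^-1) = u ^+ n.+1 - (u ^+ n.+1)^-1.
  elim/ltn_ind: n => -[|[|n]] IH.
  - by rewrite chebU0 hornerC mul1r !expr1.
  - by rewrite chebU1 hornerM hornerC hornerX /z /joukowski; field.
  rewrite horner_chebUSS mulrBl -(mulrA (2 * z)) (IH n.+1)// (IH n)//.
  rewrite /z /joukowski !exprS; field.
  by rewrite u0 expf_neq0.
set Y := sqmod (chebU n : {poly C}).[z].
(* Once r^(-n) is extracted, the modulus of U_n(z) is |1 - u^(2n+2)| / |1 - u^2|, with numerator at
   least 1 - r^2 and denominator at most 2. *)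
have Yge : (1 - r ^+ 2) ^+ 2 / 4 / (r ^+ 2) ^+ n <= Y.
  have W : Y * sqmod (u - u^-1) = sqmod (u ^+ n.+1 - (u ^+ n.+1)^-1).
    by rewrite -sqmodM Uz.
  have sub_inv (v : C) : v != 0 -> sqmod (v - v^-1) = sqmod (1 - v ^+ 2) / sqmod v.
    move=> v0; have -> : v - v^-1 = - (1 - v ^+ 2) / v by field.
    by rewrite sqmodM sqmodV sqmodN.
  move: W; rewrite !sub_inv ?expf_neq0// !sqmodX ur.
  set A := sqmod (1 - u ^+ 2); set B := sqmod (1 - (u ^+ n.+1) ^+ 2) => W.
  have A4 : A <= 4.
    apply: (@le_trans _ _ ((1 + r ^+ 2) ^+ 2)).
      by apply: sqmod_1sub_le; rewrite ?sqmodX ?ur// exprn_ge0// ltW.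
    have : r ^+ 2 <= 1 by rewrite exprn_ile1// ltW.
    have : 0 <= r ^+ 2 by exact: sqr_ge0.
    by set q := r ^+ 2 => *; nra.
  have Bge : (1 - r ^+ 2) ^+ 2 <= B.
    apply: (@le_trans _ _ ((1 - (r ^+ n.+1) ^+ 2) ^+ 2)).
      rewrite lerXn2r ?nnegrE ?(ltW r2)//.
        by rewrite subr_ge0 -exprM exprn_ile1// ltW.
      rewrite lerB// lerXn2r ?nnegrE ?exprn_ge0 ?(ltW r0)//.
      by rewrite exprS ler_piMr ?(ltW r0)// exprn_ile1 ?ltW.
    apply: sqmod_1sub_ge; first by rewrite exprn_ge0// exprn_ge0// ltW.
    by rewrite !sqmodX ur (exprAC r).
  have Y0 : 0 <= Y by exact: sqmod_ge0.
  have rn0 : 0 < (r ^+ 2) ^+ n by rewrite !exprn_gt0.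
  have W2 : Y * A * (r ^+ 2) ^+ n = B.
    have := congr1 (fun t => t * (r ^+ 2) ^+ n.+1) W.
    rewrite divfK ?expf_neq0// => <-.
    by rewrite (exprS (r ^+ 2)) [RHS]mulrA -(mulrA Y (A / _)) divfK// expf_neq0.
  rewrite ler_pdivrMr// ler_pdivrMr// mulrAC.
  apply: (le_trans Bge); rewrite -W2 ler_wpM2r ?(ltW rn0)//.
  exact: ler_wpM2l.
have Y0 : 0 < Y.
  by apply: lt_le_trans Yge; rewrite !divr_gt0// !exprn_gt0.
have Un0 : (chebU n : {poly C}).[z] != 0 by rewrite -sqmod_gt0.
have pz : (toC (p n)).[z] = ((toC (p n)).[z] / (chebU n).[z]) * (toC (chebU n)).[z].
  by rewrite map_chebU divfK.
have Hd (s : R) : s \in `[-1, 1] -> d2 <= sqmod (z - s%:C%C).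
  by move=> s1; exact: sqmod_joukowski_sub_ge.
have HD (s : R) : s \in `[-1, 1] -> sqmod (z - s%:C%C) <= D2.
  by move=> s1; exact: sqmod_joukowski_sub_le.
have := orthonormal_lower_bound _ pz d20 Hd HD.
rewrite size_chebU leqnn KE sqmodM sqmodV -/Y => /(_ isT) main.
have LU : L (chebU n * chebU n) <= M * n.+1%:R ^+ 2.
  apply: (@le_trans _ _ (L ((n.+1%:R ^+ 2) *: 1))).
    apply: form_mono => x x1; rewrite hornerM hornerZ hornerC mulr1 -expr2.
    by rewrite -real_normK ?num_real// lerXn2r ?nnegrE// chebU_bound.
  by rewrite form_scale mulrC ler_wpM2r ?sqr_ge0// /M lerDl.
set X := sqmod (toC (p n)).[z] in main *.
have X0 : 0 <= X by exact: sqmod_ge0.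
have n0 : 0 < n.+1%:R ^+ 2 :> R by rewrite exprn_gt0.
have step : Y <= X * (2 * M * K * n.+1%:R ^+ 2).
  rewrite -[leLHS]mulr1; apply: (le_trans (ler_wpM2l (ltW Y0) main)).
  have -> : Y * (2 * (X / Y) * L (chebU n * chebU n) * K) =
      X * (2 * L (chebU n * chebU n) * K) by field; rewrite gt_eqF.
  rewrite ler_wpM2l// -!mulrA ler_wpM2l// mulrCA [leRHS]mulrCA [K * _]mulrC mulrA.
  by rewrite ler_wpM2r ?(ltW K0).
have := le_trans Yge step.
have rn0 : 0 < (r ^+ 2) ^+ n by rewrite !exprn_gt0.
rewrite ler_pdivrMr// ler_pdivrMr// => fin.
rewrite ler_pdivrMr// ler_pdivrMr// ler_pdivrMr; last by rewrite !mulr_gt0.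
apply: (le_trans fin).
by rewrite le_eqVlt; apply/orP; left; apply/eqP; ring.
Qed.

Lemma prod_ge_exp (I : eqType) (s : seq I) (F : I -> R) (m : R) : 0 <= m ->
  (forall x, x \in s -> m <= F x) -> m ^+ size s <= \prod_(x <- s) F x.
Proof.
move=> m0; elim: s => [|x s IH] H; first by rewrite big_nil.
rewrite big_cons exprS ler_pM ?exprn_ge0 ?H ?mem_head// IH// => y ys.
by rewrite H// inE ys orbT.
Qed.

Lemma prod_le_exp (I : eqType) (s : seq I) (F : I -> R) (m : R) :
  (forall x, x \in s -> 0 <= F x <= m) -> \prod_(x <- s) F x <= m ^+ size s.
Proof.
elim: s => [|x s IH] H; first by rewrite big_nil.
have /andP[x0 xm] := H x (mem_head _ _).
rewrite big_cons exprS ler_pM//.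
  by rewrite big_seq prodr_ge0// => y ys; have := H y; rewrite inE ys orbT => /(_ isT) /andP[].
by apply: IH => y ys; apply: H; rewrite inE ys orbT.
Qed.

(** Multiply |p_n|^2 over the N + 1 points [joukowski (u * y)], y a root of unity. Factoring p_n
    over its zeros and exchanging the products gives an upper bound by [prod_joukowski_sub_le]; all
    factors but y = 1 are bounded below by the hypothesis, and the factor y = 1 dominates p_n(x)^2.
    The powers of r cancel up to r^(-2n). *)
Lemma orthonormal_sup_le n N (r c x : R) : 0 < r < 1 -> 0 < c ->
  (forall u, sqmod u = r ^+ 2 ->
    c / n.+1%:R ^+ 2 / (r ^+ 2) ^+ n <= sqmod (toC (p n)).[joukowski u]) ->
  x \in `[-1, 1] ->
  (p n).[x] ^+ 2 <= (lead_coef (p n) / 2 ^+ n) ^+ (2 * N.+1) *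
     ((1 + r ^+ N.+1) ^+ 4) ^+ n / (r ^+ 2) ^+ n * (n.+1%:R ^+ 2 / c) ^+ N.
Proof.
move=> /andP[r0 r1] c0 Hc x1.
have [rts [srts rts1 prts]] := orthonormal_roots n.
have [s sE] := closed_field_poly_normal ('X^(N.+1) - 1 : {poly C}).
have mon : ('X^(N.+1) - 1 : {poly C}) \is monic by apply: monic_Xn_sub_1.
rewrite (monicP mon) scale1r in sE.
have sN : size s = N.+1.
  have := congr1 (fun q : {poly C} => size q) sE.
  by rewrite size_XnsubC// size_prod_XsubC => -[].
have s1 y : y \in s -> sqmod y = 1.
  move=> ys; apply: (@sqmod_unity _ _ N.+1) => //; apply/eqP; rewrite -subr_eq0.
  have := congr1 (fun q : {poly C} => q.[y]) sE.
  rewrite hornerD hornerN hornerXn hornerC => ->.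
  by rewrite horner_prod prodf_seq_eq0; apply/hasP; exists y => //; rewrite hornerXsubC subrr eqxx.
have one_s : 1 \in s.
  have /eqP : ('X^(N.+1) - 1 : {poly C}).[1] = 0.
    by rewrite hornerD hornerN hornerXn hornerC expr1n subrr.
  rewrite sE horner_prod prodf_seq_eq0 => /hasP[y ys].
  by rewrite hornerXsubC subr_eq0 => /eqP ->.
set u := r%:C%C * unit_circle x.
have ur : sqmod u = r ^+ 2 by rewrite sqmodM sqmod_real sqmod_unit_circle ?mulr1.
have uyr y : y \in s -> sqmod (u * y) = r ^+ 2 by move=> ys; rewrite sqmodM (s1 _ ys) mulr1.
set m := c / n.+1%:R ^+ 2 / (r ^+ 2) ^+ n in Hc.
have m0 : 0 < m by rewrite !divr_gt0// !exprn_gt0.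
pose X y := sqmod (toC (p n)).[joukowski (u * y)].
have up : \prod_(y <- s) X y <= lead_coef (p n) ^+ (2 * N.+1) *
    ((1 + r ^+ N.+1) ^+ 4 / (2 * r) ^+ (2 * N.+1)) ^+ n.
  under eq_bigr do rewrite /X prts.
  rewrite big_split/= exchange_big/= ler_pM//.
  - by rewrite prodr_ge0// => y _; exact: sqr_ge0.
  - by rewrite prodr_ge0// => y _; rewrite prodr_ge0// => ? _; exact: sqmod_ge0.
  - have := @prod_le_exp _ s (fun=> lead_coef (p n) ^+ 2) (lead_coef (p n) ^+ 2).
    by rewrite sN -exprM; apply => y _; rewrite sqr_ge0/=.
  - rewrite -srts; apply: prod_le_exp => y yr.
    rewrite prodr_ge0/= => [|? _]; last exact: sqmod_ge0.
    by apply: prod_joukowski_sub_le => //; exact: rts1.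
have low : X 1 * m ^+ N <= \prod_(y <- s) X y.
  rewrite (big_rem _ one_s)/= ler_wpM2l ?sqmod_ge0//.
  have <- : size (rem 1 s) = N by rewrite size_rem// sN.
  apply: prod_ge_exp; first exact: ltW.
  by move=> y /mem_rem ys; apply: Hc; exact: uyr.
have X1 : (p n).[x] ^+ 2 <= X 1.
  rewrite /X mulr1 prts.
  have := prts x%:C%C; rewrite horner_map sqmod_real => ->.
  rewrite ler_wpM2l ?sqr_ge0//; elim: {srts prts up} rts rts1 => [|y l IH] H.
    by rewrite !big_nil.
  rewrite !big_cons ler_pM ?sqmod_ge0 ?prodr_ge0//.
  - by move=> *; exact: sqmod_ge0.
  - have -> : x%:C%C - y%:C%C = (x - y)%:C%C by rewrite rmorphB.
    by rewrite sqmod_real sqmod_joukowski_circle// H// mem_head.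
  - by apply: IH => z zl; apply: H; rewrite inE zl orbT.
apply: (le_trans X1); have := le_trans low up.
rewrite -ler_pdivlMr ?exprn_gt0// => H; apply: (le_trans H).
rewrite le_eqVlt; apply/orP; left; apply/eqP.
have -> : ((1 + r ^+ N.+1) ^+ 4 / (2 * r) ^+ (2 * N.+1)) ^+ n =
    ((1 + r ^+ N.+1) ^+ 4) ^+ n / ((2 ^+ n) ^+ (2 * N.+1) * ((r ^+ 2) ^+ n) ^+ N.+1).
  rewrite expr_div_n; congr (_ / _); rewrite exprMn exprMn -!exprM.
  by congr (_ ^+ _ * _ ^+ _); rewrite mulnC// mulnCA mulnA.
rewrite /m [in RHS]expr_div_n.
set G := lead_coef _ ^+ _; set T := _ ^+ n; set Q := (r ^+ 2) ^+ n.
set H2 := (2 ^+ n) ^+ _.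
have Q0 : Q != 0 by rewrite !expf_neq0// gt_eqF.
have H20 : H2 != 0 by rewrite !expf_neq0// pnatr_eq0.
have -> : (c / n.+1%:R ^+ 2 / Q) ^+ N = ((n.+1%:R ^+ 2 / c) ^+ N)^-1 / Q ^+ N.
  by rewrite (expr_div_n (c / _)) -(exprVn (_ / c)) invf_div.
rewrite (exprS Q); set q := Q ^+ N; set Z := (_ / c) ^+ N.
have q0 : q != 0 by rewrite expf_neq0.
have Z0 : Z != 0.
  by rewrite expf_neq0// mulf_neq0 ?invr_eq0 ?expf_neq0 ?pnatr_eq0// gt_eqF.
by field; rewrite Z0 q0 H20 Q0.
Qed.

Lemma orthonormal_sup_growth :
  (forall rho, 1 < rho ->
    exists2 K, 0 < K & forall n, 0 <= lead_coef (p n) <= K * (2 * rho) ^+ n) ->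
  forall rho, 1 < rho -> exists2 K, 0 < K &
    forall n x, x \in `[-1, 1] -> (p n).[x] ^+ 2 <= K * rho ^+ n.
Proof.
move=> Hlead rho rho1.
(* Each of the four factors in [orthonormal_sup_le] receives the rate t. The order of choices
   matters: r and N are fixed before g, whose exponent 2 (N + 1) depends on N. *)
have [t t1 trho] := root_gt1 4 rho1.
have t0 : 0 < t by exact: lt_trans t1.
have [s s1 st] := root_gt1 2 t1.
have s0 : 0 < s by exact: lt_trans s1.
pose r := s^-1.
have r01 : 0 < r < 1 by rewrite invr_gt0 s0 invf_lt1.
have [tau tau1 taut] := root_gt1 4 t1.
have [N rN] : exists N, r ^+ N.+1 <= tau - 1 by apply: exp_small => //; rewrite subr_gt0.
have [g g1 gt] := root_gt1 (2 * N.+1) t1.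
have g0 : 0 < g by exact: lt_trans g1.
have [K1 K10 HK1] := Hlead g g1.
have [K2 K20 HK2] := poly_le_exp (2 * N) t1.
have [c c0 Hc] := sqmod_orthonormal_ge r01.
exists (K1 ^+ (2 * N.+1) * (K2 / c ^+ N)).
  by rewrite mulr_gt0 ?divr_gt0 ?exprn_gt0.
move=> n x x1; apply: (le_trans (orthonormal_sup_le N r01 c0 (Hc n) x1)).
have /andP[l0 l1] := HK1 n.
have h1 : (lead_coef (p n) / 2 ^+ n) ^+ (2 * N.+1) <= K1 ^+ (2 * N.+1) * t ^+ n.
  apply: (@le_trans _ _ ((K1 * g ^+ n) ^+ (2 * N.+1))).
    rewrite lerXn2r ?nnegrE ?divr_ge0 ?mulr_ge0 ?exprn_ge0 ?(ltW K10) ?(ltW g0)//.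
    by rewrite ler_pdivrMr ?exprn_gt0// -mulrA -exprMn [g * 2]mulrC.
  rewrite exprMn ler_wpM2l ?exprn_ge0 ?(ltW K10)// exprAC.
  by rewrite lerXn2r ?nnegrE ?exprn_ge0 ?(ltW g0) ?(ltW t0).
have h2 : ((1 + r ^+ N.+1) ^+ 4) ^+ n <= t ^+ n.
  have /andP[r0 _] := r01.
  rewrite lerXn2r ?nnegrE ?exprn_ge0 ?addr_ge0 ?exprn_ge0 ?(ltW r0) ?(ltW t0)//.
  apply: le_trans taut; rewrite lerXn2r ?nnegrE ?addr_ge0 ?exprn_ge0 ?(ltW r0)//.
    by rewrite ltW// (lt_trans _ tau1).
  by rewrite -lerBrDl.
have h3 : ((r ^+ 2) ^+ n)^-1 <= t ^+ n.
  by rewrite /r -!exprVn invrK lerXn2r ?nnegrE ?exprn_ge0 ?(ltW s0) ?(ltW t0).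
have h4 : (n.+1%:R ^+ 2 / c) ^+ N <= K2 / c ^+ N * t ^+ n.
  by rewrite expr_div_n mulrAC ler_wpM2r ?invr_ge0 ?exprn_ge0 ?(ltW c0)// -exprM.
have tn : (t ^+ n * t ^+ n * t ^+ n * t ^+ n) <= rho ^+ n.
  have -> : t ^+ n * t ^+ n * t ^+ n * t ^+ n = (t ^+ 4) ^+ n.
    by rewrite exprAC !exprS expr0 mulr1 !mulrA.
  have rho0 : 0 < rho by exact: lt_trans rho1.
  by rewrite lerXn2r ?nnegrE ?exprn_ge0 ?(ltW t0) ?(ltW rho0).
have P1 := exprn_ge0 (2 * N.+1) (divr_ge0 l0 (exprn_ge0 n (ler0n R 2))).
have r0 : 0 < r by case/andP: r01.
have P2 : 0 <= ((1 + r ^+ N.+1) ^+ 4) ^+ n.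
  by rewrite !exprn_ge0// addr_ge0// exprn_ge0 ?ltW.
have P3 : 0 <= ((r ^+ 2) ^+ n)^-1 by rewrite invr_ge0 !exprn_ge0// ltW.
have P4 : 0 <= (n.+1%:R ^+ 2 / c) ^+ N.
  by rewrite exprn_ge0// divr_ge0 ?exprn_ge0// ltW.
apply: (@le_trans _ _ (K1 ^+ (2 * N.+1) * t ^+ n * t ^+ n * t ^+ n * (K2 / c ^+ N * t ^+ n))).
  by rewrite !ler_pM ?mulr_ge0.
have -> : K1 ^+ (2 * N.+1) * t ^+ n * t ^+ n * t ^+ n * (K2 / c ^+ N * t ^+ n) =
  K1 ^+ (2 * N.+1) * (K2 / c ^+ N) * (t ^+ n * t ^+ n * t ^+ n * t ^+ n) by ring.
by rewrite ler_wpM2l// mulr_ge0 ?divr_ge0 ?exprn_ge0 ?(ltW K10) ?(ltW K20) ?(ltW c0).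
Qed.

End Regularity.

(** * The localizing factor *)

Section Bump.
Variable R : realType.
Implicit Types (y t d : R).

(** Division by 4 keeps the base in [0,1] for t and y in [-1,1], where |t - y| <= 2. *)
Definition bump k y : {poly R} := (1 - (4^-1)%:P * ('X - y%:P) ^+ 2) ^+ k.

Lemma horner_bump k y t : (bump k y).[t] = (1 - (t - y) ^+ 2 / 4) ^+ k.
Proof.
by rewrite /bump horner_exp !(hornerD, hornerN, hornerM, hornerC, hornerX, horner_exp) [_^-1 * _]mulrC.
Qed.

Lemma bump_center k y : (bump k y).[y] = 1.
Proof. by rewrite horner_bump subrr expr0n mul0r subr0 expr1n. Qed.

Lemma size_bump k y : (size (bump k y) <= (2 * k).+1)%N.
Proof.
apply: (leq_trans (size_poly_exp_leq _ _)).
rewrite ltnS leq_mul2r; apply/orP; right.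
have : (size (1 - (4^-1)%:P * ('X - y%:P) ^+ 2 : {poly R})%R <= 3)%N; last by case: size.
rewrite (leq_trans (size_polyD _ _))// geq_max size_poly1 size_polyN/=.
rewrite mul_polyC (leq_trans (size_scale_leq _ _))//.
by rewrite (leq_trans (size_poly_exp_leq _ _))// size_XsubC.
Qed.

Lemma bump_itv k y t : y \in `[-1, 1] -> t \in `[-1, 1] -> 0 <= (bump k y).[t] <= 1.
Proof.
rewrite !in_itv/= horner_bump => /andP[y1 y2] /andP[t1 t2].
have h : 0 <= (2 - (t - y)) * (2 + (t - y)) by rewrite mulr_ge0//; lra.
have : 0 <= 1 - (t - y) ^+ 2 / 4 <= 1.
  by have := sqr_ge0 (t - y) => ?; apply/andP; split; lra.
by move=> /andP[h1 h2]; rewrite exprn_ge0// exprn_ile1.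
Qed.

Lemma bump_far k y t d : y \in `[-1, 1] -> t \in `[-1, 1] -> 0 < d ->
  t \notin `]y - d, y + d[ -> (bump k y).[t] <= (1 - d ^+ 2 / 4) ^+ k.
Proof.
rewrite !in_itv/= horner_bump => /andP[y1 y2] /andP[t1 t2] d0.
rewrite negb_and -!leNgt => far.
have td : d ^+ 2 <= (t - y) ^+ 2 by case/orP: far => ?; nra.
have h : 0 <= (2 - (t - y)) * (2 + (t - y)) by rewrite mulr_ge0//; lra.
have h1 : 0 <= 1 - (t - y) ^+ 2 / 4 by lra.
rewrite lerXn2r ?nnegrE//.
  by apply: (le_trans h1); lra.
by lra.
Qed.

End Bump.

(** * Comparison of the two Christoffel functions *)

Section ChristoffelComparison.
Variables (R : realType) (mu : {finite_measure set (measurableTypeR R) -> \bar R}).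
Variable p : nat -> {poly R}.
Hypothesis p_orth : orthonormal_polys mu p.
Local Notation leb := (@lebesgue_measure R).
Local Notation L := (mu_form mu).
Local Notation W := (@chebU_form R).
Local Notation K := (repro_kernel p).
Local Notation Kw := (repro_kernel (@chebU_on R)).

Lemma p_size n : size (p n) = n.+1.
Proof. by case: p_orth. Qed.

Lemma p_form n m : L (p n * p m) = (n == m)%:R.
Proof.
case: p_orth => _ _ <-; rewrite /mu_form.
by apply: eq_Rintegral => x _; rewrite hornerM.
Qed.

Let form_ge0 (P : {poly R}) : (forall x, x \in `[-1, 1] -> 0 <= P.[x]) -> 0 <= L P.
Proof. exact: mu_form_ge0. Qed.

Lemma chebU_form_ge0 (P : {poly R}) :
  (forall x, x \in `[-1, 1] -> 0 <= P.[x]) -> 0 <= W P.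
Proof.
by move=> P0; apply: Rintegral_ge0 => x x1; rewrite mulr_ge0 ?P0// sqrtr_ge0.
Qed.

Lemma size_mul_bump n k y (P : {poly R}) : (size P <= n)%N ->
  (size (P * bump k y)%R <= n + 2 * k)%N.
Proof.
move=> sP; apply: (leq_trans (size_polyMleq _ _)).
rewrite -ltnS; case: (size P + size _)%N (leq_add sP (size_bump k y)) => [|j] //=.
by rewrite addnS ltnS.
Qed.

Lemma bump_sqr_le1 k (y t : R) : y \in `[-1, 1] -> t \in `[-1, 1] -> (bump k y).[t] ^+ 2 <= 1.
Proof. by move=> y1 t1; have /andP[? ?] := bump_itv k y1 t1; rewrite exprn_ile1. Qed.

Lemma bump_sqr_far k (y t d : R) : y \in `[-1, 1] -> t \in `[-1, 1] -> 0 < d ->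
  t \notin `]y - d, y + d[ -> (bump k y).[t] ^+ 2 <= (1 - d ^+ 2 / 4) ^+ (2 * k).
Proof.
move=> y1 t1 d0 far; rewrite mulnC exprM.
have /andP[h1 _] := bump_itv k y1 t1; have h2 := bump_far k y1 t1 d0 far.
by rewrite lerXn2r ?nnegrE// (le_trans h1).
Qed.

(** Insert G = K_n(y,.) times the bump, with G(y) = K_n(y,y), into the Christoffel inequality of the
    Chebyshev weight. Near y the form of mu takes over and reproduces K_n(y,y); far from y the bump
    damps K_n(y,t)^2 <= K_n(y,y) T. A factor K_n(y,y) then cancels. *)
Lemma kernel_le_chebU n k (y d v T : R) :
  y \in `[-1, 1] -> 0 < d -> `]y - d, y + d[ `<=` (`]-1, 1[ : set R) -> 0 <= v ->
  (forall A, measurable A -> A `<=` [set` `]y - d, y + d[] ->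
     (\int[leb]_(x in A) (v * Num.sqrt (1 - x ^+ 2))%:E <= mu A)%E) ->
  (forall t, t \in `[-1, 1] -> K n t t <= T) ->
  v * K n y y <= Kw (n + 2 * k) y y * (1 + v * (2 * ((1 - d ^+ 2 / 4) ^+ (2 * k) * T))).
Proof.
move=> y1 d0 Jsub v0 Hmu KT; set q := (1 - _ / 4) ^+ _.
have T0 : 0 <= T by apply: le_trans (KT y y1); exact: repro_kernel_ge0.
have q0 : 0 <= q by rewrite /q mulnC exprM sqr_ge0.
pose P := kernel_poly p n y.
have sP : (size P <= n)%N by exact: size_kernel_poly p_size _ _.
have PP : L (P * P) = K n y y by exact: form_kernel_poly p_size p_form _ _.
have Py : P.[y] = K n y y by exact: horner_kernel_poly.
have := christoffel_ineq (@size_chebU_on R) (@chebU_on_orth R) y (size_mul_bump k y sP).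
rewrite hornerM bump_center mulr1 Py; set G := P * bump k y; set Q := Kw _ y y => main.
have Q0 : 0 <= Q by exact: repro_kernel_ge0.
have K0 : 0 <= K n y y by exact: repro_kernel_ge0.
have GG t : (G * G).[t] = P.[t] ^+ 2 * (bump k y).[t] ^+ 2.
  by rewrite /G !hornerM; ring.
have GG0 t : t \in `[-1, 1] -> 0 <= (G * G).[t].
  by move=> _; rewrite hornerM -expr2 sqr_ge0.
have step : v * W (G * G) <= K n y y + v * (2 * (q * (K n y y * T))).
  have -> : K n y y = L (P * P) by [].
  apply: le_trans (chebU_form_le (B := q * (L (P * P) * T)) Jsub v0 Hmu GG0 _ _) _.
  - by rewrite mulr_ge0// mulr_ge0// PP.
  - move=> t t1 far; rewrite GG mulrC; apply: ler_pM; rewrite ?sqr_ge0//.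
      exact: bump_sqr_far.
    apply: le_trans (christoffel_ineq p_size p_form t sP) _.
    by rewrite /= PP mulrC ler_wpM2l ?KT.
  - rewrite lerD2r; apply: (form_mono form_ge0) => t t1.
    by rewrite GG hornerM -expr2 ler_piMr ?sqr_ge0// bump_sqr_le1.
have [K00|Kn0] := eqVneq (K n y y) 0.
  by rewrite K00 mulr0 mulr_ge0// addr_ge0// !mulr_ge0.
have Kp : 0 < K n y y by rewrite lt_def Kn0.
rewrite -(ler_pM2r Kp).
apply: (@le_trans _ _ (Q * (v * W (G * G)))).
  by rewrite -mulrA -expr2 [Q * _]mulrCA ler_wpM2l.
apply: (le_trans (ler_wpM2l Q0 step)).
by rewrite le_eqVlt; apply/orP; left; apply/eqP; ring.
Qed.

Lemma chebU_kernel_bound N t : t \in `[-1, 1] -> Kw N t t <= N%:R ^+ 3.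
Proof.
move=> t1; rewrite /repro_kernel.
apply: (@le_trans _ _ (\sum_(k < N) N%:R ^+ 2)); last first.
  by rewrite sumr_const card_ord -[leLHS]mulr_natl -exprS.
apply: ler_sum => k _; rewrite /chebU_on !hornerZ.
have -> : forall a b : R, a * b * (a * b) = a ^+ 2 * b ^+ 2 by move=> a b; ring.
have p0 : 0 < pi :> R := pi_gt0 R.
rewrite sqr_sqrtr ?divr_ge0 ?(ltW p0)// -[leRHS]mul1r ler_pM ?sqr_ge0 ?divr_ge0 ?(ltW p0)//.
  by rewrite ler_pdivrMr// mul1r pi_ge2.
rewrite -real_normK ?num_real// lerXn2r ?nnegrE//.
by rewrite (le_trans (chebU_bound _ t1))// ler_nat.
Qed.

Definition test_poly N k (y : R) : {poly R} :=
  (Kw N y y)^-1 *: (kernel_poly (@chebU_on R) N y * bump k y).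

Lemma horner_test_poly N k y t :
  (test_poly N k y).[t] = Kw N y t / Kw N y y * (bump k y).[t].
Proof. by rewrite hornerZ hornerM horner_kernel_poly mulrA [_^-1 * _]mulrC. Qed.

Lemma test_poly_center N k y : (0 < N)%N -> (test_poly N k y).[y] = 1.
Proof.
move=> N0; rewrite horner_test_poly bump_center mulr1 divff// gt_eqF//.
by apply: repro_kernel_gt0 => //; exact: size_chebU_on.
Qed.

Lemma size_test_poly N k y : (size (test_poly N k y) <= N + 2 * k)%N.
Proof.
apply: (leq_trans (size_scale_leq _ _)); apply: size_mul_bump.
exact: size_kernel_poly (@size_chebU_on R) _ _.
Qed.

Lemma form_test_poly_le N k (y d v : R) : (0 < N)%N ->
  y \in `[-1, 1] -> 0 < d -> `]y - d, y + d[ `<=` (`]-1, 1[ : set R) -> 0 <= v ->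
  (forall A, measurable A -> A `<=` [set` `]y - d, y + d[] ->
     (mu A <= \int[leb]_(x in A) (v * Num.sqrt (1 - x ^+ 2))%:E)%E) ->
  L (test_poly N k y * test_poly N k y) * Kw N y y <=
    v + (1 - d ^+ 2 / 4) ^+ (2 * k) * N%:R ^+ 3 * fine (mu setT).
Proof.
move=> N0 y1 d0 Jsub v0 Hmu; set q := (1 - _ / 4) ^+ _; set S := test_poly N k y.
have q0 : 0 <= q by rewrite /q mulnC exprM sqr_ge0.
set Q := Kw N y y; have Q0 : 0 < Q by apply: repro_kernel_gt0 => //; exact: size_chebU_on.
pose P := Q^-1 *: kernel_poly (@chebU_on R) N y.
have SE t : (S * S).[t] = P.[t] ^+ 2 * (bump k y).[t] ^+ 2.
  by rewrite /S /test_poly -/Q /P !(hornerM, hornerZ); ring.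
have PP : W (P * P) = Q^-1.
  rewrite /P -scalerAl -scalerAr !linearZ/=.
  rewrite (form_kernel_poly (@size_chebU_on R) (@chebU_on_orth R)) -/Q.
  by rewrite mulVf ?mulr1// gt_eqF.
have sP : (size P <= N)%N.
  apply: (leq_trans (size_scale_leq _ _)).
  exact: size_kernel_poly (@size_chebU_on R) _ _.
have SS0 t : t \in `[-1, 1] -> 0 <= (S * S).[t].
  by move=> _; rewrite hornerM -expr2 sqr_ge0.
have := mu_form_le (B := q * (N%:R ^+ 3 / Q)) Jsub v0 Hmu SS0.
move=> /(_ _ _)/le_trans main.
rewrite -ler_pdivlMr//; apply: main.
- by rewrite mulr_ge0// divr_ge0 ?exprn_ge0// ltW.
- move=> t t1 far; rewrite SE mulrC; apply: ler_pM; rewrite ?sqr_ge0//.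
    exact: bump_sqr_far.
  apply: le_trans (christoffel_ineq (@size_chebU_on R) (@chebU_on_orth R) t sP) _.
  by rewrite /= PP ler_wpM2r ?invr_ge0 ?(ltW Q0) ?chebU_kernel_bound.
rewrite mulrDl lerD//.
  rewrite ler_wpM2l// -PP; apply: (form_mono chebU_form_ge0) => t t1.
  by rewrite SE hornerM -expr2 ler_piMr ?sqr_ge0// bump_sqr_le1.
by rewrite le_eqVlt; apply/orP; left; apply/eqP; ring.
Qed.

End ChristoffelComparison.

(** * Cosine sums and asymptotics of the Chebyshev kernel *)

Section CosineSums.
Variable R : realType.
Implicit Types (a b x t th ph : R).

(* [(x - a) * (x - b) <= 0] says that [x] lies between [a] and [b], in whichever
   order they come. *)
Lemma mvt_between (f df : R -> R) a b :
  (forall x, (x - a) * (x - b) <= 0 -> is_derive x 1 f (df x)) ->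
  exists2 c, (c - a) * (c - b) <= 0 & f b - f a = df c * (b - a).
Proof.
wlog ab : a b / a <= b.
  move=> H Hd; have [ab|/ltW ba] := leP a b; first exact: H.
  have [|c cE E] := H b a ba; first by move=> x; rewrite mulrC; exact: Hd.
  by exists c; [rewrite mulrC|rewrite -opprB E -mulrN opprB].
move=> Hd.
have btw x : a <= x -> x <= b -> (x - a) * (x - b) <= 0.
  by move=> ax xb; rewrite mulr_ge0_le0// ?subr_ge0// subr_le0.
have [||c cab E] := @MVT_segment R f df a b ab.
- by move=> x; rewrite in_itv/= => /andP[/ltW ax /ltW xb]; apply: Hd; exact: btw.
- apply: derivable_within_continuous => x; rewrite in_itv/= => /andP[ax xb].
  by have := Hd x (btw x ax xb) => ?; exact: ex_derive.
by exists c => //; move: cab; rewrite in_itv/= => /andP[? ?]; exact: btw.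
Qed.

Lemma between_dist a b c : (c - a) * (c - b) <= 0 -> `|c - b| <= `|b - a|.
Proof.
move=> h; rewrite -ler_sqr ?nnegrE// !real_normK ?num_real//.
by have := sqr_ge0 (c - a) => ?; nra.
Qed.

Lemma sin_mvt a b :
  exists2 c, (c - a) * (c - b) <= 0 & sin b - sin a = cos c * (b - a).
Proof. by apply: mvt_between => x _; exact: is_derive_sin. Qed.

Lemma cos_lipschitz a b : `|cos b - cos a| <= `|b - a|.
Proof.
have [c _ ->] := @mvt_between cos (fun x => - sin x) a b (fun x _ => is_derive_cos x).
by rewrite normrM normrN ler_piMl// sin_max.
Qed.

Lemma sin_taylor a b : `|sin b - sin a - (b - a) * cos b| <= (b - a) ^+ 2.
Proof.
have [c cab ->] := sin_mvt a b.
have -> : cos c * (b - a) - (b - a) * cos b = (b - a) * (cos c - cos b) by ring.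
rewrite normrM -[leRHS]real_normK ?num_real// expr2 ler_wpM2l//.
apply: (le_trans (cos_lipschitz _ _)); exact: between_dist.
Qed.

Definition cosum (N : nat) a : R := \sum_(k < N) cos (k.+1%:R * a).

Lemma cosum_telescope N a : 2 * sin (a / 2) * cosum N a =
  sin (N%:R * a + a / 2) - sin (a / 2).
Proof.
elim: N => [|N IH]; first by rewrite /cosum big_ord0 mulr0 mul0r add0r subrr.
rewrite /cosum big_ord_recr/= -/(cosum N a) mulrDr IH.
have -> : N%:R * a + a / 2 = N.+1%:R * a - a / 2 by rewrite -natr1; field.
by rewrite sinB sinD; ring.
Qed.

(** The Dirichlet kernel estimate: bounded in N as long as a stays away from the multiples of 2
    pi. *)
Lemma cosum_bound N a : `|sin (a / 2)| * `|cosum N a| <= 1.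
Proof.
have := cosum_telescope N a => /(congr1 Num.norm); rewrite !normrM ger0_norm// => E.
have : `|sin (N%:R * a + a / 2) - sin (a / 2)| <= 2.
  rewrite (le_trans (ler_normB _ _))//; have := sin_max (N%:R * a + a / 2).
  by have := sin_max (a / 2); lra.
rewrite -E; lra.
Qed.

Lemma cosum_sin N a : `|sin (N%:R * a) - a * cosum N a| <= N%:R * a ^+ 2.
Proof.
elim: N => [|N IH]; first by rewrite /cosum big_ord0 mulr0 !mul0r sin0 subrr normr0.
rewrite /cosum big_ord_recr/= -/(cosum N a).
have T := sin_taylor (N%:R * a) (N.+1%:R * a).
have E : N.+1%:R * a - N%:R * a = a by rewrite -natr1; ring.
rewrite E in T.
have -> : sin (N.+1%:R * a) - a * (cosum N a + cos (N.+1%:R * a)) =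
  (sin (N%:R * a) - a * cosum N a) +
  (sin (N.+1%:R * a) - sin (N%:R * a) - a * cos (N.+1%:R * a)) by ring.
apply: (le_trans (ler_normD _ _)).
by rewrite -[in leRHS]natr1 mulrDl mul1r lerD.
Qed.

Definition sinc t : R := if t == 0 then 1 else sin t / t.

(** The left term is a Riemann sum of mesh 1/N for the integral of cos(N a s) over s in [0,1], which
    is sinc(N a). *)
Lemma cosum_sinc N a : (0 < N)%N -> `|cosum N a / N%:R - sinc (N%:R * a)| <= `|a|.
Proof.
move=> N0; have Np : 0 < N%:R :> R by rewrite ltr0n.
have Nn0 : N%:R != 0 :> R by rewrite gt_eqF.
rewrite /sinc mulf_eq0 (negbTE Nn0)/=; have [->|a0] := eqVneq a 0.
  rewrite /cosum; under eq_bigr do rewrite mulr0 cos0.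
  by rewrite sumr_const card_ord divff// subrr.
have -> : cosum N a / N%:R - sin (N%:R * a) / (N%:R * a) =
   - (sin (N%:R * a) - a * cosum N a) / (N%:R * a).
  by field; rewrite a0 Nn0.
have na : 0 < `|a| by rewrite normr_gt0.
rewrite normrM normrN normfV normrM (ger0_norm (ltW Np)) ler_pdivrMr ?mulr_gt0//.
apply: (le_trans (cosum_sin N a)); rewrite -[a ^+ 2]real_normK ?num_real// expr2.
by rewrite mulrCA.
Qed.

Lemma cosum_lipschitz N a b : `|cosum N a - cosum N b| <= N%:R ^+ 2 * `|a - b|.
Proof.
rewrite /cosum -sumrB (le_trans (ler_norm_sum _ _ _))//.
apply: (@le_trans _ _ (\sum_(k < N) N%:R * `|a - b|)).
  apply: ler_sum => k _; apply: (le_trans (cos_lipschitz _ _)).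
  by rewrite -mulrBr normrM ger0_norm// ler_wpM2r// ler_nat.
by rewrite sumr_const card_ord -[leLHS]mulr_natl mulrA -expr2.
Qed.

(** sinc is the limit of the averages [cosum M (x / M) / M], each 1-Lipschitz in x; this bypasses
    the quotient at 0. *)
Lemma sinc_lipschitz a b : `|sinc a - sinc b| <= `|a - b|.
Proof.
apply/ler_addgt0Pr => e e0.
have [N Ne] : exists N : nat, (`|a| + `|b|) / N.+1%:R <= e.
  have h0 : 0 <= (`|a| + `|b|) / e by rewrite divr_ge0 ?addr_ge0// ltW.
  exists (Num.trunc ((`|a| + `|b|) / e)); rewrite ler_pdivrMr// mulrC -ler_pdivrMr//.
  by rewrite ltW// truncnS_gt.
set M := N.+1 in Ne; have M0 : 0 < M%:R :> R by rewrite ltr0n.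
have Mn0 : M%:R != 0 :> R by rewrite gt_eqF.
have H x : `|cosum M (x / M%:R) / M%:R - sinc x| <= `|x| / M%:R.
  have := @cosum_sinc M (x / M%:R) isT; rewrite [M%:R * _]mulrC divfK//.
  by rewrite normrM normfV (ger0_norm (ltW M0)).
have Hl : `|cosum M (a / M%:R) / M%:R - cosum M (b / M%:R) / M%:R| <= `|a - b|.
  rewrite -mulrBl normrM normfV (ger0_norm (ltW M0)) ler_pdivrMr//.
  apply: (le_trans (cosum_lipschitz _ _ _)).
  rewrite -mulrBl normrM normfV (ger0_norm (ltW M0)) le_eqVlt; apply/orP; left.
  by apply/eqP; field.
have -> : sinc a - sinc b = - (cosum M (a / M%:R) / M%:R - sinc a)
  + (cosum M (a / M%:R) / M%:R - cosum M (b / M%:R) / M%:R)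
  + (cosum M (b / M%:R) / M%:R - sinc b) by ring.
rewrite (le_trans (ler_normD _ _))// (le_trans (lerD (ler_normD _ _) (lexx _)))//.
rewrite normrN; have := H a; have := H b; move: Hl Ne.
rewrite mulrDl; lra.
Qed.

Local Notation Kw := (repro_kernel (@chebU_on R)).

Lemma chebU_kernel_cos N th ph :
  pi * (sin th * sin ph) * Kw N (cos th) (cos ph) = cosum N (th - ph) - cosum N (th + ph).
Proof.
rewrite /repro_kernel /cosum -sumrB mulr_sumr; apply: eq_bigr => k _.
have p0 : 0 < pi :> R := pi_gt0 R.
rewrite /chebU_on !hornerZ.
have -> : forall s u v : R, pi * (sin th * sin ph) * (s * u * (s * v)) =
   pi * s ^+ 2 * ((u * sin th) * (v * sin ph)) by move=> *; ring.
rewrite sqr_sqrtr ?divr_ge0 ?(ltW p0)// !chebU_sin.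
rewrite mulrBr mulrDr cosB cosD; move: pi p0 => P p0; field.
by rewrite gt_eqF.
Qed.

Local Notation rt t := (Num.sqrt (1 - t ^+ 2)).

Lemma oo_sqrt_gt0 t : t \in `]-1, 1[ -> 0 < rt t.
Proof.
rewrite in_itv/= => /andP[t1 t2]; rewrite sqrtr_gt0 subr_gt0; nra.
Qed.

Lemma oo_acosK t : t \in `]-1, 1[ -> cos (acos t) = t /\ sin (acos t) = rt t.
Proof.
rewrite in_itv/= => /andP[/ltW t1 /ltW t2].
by split; [rewrite acosK// in_itv/= t1 t2|rewrite sin_acos// t1 t2].
Qed.

Lemma chebU_kernel_diag N t : t \in `]-1, 1[ ->
  `|pi * (1 - t ^+ 2) * Kw N t t - N%:R| <= (rt t)^-1.
Proof.
move=> t1; have [cE sE] := oo_acosK t1; have s0 := oo_sqrt_gt0 t1.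
have := chebU_kernel_cos N (acos t) (acos t).
rewrite sE cE -expr2 sqr_sqrtr; last by rewrite ltW// -sqrtr_gt0.
move=> ->; rewrite subrr.
have -> : cosum N 0 = N%:R.
  by rewrite /cosum; under eq_bigr do rewrite mulr0 cos0; rewrite sumr_const card_ord.
rewrite addrAC subrr add0r normrN -[leRHS]mul1r ler_pdivlMr// mulrC.
have := cosum_bound N (acos t + acos t).
have -> : (acos t + acos t) / 2 = acos t by field.
by rewrite sE ger0_norm// ltW.
Qed.

(** The error is the cosine sum at th + ph, at most 1/|sin((th + ph)/2)| by [cosum_bound], and sin
    th + sin ph is at most 2 |sin((th + ph)/2)|. *)
Lemma chebU_kernel_offdiag N t x : t \in `]-1, 1[ -> x \in `]-1, 1[ ->
  `|pi * (rt t * rt x) * Kw N t x - cosum N (acos t - acos x)| <= 2 / (rt t + rt x).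
Proof.
move=> t1 x1; have [cE sE] := oo_acosK t1; have s0 := oo_sqrt_gt0 t1.
have [cE' sE'] := oo_acosK x1; have s0' := oo_sqrt_gt0 x1.
have := chebU_kernel_cos N (acos t) (acos x); rewrite sE cE sE' cE' => ->.
rewrite addrAC subrr add0r normrN ler_pdivlMr ?addr_gt0// mulrC.
set u := acos t in sE *; set v := acos x in sE' *.
have E : rt t + rt x = 2 * sin ((u + v) / 2) * cos ((u - v) / 2).
  rewrite -sE -sE'.
  transitivity (sin ((u + v) / 2 + (u - v) / 2) + sin ((u + v) / 2 - (u - v) / 2)).
    by congr (sin _ + sin _); field.
  by rewrite sinB sinD; ring.
have h : rt t + rt x <= 2 * `|sin ((u + v) / 2)|.
  rewrite -[leLHS]ger0_norm; last by rewrite addr_ge0// ltW.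
  by rewrite E !normrM (ger0_norm (ler0n R 2)) ler_piMr// cos_max.
have B := cosum_bound N (u + v).
apply: (le_trans (ler_wpM2r (normr_ge0 _) h)); rewrite -mulrA; lra.
Qed.

End CosineSums.

(** * Uniformity on a segment *)

Section Preliminaries.
Variable R : realType.

(* Unlike the Heine theorem, [t] is not confined to [a, b]. *)
Lemma uniform_continuity_near_segment (g : R -> R) (a b : R) :
  (forall x, x \in `[a, b] -> {for x, continuous g}) ->
  forall e, 0 < e -> exists2 d, 0 < d &
    forall x t, x \in `[a, b] -> `|t - x| < d -> `|g t - g x| <= e.
Proof.
move=> cg e e0.
have /compact_near_coveringP/near_covering_withinP := @segment_compact R a b.
move=> /(_ R 0^'+ (fun d x => forall t, `|t - x| < d -> `|g t - g x| <= e) _).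
case=> [x xab|d /= d0 H].
  have e2 : 0 < e / 2 by rewrite divr_gt0.
  have /cvgrPdist_le /(_ _ e2) := cg x xab.
  move=> /nbhs_ballP [r /= r0 Hr].
  have r2 : 0 < r / 2 by rewrite divr_gt0.
  exists (ball x (r / 2), [set d | 0 < d < r / 2]) => /=.
    split; first by exists (r / 2).
    exists (r / 2) => //= y /=; rewrite sub0r normrN => h1 h2.
    by rewrite h2/= (le_lt_trans (ler_norm _) h1).
  move=> [y d] /= [xy /andP[d0 dr]] _ t td.
  have B z : `|x - z| < r -> `|g x - g z| <= e / 2 by move=> h; exact: Hr.
  have xy' : `|x - y| < r / 2 by exact: xy.
  have xt : `|x - t| < r.
    have -> : x - t = (x - y) - (t - y) by ring.
    by rewrite (le_lt_trans (ler_normB _ _))//; lra.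
  have := B t xt; have /B : `|x - y| < r by lra.
  have -> : g t - g y = (g x - g y) - (g x - g t) by ring.
  by move=> h1 h2; rewrite (le_trans (ler_normB _ _))//; lra.
exists (d / 2); first by rewrite divr_gt0.
move=> x t xab tx; apply: (H (d / 2) _ _ x xab t tx) => /=.
  by rewrite sub0r normrN gtr0_norm ?divr_gt0//; lra.
by rewrite divr_gt0.
Qed.

(** The sequence picks at each index a point violating the estimate, if there is one; convergence
    along it leaves none for large n. *)
Lemma uniform_cvg_seq (A : set R) (f : nat -> R -> R) (l : R) :
  (forall x : nat -> R, (forall n, A (x n)) -> (fun n => f n (x n)) @ \oo --> l) ->
  {uniform A, f @ \oo --> (fun=> l)}.
Proof.
move=> H P /uniform_nbhs [E [entE EP]].
have [e e0 He] : exists2 e, 0 < e & forall u v : R, `|u - v| < e -> E (u, v).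
  by move: entE; rewrite -entourage_ballE => -[e /= e0 He]; exists e => // u v uv; exact: He.
suff : \forall n \near \oo, forall y, A y -> `|l - f n y| < e.
  by apply: filterS => n Hn; apply: EP => y Ay; apply: He; exact: Hn.
have [A0|/set0P[x0 Ax0]] := eqVneq A set0.
  by apply: nearW => n y; rewrite A0.
pose bad n y := A y /\ ~ `|l - f n y| < e.
pose x n := if pselect (exists y, bad n y) is left h then projT1 (cid h) else x0.
have Ax n : A (x n).
  by rewrite /x; case: pselect => // h; case: cid => y [].
have /cvgrPdist_lt /(_ e e0) := H x Ax.
apply: filterS => n; rewrite /x; case: pselect => [h|nb _ y Ay].
  by case: cid => y [].
by apply: contrapT => bd; apply: nb; exists y.
Qed.

End Preliminaries.

(** * Subexponential growth of the kernel of a regular measure *)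

Section LeadGrowth.
Variables (R : realType) (mu : {finite_measure set (measurableTypeR R) -> \bar R}).
Variable p : nat -> {poly R}.
Hypothesis p_orth : orthonormal_polys mu p.
Hypothesis mu_reg : regular_measure mu.

(** The limit of the n-th roots gives the bound for large n; the sum of the first leading
    coefficients, put into K, covers the other indices. *)
Lemma lead_growth (rho : R) : 1 < rho ->
  exists2 K, 0 < K & forall n, 0 <= lead_coef (p n) <= K * (2 * rho) ^+ n.
Proof.
move=> rho1; have [q q_orth qlim] := mu_reg.
have [_ lp _] := p_orth; have [_ lq _] := q_orth.
have qp n : q n = p n.
  apply: (orthonormal_unique (p_size p_orth) (p_form p_orth)) => //.
    exact: p_size q_orth.
  exact: p_form q_orth.
have l0 n : 0 <= lead_coef (p n) by rewrite ltW.
have r0 : 0 < 2 * rho by rewrite mulr_gt0// (lt_trans _ rho1).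
have : \forall n \near \oo, lead_coef (p n) <= (2 * rho) ^+ n.
  have /cvgrPdist_le /(_ (2 * rho - 2)) := qlim.
  have -> : 0 < 2 * rho - 2 by lra.
  move=> /(_ isT) near1; near=> n.
  have n0 : n != 0%N by rewrite -lt0n; near: n; exists 1%N.
  have nn0 : n%:R != 0 :> R by rewrite pnatr_eq0.
  have : `|2 - lead_coef (q n) `^ n%:R^-1| <= 2 * rho - 2 by near: n.
  rewrite qp distrC => /(le_trans (ler_norm _)) h.
  have h2 : lead_coef (p n) `^ n%:R^-1 <= 2 * rho by lra.
  have -> : lead_coef (p n) = (lead_coef (p n) `^ n%:R^-1) ^+ n.
    by rewrite -powR_mulrn ?powR_ge0// -powRrM mulVf// powRr1.
  by rewrite lerXn2r// nnegrE ?powR_ge0// ltW.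
move=> [N _ HN]; exists (1 + \sum_(k < N) lead_coef (p k)).
  by rewrite ltr_pwDl// sumr_ge0.
move=> n; rewrite l0/=.
have rn1 : 1 <= (2 * rho) ^+ n by rewrite exprn_ege1//; lra.
have S0 : 0 <= \sum_(k < N) lead_coef (p k) by rewrite sumr_ge0.
have [Nn|nN] := leqP N n.
  apply: (le_trans (HN n Nn)); rewrite ler_peMl ?lerDl//.
  by rewrite (le_trans _ rn1).
apply: (@le_trans _ _ (1 + \sum_(k < N) lead_coef (p k))).
  rewrite (bigD1 (Ordinal nN))//= addrCA lerDl addr_ge0// sumr_ge0//.
by rewrite ler_peMr// addr_ge0.
Unshelve. all: by end_near. Qed.

(** Each of the n terms grows at rate s, and the factor n is absorbed by a second s, with s^2 <=
    rho. *)
Lemma kernel_growth (rho : R) : 1 < rho ->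
  exists2 K, 0 < K & forall n t, t \in `[-1, 1] -> repro_kernel p n t t <= K * rho ^+ n.
Proof.
move=> rho1; have [s s1 srho] := root_gt1 2 rho1.
have s0 : 0 < s by exact: lt_trans s1.
have [K1 K10 H1] := orthonormal_sup_growth (p_size p_orth) (p_form p_orth)
  (@mu_form_ge0 R mu) lead_growth s1.
have [K2 K20 H2] := linear_le_exp s1.
exists (K1 * K2); first by rewrite mulr_gt0.
move=> n t t1; apply: (@le_trans _ _ (\sum_(k < n) (K1 * s ^+ n))).
  apply: ler_sum => k _; rewrite -expr2; apply: (le_trans (H1 k t t1)).
  by rewrite ler_wpM2l ?(ltW K10)// ler_weXn2l ?(ltW s1)// ltnW.
rewrite sumr_const card_ord -[leLHS]mulr_natl.
have n1 : n%:R <= K2 * s ^+ n by apply: le_trans (H2 n); rewrite ler_nat.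
apply: (@le_trans _ _ (K2 * s ^+ n * (K1 * s ^+ n))).
  by rewrite ler_wpM2r// mulr_ge0 ?exprn_ge0 ?ltW.
have -> : K2 * s ^+ n * (K1 * s ^+ n) = K1 * K2 * (s ^+ 2) ^+ n.
  by rewrite exprAC expr2; ring.
rewrite ler_wpM2l ?mulr_ge0 ?(ltW K10) ?(ltW K20)//.
by rewrite lerXn2r// nnegrE ?exprn_ge0 ?(ltW s0)// (le_trans _ srho)// exprn_ge0// ltW.
Qed.

End LeadGrowth.

(** * Exponential decay in n / h *)

Section Decay.
Variable R : realType.
Implicit Types (q c e : R).

Lemma divn_pinfty h : (0 < h)%N -> (fun n => n %/ h)%N @ \oo --> \oo.
Proof.
move=> h0 P [N _ HN]; exists (N * h)%N => // n /= Nn.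
by apply: HN => /=; rewrite leq_divRL.
Qed.

Lemma exp_divn_small h q c e : (0 < h)%N -> 0 <= q < 1 -> 0 < e ->
  \forall n \near \oo, c * q ^+ (n %/ h) <= e.
Proof.
move=> h0 /andP[q0 q1] e0.
have H : (fun n => c * q ^+ n) @ \oo --> (0 : R).
  rewrite -(mulr0 c); apply: cvgM; first exact: cvg_cst.
  by apply: cvg_expr; rewrite ger0_norm.
have : (fun n => c * q ^+ (n %/ h)) @ \oo --> (0 : R).
  exact: (cvg_comp _ _ (divn_pinfty h0) H).
move=> /cvgrPdist_le /(_ e e0); apply: filterS => n.
by rewrite sub0r normrN => /(le_trans (ler_norm _)).
Qed.

End Decay.

(** * Two-sided estimates near the segment *)

Section Asymptotics.
Variables (R : realType) (mu : {finite_measure set (measurableTypeR R) -> \bar R}).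
Variable p : nat -> {poly R}.
Hypothesis p_orth : orthonormal_polys mu p.
Hypothesis mu_reg : regular_measure mu.
Variable w : R -> R.
Hypothesis w_dens : ac_density mu w.
Variables a b : R.
Hypotheses (a_gt : -1 < a) (ab : a <= b) (b_lt : b < 1).
Hypothesis mu_ac : exists c d : R, [/\ c < a, b < d
     & mrestr mu (measurable_itv `]c, d[) `<< @lebesgue_measure R].
Hypothesis w_pos : forall x, x \in `[a, b] -> 0 < w x.
Hypothesis w_cont : forall x, x \in `[a, b] -> {for x, continuous w}.
Local Notation K := (repro_kernel p).
Local Notation Kw := (repro_kernel (@chebU_on R)).
Local Notation L := (mu_form mu).
Local Notation rt t := (Num.sqrt (1 - t ^+ 2)).

(** The density of mu relative to the semicircle weight: near a point of the segment, mu is almost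
    this constant times that weight. *)
Definition rel_density (t : R) : R := w t / rt t.
Local Notation g := rel_density.

Lemma segment_oo x : x \in `[a, b] -> x \in `]-1, 1[.
Proof.
rewrite !in_itv/= => /andP[ax xb].
by rewrite (lt_le_trans a_gt ax) (le_lt_trans xb b_lt).
Qed.

Lemma rel_density_cont x : x \in `[a, b] -> {for x, continuous g}.
Proof.
move=> xab; apply: cvgM; first exact: w_cont.
apply: cvgV; last exact: continuous_semicircle.
by rewrite gt_eqF// oo_sqrt_gt0// segment_oo.
Qed.

Lemma rel_density_gt0 x : x \in `[a, b] -> 0 < g x.
Proof. by move=> xab; rewrite divr_gt0 ?w_pos// oo_sqrt_gt0// segment_oo. Qed.

Lemma segment_bounds : exists s0 gm gM, [/\ 0 < s0, 0 < gm &
  forall x, x \in `[a, b] -> [/\ s0 <= rt x, gm <= g x & g x <= gM]].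
Proof.
have cg : {within `[a, b], continuous g}.
  by apply: continuous_in_subspaceT => x; rewrite inE => xab; exact: rel_density_cont.
have cr : {within `[a, b], continuous (fun t => rt t)}.
  by apply: continuous_subspaceT; exact: continuous_semicircle.
have [x1 x1ab H1] := EVT_min ab cr; have [x2 x2ab H2] := EVT_min ab cg.
have [x3 x3ab H3] := EVT_max ab cg.
exists (rt x1), (g x2), (g x3); split.
- by rewrite oo_sqrt_gt0// segment_oo.
- exact: rel_density_gt0.
- by move=> x xab; split; [exact: H1|exact: H2|exact: H3].
Qed.

Lemma local_bounds e : 0 < e < 1 -> exists d, [/\ 0 < d, d <= 1 &
  forall x y, x \in `[a, b] -> `|y - x| < d ->
   [/\ `]y - d, y + d[ `<=` (`]-1, 1[ : set R),
    `|g y - g x| <= e * g x, `|rt y - rt x| <= e * rt x,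
    (forall A, measurable A -> A `<=` [set` `]y - d, y + d[] ->
     (\int[@lebesgue_measure R]_(t in A) ((1 - e) * g x * rt t)%:E <= mu A)%E)
    & (forall A, measurable A -> A `<=` [set` `]y - d, y + d[] ->
     (mu A <= \int[@lebesgue_measure R]_(t in A) ((1 + e) * g x * rt t)%:E)%E)]].
Proof.
move=> /andP[e0 e1]; have [s0 [gm [gM [s00 gm0 B]]]] := segment_bounds.
have [c [c' [ca bc' ac]]] := mu_ac.
have [d1 d10 H1] := uniform_continuity_near_segment rel_density_cont (mulr_gt0 e0 gm0).
have cr x : x \in `[a, b] -> {for x, continuous (fun t : R => rt t)}.
  by move=> _; exact: continuous_semicircle.
have [d2 d20 H2] := uniform_continuity_near_segment cr (mulr_gt0 e0 s00).
(* d1 and d2 control g and the semicircle; 1 - b and a + 1 keep the neighbourhood in ]-1,1[, a - c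
   and c' - b in the interval of absolute continuity, and 1 keeps the far bound of the bump
   positive. The radius D / 2 is used below because t within D / 2 of y has to lie within D of x. *)
pose D := Num.min d1 (Num.min d2 (Num.min (1 - b) (Num.min (a + 1)
  (Num.min (a - c) (Num.min (c' - b) 1))))).
have D0 : 0 < D.
  by rewrite !lt_min d10 d20 !subr_gt0 b_lt ca bc' ltr01 -ltrBlDr sub0r a_gt.
have DE : [/\ [/\ D <= d1, D <= d2 & D <= 1 - b] & [/\ D <= a + 1, D <= a - c, D <= c' - b & D <= 1]].
  by rewrite /D !ge_min !lexx !orbT.
case: DE => [[Dd1 Dd2 D1b] [Da1 Dac Dcb D1]].
have key x t : x \in `[a, b] -> `|t - x| < D ->
  [/\ t \in `]-1, 1[, t \in `]c, c'[, `|g t - g x| <= e * g x & `|rt t - rt x| <= e * rt x].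
  move=> xab tx; have [B1 B2 _] := B x xab.
  have /andP[ax xb] : a <= x <= b by move: xab; rewrite in_itv.
  have := tx; rewrite ltr_norml => /andP[t1 t2].
  split.
  - by rewrite in_itv/=; apply/andP; split; lra.
  - by rewrite in_itv/=; apply/andP; split; lra.
  - apply: le_trans (H1 x t xab _) _; first by lra.
    by rewrite ler_wpM2l// ltW.
  - apply: le_trans (H2 x t xab _) _; first by lra.
    by rewrite ler_wpM2l// ltW.
exists (D / 2); split; [by rewrite divr_gt0|by lra|].
move=> x y xab yx; have g0 := rel_density_gt0 xab.
have tD t : t \in `]y - D / 2, y + D / 2[ -> `|t - x| < D.
  rewrite in_itv/= => /andP[t1 t2]; move: yx; rewrite !ltr_norml => /andP[y1 y2].
  by apply/andP; split; lra.
have yD : `|y - x| < D by lra.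
have [y1 _ gy ry] := key x y xab yD.
have loc t : t \in `]y - D / 2, y + D / 2[ ->
    [/\ t \in `]-1, 1[, (1 - e) * g x * rt t <= w t & w t <= (1 + e) * g x * rt t].
  move=> /tD /(key x t xab) [t1 _ gt _]; have r0 := oo_sqrt_gt0 t1.
  have wE : w t = g t * rt t by rewrite /g divfK// gt_eqF.
  move: gt; rewrite ler_norml => /andP[g1 g2].
  by split => //; rewrite wE ler_wpM2r ?(ltW r0)//; lra.
have J1 : `]y - D / 2, y + D / 2[ `<=` (`]-1, 1[ : set R).
  by move=> t /= /loc[].
have J2 : `]y - D / 2, y + D / 2[ `<=` (`]c, c'[ : set R).
  by move=> t /= /tD /(key x t xab) [].
split => // A mA AJ.
  apply: (density_lower_bound w_dens J1) => //.
    by rewrite mulr_ge0 ?(ltW g0)// subr_ge0 ltW.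
  by move=> t /loc[].
apply: (density_upper_bound w_dens J1 ac J2) => //.
by move=> t /loc[].
Qed.

(** The bump with k = n / h adds a degree 2 k, at most e n; h > 2 leaves room for subtracting it
    from n. *)
Lemma mesh_exists e : 0 < e -> exists2 h : nat, (2 < h)%N &
  forall n, 2 * (n %/ h)%:R <= e * n%:R :> R.
Proof.
move=> e0; exists (Num.trunc (2 / e)).+3 => // n; set h := _.+3.
have h0 : 0 < h%:R :> R by rewrite ltr0n.
have H : (n %/ h)%:R * h%:R <= n%:R :> R by rewrite -natrM ler_nat leq_trunc_div.
have eh : 2 <= e * h%:R.
  rewrite -ler_pdivrMl// mulrC ltW//; apply: (lt_le_trans (truncnS_gt _)).
  by rewrite ler_nat; apply: leqW.
rewrite -(ler_pM2r h0) -!mulrA; apply: (@le_trans _ _ (2 * n%:R)); first by rewrite ler_wpM2l.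
by rewrite [n%:R * _]mulrC mulrA ler_wpM2r.
Qed.

Lemma upper_eventually e : 0 < e <= 4^-1 -> exists2 d, 0 < d & \forall n \near \oo,
  forall x y, x \in `[a, b] -> `|y - x| < d ->
  (1 - e) * (pi * (1 - y ^+ 2) * g x * K n y y) <= (1 + e) * (1 + 2 * e) * n%:R.
Proof.
move=> /andP[e0 e4]; have e01 : 0 < e < 1 by rewrite e0; lra.
have [d [d0 d1 Hd]] := local_bounds e01.
have [s0 [gm [gM [s00 gm0 B]]]] := segment_bounds.
have [h h2 Hh] := mesh_exists e0; have h0 : (0 < h)%N by apply: ltn_trans h2.
pose q := 1 - d ^+ 2 / 4.
have dd : d ^+ 2 <= 1 by rewrite exprn_ile1// ltW.
have dd0 : 0 < d ^+ 2 by rewrite exprn_gt0.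
have q0 : 0 < q by rewrite /q; lra.
have q1 : q < 1 by rewrite /q; lra.
have qi1 : 1 < q^-1 by rewrite invf_gt1.
(* The growth rate of K_n is fixed after h and q: rho^h q <= 1 lets q^(k+1) absorb rho^n, as n < h
   (k + 1). *)
have [rho rho1 rhoq] := root_gt1 h qi1.
have rho0 : 0 < rho by apply: lt_trans rho1.
have [C C0 HC] := kernel_growth p_orth mu_reg rho1.
have q01 : 0 <= q < 1 by rewrite q1 ltW.
have near1 := exp_divn_small (gM * (2 * (C / q))) h0 q01 e0.
have near2 := nbhs_infty_ger (2 / s0 / e).
exists d => //; near=> n => x y xab yx.
have [Jsub gy ry low _] := Hd x y xab yx.
have [sx gx gxM] := B x xab.
have n1 : gM * (2 * (C / q)) * q ^+ (n %/ h) <= e by near: n.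
have n2 : 2 / s0 / e <= n%:R by near: n.
have g0 : 0 < g x by apply: lt_le_trans gx.
have yI : y \in `]-1, 1[ by apply: (Jsub y); rewrite /= in_itv/=; apply/andP; split; lra.
have yI' : y \in `[-1, 1] by exact: subset_itv_oo_cc yI.
set k := (n %/ h)%N in n1 *.
have v0 : 0 <= (1 - e) * g x by rewrite mulr_ge0 ?(ltW g0)//; lra.
have main := kernel_le_chebU p_orth k yI' d0 Jsub v0 low (HC n).
rewrite -/q in main.
(* Of q^(2k), one half, completed by a factor q (whence C / q), cancels the growth rho^n; the other
   half tends to 0. *)
have tiny : (1 - e) * g x * (2 * (q ^+ (2 * k) * (C * rho ^+ n))) <= e.
  apply: le_trans n1.
  have rq : rho ^+ n * q ^+ k.+1 <= 1.
    apply: (@le_trans _ _ ((rho ^+ h) ^+ k.+1 * q ^+ k.+1)).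
      rewrite ler_wpM2r ?exprn_ge0 ?(ltW q0)// -exprM ler_weXn2l ?(ltW rho1)//.
      by rewrite mulnC ltnW// ltn_ceil.
    rewrite -exprMn exprn_ile1 ?mulr_ge0 ?exprn_ge0 ?(ltW q0) ?(ltW rho0)//.
    by rewrite -ler_pdivlMr// div1r.
  have -> : (1 - e) * g x * (2 * (q ^+ (2 * k) * (C * rho ^+ n))) =
     ((1 - e) * g x) * (2 * (C / q) * q ^+ k) * (rho ^+ n * q ^+ k.+1).
    by rewrite mul2n -addnn exprD exprS; field; rewrite gt_eqF.
  rewrite [leRHS](_ : _ = gM * (2 * (C / q) * q ^+ k) * 1); last by ring.
  have c0 : 0 <= 2 * (C / q) * q ^+ k.
    by rewrite !mulr_ge0 ?invr_ge0 ?exprn_ge0 ?(ltW q0) ?(ltW C0).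
  have t0 : 0 <= rho ^+ n * q ^+ k.+1.
    by rewrite mulr_ge0 ?exprn_ge0 ?(ltW q0) ?(ltW rho0).
  apply: ler_pM => //; first exact: mulr_ge0.
  apply: ler_wpM2r => //; apply: le_trans gxM.
  by rewrite ler_piMl ?(ltW g0)//; lra.
have ry0 := oo_sqrt_gt0 yI.
have ry2 : s0 / 2 <= rt y by move: ry; rewrite ler_norml => /andP[? ?]; nra.
have diag := chebU_kernel_diag (n + 2 * k) yI.
have ryV : (rt y)^-1 <= e * n%:R.
  have : (rt y)^-1 <= 2 / s0.
    by rewrite -[2 / s0]invf_div lef_pV2 ?posrE ?divr_gt0.
  by move=> /le_trans; apply; move: n2; rewrite ler_pdivrMr// [n%:R * e]mulrC.
have Nn : (n + 2 * k)%:R <= (1 + e) * n%:R :> R.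
  by rewrite natrD natrM; have := Hh n; rewrite -/k; lra.
have Q0 : 0 <= Kw (n + 2 * k) y y by exact: repro_kernel_ge0.
have P0 : 0 <= pi * (1 - y ^+ 2).
  by rewrite mulr_ge0 ?pi_ge0// ltW// -sqrtr_gt0.
have diag2 : pi * (1 - y ^+ 2) * Kw (n + 2 * k) y y <= (1 + 2 * e) * n%:R.
  move: diag ryV Nn; rewrite ler_norml => /andP[_].
  set X := pi * _ * _; set r := (rt y)^-1; move: X r => X r; lra.
have -> : (1 - e) * (pi * (1 - y ^+ 2) * g x * K n y y) =
   pi * (1 - y ^+ 2) * ((1 - e) * g x * K n y y) by ring.
apply: (le_trans (ler_wpM2l P0 main)).
rewrite [leLHS]mulrA [leRHS](_ : _ = (1 + 2 * e) * n%:R * (1 + e)); last by ring.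
apply: ler_pM => //; first exact: mulr_ge0.
- by rewrite addr_ge0// mulr_ge0// !mulr_ge0 ?exprn_ge0 ?(ltW q0) ?(ltW C0) ?(ltW rho0).
- by rewrite lerD2l.
Unshelve. all: by end_near. Qed.

(** What remains of the size n for the Chebyshev kernel once the bump has taken its degree 2 (n /
    h). *)
Definition test_size h n : nat := (n - 2 * (n %/ h))%N.

Lemma test_sizeK h n : (2 < h)%N -> (test_size h n + 2 * (n %/ h) = n)%N.
Proof.
move=> h2; rewrite subnK//; apply: leq_trans (leq_trunc_div n h).
by rewrite mulnC leq_mul2l ltnW ?orbT.
Qed.

(** A single estimate with two uses: a lower bound for K_n(y,y), and an upper bound for the excess
    of S over the minimum. *)
Lemma test_eventually e : 0 < e <= 4^-1 -> exists d h, [/\ 0 < d, (2 < h)%N,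
  (forall n, 2 * (n %/ h)%:R <= e * n%:R :> R) & \forall n \near \oo,
  (0 < test_size h n)%N /\
  forall x y, x \in `[a, b] -> `|y - x| < d ->
  let S := test_poly (test_size h n) (n %/ h) y in
  (1 - 2 * e) * n%:R * L (S * S) <= (1 + 2 * e) * (pi * (1 - y ^+ 2) * g x)].
Proof.
move=> /andP[e0 e4]; have e01 : 0 < e < 1 by rewrite e0; lra.
have [d [d0 d1 Hd]] := local_bounds e01.
have [s0 [gm [gM [s00 gm0 B]]]] := segment_bounds.
have [h h2 Hh] := mesh_exists e0; have h0 : (0 < h)%N by apply: ltn_trans h2.
pose q := 1 - d ^+ 2 / 4.
have dd : d ^+ 2 <= 1 by rewrite exprn_ile1// ltW.
have dd0 : 0 < d ^+ 2 by rewrite exprn_gt0.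
have q0 : 0 < q by rewrite /q; lra.
have q1 : q < 1 by rewrite /q; lra.
have qi1 : 1 < q^-1 by rewrite invf_gt1.
have [C C0 HC] := poly_le_exp 3 qi1.
pose M := fine (mu setT); have M0 : 0 <= M by rewrite fine_ge0.
have q01 : 0 <= q < 1 by rewrite q1 ltW.
have near1 := exp_divn_small (h%:R ^+ 3 * C * M) h0 q01 (mulr_gt0 e0 gm0).
have near2 := nbhs_infty_ger (2 / s0 / e).
have near3 := nbhs_infty_ger (1 : R).
exists d, h; split => //; near=> n.
have n1 : h%:R ^+ 3 * C * M * q ^+ (n %/ h) <= e * gm by near: n.
have n2 : 2 / s0 / e <= n%:R by near: n.
have n3 : 1 <= n%:R :> R by near: n.
set N := test_size h n; set k := (n %/ h)%N in n1 *.
have NE : (N + 2 * k = n)%N by exact: test_sizeK.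
have NR : N%:R = n%:R - 2 * k%:R :> R by rewrite -[in RHS]NE natrD natrM; ring.
have Nn : (1 - e) * n%:R <= N%:R by rewrite NR; have := Hh n; rewrite -/k; lra.
have N0 : (0 < N)%N.
  by rewrite -(ltr0n R); apply: lt_le_trans Nn; rewrite mulr_gt0//; lra.
split => // x y xab yx; set S := test_poly N k y; rewrite /=.
have [Jsub gy ry _ up] := Hd x y xab yx.
have [sx gx gxM] := B x xab.
have g0 : 0 < g x by apply: lt_le_trans gx.
have yI : y \in `]-1, 1[ by apply: (Jsub y); rewrite /= in_itv/=; apply/andP; split; lra.
have yI' : y \in `[-1, 1] by exact: subset_itv_oo_cc yI.
have v0 : 0 <= (1 + e) * g x by rewrite mulr_ge0 ?(ltW g0)//; lra.
have main := form_test_poly_le k N0 yI' d0 Jsub v0 up.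
rewrite -/q -/M -/S in main.
(* N <= h (k + 1), and C q^(-k) dominates (k + 1)^3: again half of q^(2k) is spent and the other
   half decays. *)
have tiny : q ^+ (2 * k) * N%:R ^+ 3 * M <= e * g x.
  apply: (@le_trans _ _ (e * gm)); last by rewrite ler_wpM2l// ltW.
  apply: le_trans n1; rewrite [leRHS]mulrAC ler_wpM2r//.
  apply: (@le_trans _ _ (q ^+ (2 * k) * (h%:R ^+ 3 * (C * (q^-1) ^+ k)))).
    rewrite ler_wpM2l ?exprn_ge0 ?(ltW q0)//.
    apply: (@le_trans _ _ ((h%:R * k.+1%:R) ^+ 3)).
      rewrite lerXn2r ?nnegrE ?mulr_ge0// -natrM ler_nat.
      by rewrite (leq_trans (leq_subr _ _))// mulnC ltnW// ltn_ceil.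
    by rewrite exprMn ler_wpM2l ?exprn_ge0.
  rewrite le_eqVlt; apply/orP; left; apply/eqP.
  rewrite mul2n -addnn exprD exprVn; field.
  by rewrite expf_neq0// gt_eqF.
have ry0 := oo_sqrt_gt0 yI.
have ry2 : s0 / 2 <= rt y by move: ry; rewrite ler_norml => /andP[? ?]; nra.
have diag := chebU_kernel_diag N yI.
have ryV : (rt y)^-1 <= e * n%:R.
  have : (rt y)^-1 <= 2 / s0.
    by rewrite -[2 / s0]invf_div lef_pV2 ?posrE ?divr_gt0.
  by move=> /le_trans; apply; move: n2; rewrite ler_pdivrMr// [n%:R * e]mulrC.
have LS0 : 0 <= L (S * S) by apply: mu_form_ge0 => t _; rewrite hornerM -expr2 sqr_ge0.
have P0 : 0 <= pi * (1 - y ^+ 2).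
  by rewrite mulr_ge0 ?pi_ge0// ltW// -sqrtr_gt0.
have diag2 : (1 - 2 * e) * n%:R <= pi * (1 - y ^+ 2) * Kw N y y.
  move: diag ryV Nn; rewrite ler_norml => /andP[+ _].
  set X := pi * _ * _; set r := (rt y)^-1; move: X r => X r; lra.
apply: (le_trans (ler_wpM2r LS0 diag2)).
have -> : pi * (1 - y ^+ 2) * Kw N y y * L (S * S) =
  pi * (1 - y ^+ 2) * (L (S * S) * Kw N y y) by ring.
apply: (le_trans (ler_wpM2l P0 main)).
rewrite [leRHS](_ : _ = pi * (1 - y ^+ 2) * ((1 + 2 * e) * g x)); last by ring.
by rewrite ler_wpM2l//; lra.
Unshelve. all: by end_near. Qed.

End Asymptotics.

(** * Numerical inequalities *)

Section Arithmetic.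
Variable R : realType.
Implicit Types (e u v r : R).

Lemma diag_arith e B : 0 < e <= 4^-1 -> (1 - e) * B <= (1 + e) * (1 + 2 * e) ->
  1 - 2 * e <= (1 + 2 * e) * B -> `|B - 1| <= 8 * e.
Proof. by move=> /andP[e0 e4] h1 h2; rewrite ler_norml; apply/andP; split; nra. Qed.

(** Used with A = K(z,z) L(S^2), C = K(z,z)/K(y,y), and B a rescaled K(z,z) tending to 1. *)
Lemma excess_arith e A B C : 0 < e <= 4^-1 -> e <= 16^-1 -> (1 - 2 * e) * A <= (1 + 2 * e) * B ->
  B <= 1 + e -> `|C - 1| <= e -> A - C <= 10 * e.
Proof.
by move=> /andP[e0 _] e16 h1 h2; rewrite ler_norml => /andP[h3 h4]; nra.
Qed.

Lemma bernoulli_le u k : 0 <= u <= 1 -> 1 - k%:R * u <= (1 - u) ^+ k.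
Proof.
move=> /andP[u0 u1]; elim: k => [|k IH]; first by rewrite mul0r subr0 expr0.
rewrite exprS -natr1; have k0 : 0 <= k%:R :> R by [].
apply: (@le_trans _ _ ((1 - u) * (1 - k%:R * u))); first by nra.
by rewrite ler_wpM2l// subr_ge0.
Qed.

Lemma product_close e u v r s : 0 <= e <= 4^-1 -> `|u - v| <= e * (s + 4) -> `|v| <= 1 + s ->
  0 <= s -> `|r - 1| <= e -> `|u * r - v| <= 3 * (s + 5) * e.
Proof.
move=> /andP[e0 e4] uv v1 s0 r1.
have -> : u * r - v = (u - v) * r + v * (r - 1) by ring.
rewrite (le_trans (ler_normD _ _))// !normrM.
have r2 : `|r| <= 3 / 2.
  have -> : r = (r - 1) + 1 by ring.
  by rewrite (le_trans (ler_normD _ _))// normr1; lra.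
have h1 : `|u - v| * `|r| <= (e * (s + 4)) * (3 / 2) by rewrite ler_pM.
have h2 : `|v| * `|r - 1| <= (1 + s) * e by rewrite ler_pM.
nra.
Qed.

Lemma cvg1_mul (f h : nat -> R) : f @ \oo --> (1 : R) -> h @ \oo --> (1 : R) ->
  (fun n => f n * h n) @ \oo --> (1 : R).
Proof. by move=> hf hh; rewrite -[X in _ --> X]mulr1; exact: cvgM. Qed.

Lemma cvg1_div (f h : nat -> R) : f @ \oo --> (1 : R) -> h @ \oo --> (1 : R) ->
  (fun n => f n / h n) @ \oo --> (1 : R).
Proof.
move=> hf hh; apply: cvg1_mul => //.
by rewrite -[X in _ --> X]invr1; apply: cvgV => //; exact: oner_neq0.
Qed.

Lemma rt_gt0_oo (t : R) : 0 < Num.sqrt (1 - t ^+ 2) -> t \in `]-1, 1[.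
Proof.
rewrite sqrtr_gt0 subr_gt0 in_itv/= => h1.
by apply/andP; split; nra.
Qed.

End Arithmetic.

(** * Limits of the kernel along sequences *)

Section Limits.
Variables (R : realType) (L : {scalar {poly R}}) (p : nat -> {poly R}).
Hypothesis size_p : forall n, size (p n) = n.+1.
Hypothesis orth_p : forall n m, L (p n * p m) = (n == m)%:R.
Variables (g : R -> R) (a b s0 : R).
Local Notation K := (repro_kernel p).
Local Notation Kw := (repro_kernel (@chebU_on R)).
Local Notation rt t := (Num.sqrt (1 - t ^+ 2)).
Hypothesis s0_gt0 : 0 < s0.
Hypothesis rt_bound : forall x, x \in `[a, b] -> s0 <= rt x.
Hypothesis g_gt0 : forall x, x \in `[a, b] -> 0 < g x.
Hypothesis upper : forall e, 0 < e <= 4^-1 -> exists2 d, 0 < d & \forall n \near \oo,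
  forall x y, x \in `[a, b] -> `|y - x| < d ->
  (1 - e) * (pi * (1 - y ^+ 2) * g x * K n y y) <= (1 + e) * (1 + 2 * e) * n%:R.
Hypothesis test : forall e, 0 < e <= 4^-1 -> exists d h, [/\ 0 < d, (2 < h)%N,
  (forall n, 2 * (n %/ h)%:R <= e * n%:R :> R) & \forall n \near \oo,
  (0 < test_size h n)%N /\
  forall x y, x \in `[a, b] -> `|y - x| < d ->
  let S := test_poly (test_size h n) (n %/ h) y in
  (1 - 2 * e) * n%:R * L (S * S) <= (1 + 2 * e) * (pi * (1 - y ^+ 2) * g x)].

(** Normalized to tend to 1: the expected size of K_n(y,y) is n / (pi w(y) sqrt(1 - y^2)), with w(y)
    written as g times the semicircle and g frozen at x. *)
Definition scaled_kernel n x y : R := pi * (1 - y ^+ 2) * g x * K n y y / n%:R.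

Lemma scaled_kernel_limit e : 0 < e -> exists2 d, 0 < d & \forall n \near \oo,
  forall x y, x \in `[a, b] -> `|y - x| < d -> `|scaled_kernel n x y - 1| <= e.
Proof.
(* The 8 is the loss in [diag_arith]. *)
move=> e0; pose e' := Num.min (e / 8) 4^-1.
have e'0 : 0 < e' <= 4^-1.
  by rewrite lt_min divr_gt0//= invr_gt0 ltr0n/= ge_min lexx orbT.
have e'e : 8 * e' <= e.
  by rewrite mulrC -ler_pdivlMr// ge_min lexx.
have [d1 d10 H1] := upper e'0; have [d2 [h [d20 h2 Hh H2]]] := test e'0.
exists (Num.min d1 d2); first by rewrite lt_min d10.
near=> n => x y xab; rewrite lt_min => /andP[yd1 yd2].
have n0 : 0 < n%:R :> R by near: n; exact: nbhs_infty_gtr.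
have nn0 : n%:R != 0 :> R by rewrite gt_eqF.
have U : forall x y, x \in `[a, b] -> `|y - x| < d1 ->
  (1 - e') * (pi * (1 - y ^+ 2) * g x * K n y y) <= (1 + e') * (1 + 2 * e') * n%:R.
  by near: n.
have T : (0 < test_size h n)%N /\
  forall x y, x \in `[a, b] -> `|y - x| < d2 ->
  let S := test_poly (test_size h n) (n %/ h) y in
  (1 - 2 * e') * n%:R * L (S * S) <= (1 + 2 * e') * (pi * (1 - y ^+ 2) * g x).
  by near: n.
have {}U := U x y xab yd1.
case: T => N0 /(_ x y xab yd2) /=; set S := test_poly _ _ _ => T.
have K0 : 0 <= K n y y by exact: repro_kernel_ge0.
(* S is admissible in the extremal problem, having size at most n and value 1 at y. *)
have KS : 1 <= K n y y * L (S * S).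
  have sS : (size S <= n)%N by rewrite -[n](test_sizeK _ h2) size_test_poly.
  have := christoffel_ineq size_p orth_p y sS.
  by rewrite test_poly_center// expr1n.
apply: le_trans e'e; apply: diag_arith => //; rewrite /scaled_kernel.
  by rewrite mulrA ler_pdivrMr.
rewrite mulrA ler_pdivlMr//.
have e2 : 0 <= 1 - 2 * e' by case/andP: e'0 => *; lra.
apply: (@le_trans _ _ (K n y y * ((1 - 2 * e') * n%:R * L (S * S)))).
  have -> : K n y y * ((1 - 2 * e') * n%:R * L (S * S)) =
    (1 - 2 * e') * n%:R * (K n y y * L (S * S)) by ring.
  by rewrite ler_peMr// mulr_ge0// ltW.
apply: (le_trans (ler_wpM2l K0 T)).
by rewrite le_eqVlt; apply/orP; left; apply/eqP; ring.
Unshelve. all: by end_near. Qed.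

Section Sequences.
Variables (x : nat -> R).
Hypothesis xab : forall n, x n \in `[a, b].

Definition tracks (y : nat -> R) := (fun n => y n - x n) @ \oo --> (0 : R).

Lemma tracks_self : tracks x.
Proof.
rewrite /tracks (_ : (fun n => x n - x n) = fun=> 0); first exact: cvg_cst.
by apply/funext => n; rewrite subrr.
Qed.

Lemma tracks_near y d : tracks y -> 0 < d -> \forall n \near \oo, `|y n - x n| < d.
Proof.
move=> yx d0; move/cvgrPdist_lt : yx => /(_ d d0).
by apply: filterS => n; rewrite sub0r normrN.
Qed.

Lemma scaled_kernel_cvg y : tracks y ->
  (fun n => scaled_kernel n (x n) (y n)) @ \oo --> (1 : R).
Proof.
move=> yx; apply/cvgrPdist_le => e e0.
have [d d0 H] := scaled_kernel_limit e0; have near1 := tracks_near yx d0.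
near=> n; rewrite distrC; have Hn : forall x y, x \in `[a, b] -> `|y - x| < d ->
  `|scaled_kernel n x y - 1| <= e by near: n.
by apply: Hn => //; near: n.
Unshelve. all: by end_near. Qed.

Lemma one_minus_sqr_ge n : s0 ^+ 2 <= 1 - x n ^+ 2.
Proof.
have h := rt_bound (xab n).
have rt0 : 0 < rt (x n) by apply: lt_le_trans h.
have p0 : 0 <= 1 - x n ^+ 2 by rewrite ltW// -sqrtr_gt0.
by rewrite -[leRHS]sqr_sqrtr// lerXn2r ?nnegrE// ltW.
Qed.

Lemma sqr_ratio_cvg y : tracks y ->
  (fun n => (1 - y n ^+ 2) / (1 - x n ^+ 2)) @ \oo --> (1 : R).
Proof.
move=> yx; have s2 : 0 < s0 ^+ 2 by rewrite exprn_gt0.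
have P n : 0 < 1 - x n ^+ 2 by apply: lt_le_trans (one_minus_sqr_ge n).
apply/cvgrPdist_le => e e0.
have near1 := tracks_near yx (@ltr01 R).
have near2 := tracks_near yx (divr_gt0 (mulr_gt0 e0 s2) (ltr0n R 3)).
near=> n.
have yx1 : `|y n - x n| < 1 by near: n.
have yx2 : `|y n - x n| < e * s0 ^+ 2 / 3 by near: n.
have -> : 1 - (1 - y n ^+ 2) / (1 - x n ^+ 2) =
  ((y n - x n) * (y n - x n + 2 * x n)) / (1 - x n ^+ 2).
  by field; rewrite gt_eqF.
rewrite normrM normfV (ger0_norm (ltW (P n))) ler_pdivrMr//.
have x1 : `|x n| <= 1.
  by rewrite ler_norml; have := P n; rewrite subr_gt0 => h; apply/andP; split; nra.
apply: (@le_trans _ _ (`|y n - x n| * 3)).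
  rewrite normrM ler_wpM2l// (le_trans (ler_normD _ _))// normrM ger0_norm//; lra.
apply: (@le_trans _ _ (e * s0 ^+ 2)); last by rewrite ler_wpM2l ?(ltW e0)// one_minus_sqr_ge.
by rewrite -ler_pdivlMr// ltW.
Unshelve. all: by end_near. Qed.

Lemma rt_ratio_cvg y : tracks y -> (fun n => rt (y n) / rt (x n)) @ \oo --> (1 : R).
Proof.
move=> /sqr_ratio_cvg H.
have -> : (fun n => rt (y n) / rt (x n)) = Num.sqrt \o (fun n => (1 - y n ^+ 2) / (1 - x n ^+ 2)).
  apply/funext => n /=; rewrite mulrC [in RHS]mulrC sqrtrM ?sqrtrV ?invr_ge0//.
    by rewrite (le_trans _ (one_minus_sqr_ge n))// sqr_ge0.
  by rewrite (le_trans _ (one_minus_sqr_ge n))// sqr_ge0.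
have := cvg_comp _ _ H (@sqrt_continuous R 1).
by rewrite sqrtr1.
Qed.

Lemma rt_tracks_ge y : tracks y -> \forall n \near \oo, s0 / 2 <= rt (y n).
Proof.
move=> /rt_ratio_cvg /cvgrPdist_le /(_ 2^-1); rewrite invr_gt0 ltr0n => /(_ isT).
apply: filterS => n; have h := rt_bound (xab n).
have r0 : 0 < rt (x n) by apply: lt_le_trans h.
rewrite ler_norml => /andP[_]; rewrite lerBlDr -lerBlDl => h1.
have h2 : 2^-1 <= rt (y n) / rt (x n) by lra.
rewrite ler_pdivlMr// in h2; apply: le_trans h2; rewrite mulrC; lra.
Qed.

Lemma natV_cvg : (fun n : nat => n%:R^-1) @ \oo --> (0 : R).
Proof.
apply/cvgrPdist_le => e e0; near=> n.
have n0 : 0 < n%:R :> R by near: n; exact: nbhs_infty_gtr.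
rewrite sub0r normrN ger0_norm ?invr_ge0// -[e]invrK lef_pV2 ?posrE ?invr_gt0//.
by near: n; exact: nbhs_infty_ger.
Unshelve. all: by end_near. Qed.

Section TestValue.
Variables (y z : nat -> R) (s e : R) (h : nat).
Hypotheses (yx : tracks y) (zx : tracks z).
Hypothesis s_lim : (fun n => n%:R * (acos (y n) - acos (z n))) @ \oo --> s.
Hypothesis e_itv : 0 < e <= 4^-1.
Hypothesis h_gt2 : (2 < h)%N.
Hypothesis h_mesh : forall n, 2 * (n %/ h)%:R <= e * n%:R :> R.
Local Notation al n := (acos (y n) - acos (z n)).
Local Notation N n := (test_size h n).

Let e_gt0 : 0 < e. Proof. by case/andP: e_itv. Qed.

Lemma test_sizeR n : (N n)%:R = n%:R - 2 * (n %/ h)%:R :> R.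
Proof.
have /(congr1 (fun k => k%:R : R)) := test_sizeK n h_gt2.
by rewrite natrD natrM => <-; rewrite addrK.
Qed.

Lemma test_size_ge n : n%:R / 2 <= (N n)%:R :> R.
Proof.
rewrite test_sizeR; have := h_mesh n; have n0 : 0 <= n%:R :> R by [].
have /andP[_ e4] := e_itv; have : e * n%:R <= 4^-1 * n%:R by rewrite ler_wpM2r.
lra.
Qed.

Lemma angle_cvg : (fun n => al n) @ \oo --> (0 : R).
Proof.
have H : (fun n => n%:R * al n * n%:R^-1) @ \oo --> s * 0.
  by apply: cvgM => //; exact: natV_cvg.
rewrite mulr0 in H; apply: cvg_trans H; apply: near_eq_cvg; near=> n.
have n0 : n%:R != 0 :> R by rewrite gt_eqF//; near: n; exact: nbhs_infty_gtr.
by rewrite mulrAC mulfV// mul1r.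
Unshelve. all: by end_near. Qed.

Lemma chebU_diag_cvg :
  (fun n => pi * (1 - y n ^+ 2) * Kw (N n) (y n) (y n) / (N n)%:R) @ \oo --> (1 : R).
Proof.
apply/cvgrPdist_le => eps eps0; near=> n.
have n0 : 0 < n%:R :> R by near: n; exact: nbhs_infty_gtr.
have ry : s0 / 2 <= rt (y n) by near: n; exact: rt_tracks_ge.
have nb : 4 / s0 / eps <= n%:R by near: n; exact: nbhs_infty_ger.
have Nn := test_size_ge n; have N0 : 0 < (N n)%:R :> R by apply: lt_le_trans Nn; rewrite divr_gt0.
have ry0 : 0 < rt (y n) by apply: lt_le_trans ry; rewrite divr_gt0.
have := chebU_kernel_diag (N n) (rt_gt0_oo ry0).
set X := pi * _ * _ => diag.
have -> : 1 - X / (N n)%:R = - (X - (N n)%:R) / (N n)%:R by field; rewrite gt_eqF.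
rewrite normrM normrN normfV (ger0_norm (ltW N0)) ler_pdivrMr//.
apply: (le_trans diag); apply: (@le_trans _ _ (2 / s0)).
  by rewrite -[2 / s0]invf_div lef_pV2 ?posrE ?divr_gt0.
apply: (@le_trans _ _ (eps * (n%:R / 2))); last by rewrite ler_wpM2l ?(ltW eps0).
by move: nb; rewrite ler_pdivrMr//; lra.
Unshelve. all: by end_near. Qed.

(** Three errors: the cosine sum at the sum of the angles, of order 1/n after division (e); the
    Riemann sum (e); and the passage from n to N, which changes n al by a proportion of at most e (e
    + e (|s| + 1)). *)
Lemma chebU_offdiag_eventually : \forall n \near \oo,
  `|pi * (rt (y n) * rt (z n)) * Kw (N n) (y n) (z n) / (N n)%:R - sinc s| <= e * (`|s| + 4).
Proof.
near=> n.
have n0 : 0 < n%:R :> R by near: n; exact: nbhs_infty_gtr.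
have ry : s0 / 2 <= rt (y n) by near: n; exact: rt_tracks_ge.
have rz : s0 / 2 <= rt (z n) by near: n; exact: rt_tracks_ge.
have nb : 4 / s0 / e <= n%:R by near: n; exact: nbhs_infty_ger.
have Nn := test_size_ge n; have N0 : 0 < (N n)%:R :> R by apply: lt_le_trans Nn; rewrite divr_gt0.
have ry0 : 0 < rt (y n) by apply: lt_le_trans ry; rewrite divr_gt0.
have rz0 : 0 < rt (z n) by apply: lt_le_trans rz; rewrite divr_gt0.
have al1 : `|al n| <= e.
  rewrite -normrN -sub0r; near: n; move/cvgrPdist_le : angle_cvg; exact.
have al2 : `|s - n%:R * al n| <= e by near: n; move/cvgrPdist_le : s_lim; exact.
have off := chebU_kernel_offdiag (N n) (rt_gt0_oo ry0) (rt_gt0_oo rz0).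
set X := pi * _ * _ in off *; set u := al n in off al1 al2 *.
have N1 : (0 < N n)%N by rewrite -(ltr0n R).
have avg := cosum_sinc u N1.
have lip := sinc_lipschitz ((N n)%:R * u) s.
have NE := test_sizeR n; have Nh := h_mesh n.
have k0 : 0 <= (n %/ h)%:R :> R by [].
set M := (N n)%:R in Nn N0 off avg lip NE *.
set k := (n %/ h)%:R in NE Nh k0.
set nn := n%:R in n0 nb Nn al2 NE Nh *.
have [e0 e4] : 0 < e /\ e <= 4^-1 by case/andP: e_itv.
have d1 : `|X / M - cosum (N n) u / M| <= e.
  rewrite -mulrBl normrM normfV (ger0_norm (ltW N0)) ler_pdivrMr//.
  apply: (le_trans off); apply: (@le_trans _ _ (2 / s0)).
    rewrite ler_wpM2l// lef_pV2 ?posrE ?addr_gt0//.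
    by rewrite [s0]splitr lerD.
  apply: (@le_trans _ _ (e * (nn / 2))); last by rewrite ler_wpM2l ?(ltW e0).
  by move: nb; rewrite ler_pdivrMr//; lra.
have nu : `|nn * u| <= `|s| + 1.
  have -> : nn * u = s - (s - nn * u) by ring.
  by rewrite (le_trans (ler_normB _ _))// lerD2l (le_trans al2)//; lra.
have d3 : `|M * u - s| <= e + e * (`|s| + 1).
  have -> : M * u - s = - (s - nn * u) - 2 * k * u by rewrite NE; ring.
  rewrite (le_trans (ler_normB _ _))// normrN lerD//.
  rewrite normrM ger0_norm ?mulr_ge0//.
  apply: (@le_trans _ _ (e * nn * `|u|)); first by rewrite ler_wpM2r.
  by rewrite -mulrA ler_wpM2l ?(ltW e0)// -[nn](ger0_norm (ltW n0)) -normrM.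
have -> : X / M - sinc s = (X / M - cosum (N n) u / M)
   + (cosum (N n) u / M - sinc (M * u)) + (sinc (M * u) - sinc s) by ring.
rewrite (le_trans (ler_normD _ _))// (le_trans (lerD (ler_normD _ _) (lexx _)))//.
move: d1 avg lip d3 al1; set A := `|X / M - _|; set B := `|_ / M - _|.
set D := `|M * u - s|; set E := `|sinc _ - _|; set F := `|u|; move: A B D E F => A B D E F.
by move: `|s| => S; lra.
Unshelve. all: by end_near. Qed.

(** By Bernoulli's inequality the deviation from 1 is at most n (z - y)^2 <= (n al) al, which tends
    to s times 0: the bump is flat at the scale 1/n. *)
Lemma bump_cvg : (fun n => (bump (n %/ h) (y n)).[z n]) @ \oo --> (1 : R).
Proof.
have H : (fun n => n%:R * al n * al n) @ \oo --> s * 0.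
  by apply: cvgM => //; exact: angle_cvg.
rewrite mulr0 in H; apply/cvgrPdist_le => eps eps0; near=> n.
have n1 : `|n%:R * al n * al n| <= eps.
  rewrite -normrN -sub0r; near: n; move/cvgrPdist_le : H; exact.
have ry : s0 / 2 <= rt (y n) by near: n; exact: rt_tracks_ge.
have rz : s0 / 2 <= rt (z n) by near: n; exact: rt_tracks_ge.
have ry0 : 0 < rt (y n) by apply: lt_le_trans ry; rewrite divr_gt0.
have rz0 : 0 < rt (z n) by apply: lt_le_trans rz; rewrite divr_gt0.
have yI := rt_gt0_oo ry0; have zI := rt_gt0_oo rz0.
have /andP[b0 b1] := bump_itv (n %/ h) (subset_itv_oo_cc yI) (subset_itv_oo_cc zI).
rewrite ger0_norm ?subr_ge0// lerBlDl -lerBlDr; apply: le_trans (_ : _ <= 1 - n%:R * al n ^+ 2) _.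
  rewrite lerB//; apply: le_trans n1; rewrite -mulrA -expr2.
  by rewrite ler_norm.
rewrite horner_bump.
have zy : (z n - y n) ^+ 2 <= al n ^+ 2.
  have := cos_lipschitz (acos (z n)) (acos (y n)).
  have [-> _] := oo_acosK yI; have [-> _] := oo_acosK zI => hl.
  rewrite -[leLHS]real_normK ?num_real// -[leRHS]real_normK ?num_real//.
  by rewrite lerXn2r ?nnegrE// distrC.
have u01 : 0 <= (z n - y n) ^+ 2 / 4 <= 1.
  rewrite divr_ge0 ?sqr_ge0//=; move: yI zI; rewrite !in_itv/= => /andP[y1 y2] /andP[z1 z2].
  by have h0 : 0 <= (2 - (z n - y n)) * (2 + (z n - y n)); [rewrite mulr_ge0//; lra|lra].
apply: le_trans (bernoulli_le (n %/ h) u01).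
rewrite lerB// ler_pM ?divr_ge0 ?sqr_ge0//; first by rewrite ler_nat leq_div.
by apply: le_trans zy; rewrite ler_piMr ?sqr_ge0// invf_le1// ler1n.
Unshelve. all: by end_near. Qed.

Lemma test_value_eventually : \forall n \near \oo,
  `|(test_poly (N n) (n %/ h) (y n)).[z n] - sinc s| <= 3 * (`|s| + 5) * e.
Proof.
pose D n := pi * (1 - y n ^+ 2) * Kw (N n) (y n) (y n) / (N n)%:R.
(* r turns the symmetric normalization of the off-diagonal limit into that of [test_poly]; the
   square roots are compared through the one at x_n so that each ratio tends to 1. *)
pose r n := (rt (y n) / rt (x n)) / (rt (z n) / rt (x n)) / D n * (bump (n %/ h) (y n)).[z n].
have r_cvg : r @ \oo --> (1 : R).
  apply: cvg1_mul; last exact: bump_cvg.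
  apply: cvg1_div; last exact: chebU_diag_cvg.
  by apply: cvg1_div; exact: rt_ratio_cvg.
near=> n.
have r1 : `|r n - 1| <= e.
  rewrite distrC; near: n; move/cvgrPdist_le : r_cvg; exact.
have off : `|pi * (rt (y n) * rt (z n)) * Kw (N n) (y n) (z n) / (N n)%:R - sinc s| <= e * (`|s| + 4).
  by near: n; exact: chebU_offdiag_eventually.
have n0 : 0 < n%:R :> R by near: n; exact: nbhs_infty_gtr.
have N0 : 0 < (N n)%:R :> R by apply: lt_le_trans (test_size_ge n); rewrite divr_gt0.
have ry : s0 / 2 <= rt (y n) by near: n; exact: rt_tracks_ge.
have rz : s0 / 2 <= rt (z n) by near: n; exact: rt_tracks_ge.
have ry0 : 0 < rt (y n) by apply: lt_le_trans ry; rewrite divr_gt0.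
have rz0 : 0 < rt (z n) by apply: lt_le_trans rz; rewrite divr_gt0.
have rx0 : 0 < rt (x n) by apply: lt_le_trans (rt_bound (xab n)).
have Q0 : 0 < Kw (N n) (y n) (y n).
  by apply: repro_kernel_gt0; [exact: size_chebU_on|rewrite -(ltr0n R)].
have -> : (test_poly (N n) (n %/ h) (y n)).[z n] =
   pi * (rt (y n) * rt (z n)) * Kw (N n) (y n) (z n) / (N n)%:R * r n.
  rewrite horner_test_poly /r /D.
  have yE : rt (y n) ^+ 2 = 1 - y n ^+ 2 by rewrite sqr_sqrtr// ltW// -sqrtr_gt0.
  move: (rt (y n)) (rt (z n)) (rt (x n)) ry0 rz0 rx0 yE => Y Z X Y0 Z0 X0 <-.
  move: (Kw _ _ _) (Kw _ _ _) Q0 (N n)%:R N0 => k1 k2 k20 M M0.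
  move: pi (pi_gt0 R) => P P0; field.
  by rewrite !gt_eqF.
apply: product_close => //.
- by case/andP: e_itv => /ltW -> ->.
- have := sinc_lipschitz s 0; rewrite subr0 {2}/sinc eqxx => h1.
  have -> : sinc s = (sinc s - 1) + 1 by ring.
  by rewrite (le_trans (ler_normD _ _))// normr1 addrC lerD2l.
Unshelve. all: by end_near. Qed.

End TestValue.

Lemma kernel_ratio_limit y z s : tracks y -> tracks z ->
  (fun n => n%:R * (acos (y n) - acos (z n))) @ \oo --> s ->
  (fun n => K n (y n) (z n) / K n (y n) (y n)) @ \oo --> sinc s.
Proof.
move=> yx zx s_lim; apply/cvgrPdist_le => eps eps0.
(* 3 (|s| + 5) comes from the value of S at z and 4 from the extremal approximation. The latter
   bounds a square by 10 e, so e is taken as eta^2 and 10 <= 4^2 is used. *)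
pose c := 3 * (`|s| + 5) + 4.
have c0 : 0 < c by rewrite addr_gt0// mulr_gt0// ltr_wpDl.
pose eta := Num.min (eps / c) 4^-1.
have eta0 : 0 < eta by rewrite lt_min divr_gt0//= invr_gt0.
have eta4 : eta <= 4^-1 by rewrite ge_min lexx orbT.
have eta_eps : c * eta <= eps by rewrite mulrC -ler_pdivlMr// ge_min lexx.
pose e := eta ^+ 2.
have e16 : e <= 16^-1 by rewrite /e; nra.
have e4 : 0 < e <= 4^-1 by rewrite exprn_gt0//=; lra.
have e_eta : e <= eta by rewrite /e; nra.
have [e0 _] := andP e4.
have [d [h [d0 h2 Hh Htest]]] := test e4.
(* The bound on L(S^2) involves 1 - y^2, whereas [scaled_kernel] at z involves 1 - z^2; the ratios
   through x_n exchange the two. *)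
have cz : (fun n => scaled_kernel n (x n) (z n) * ((1 - y n ^+ 2) / (1 - x n ^+ 2))
     / ((1 - z n ^+ 2) / (1 - x n ^+ 2))) @ \oo --> (1 : R).
  apply: cvg1_div; last exact: sqr_ratio_cvg.
  by apply: cvg1_mul; [exact: scaled_kernel_cvg|exact: sqr_ratio_cvg].
have cy : (fun n => scaled_kernel n (x n) (z n) * ((1 - y n ^+ 2) / (1 - x n ^+ 2))
     / ((1 - z n ^+ 2) / (1 - x n ^+ 2)) / scaled_kernel n (x n) (y n)) @ \oo --> (1 : R).
  by apply: cvg1_div => //; exact: scaled_kernel_cvg.
near=> n.
have n0 : 0 < n%:R :> R by near: n; exact: nbhs_infty_gtr.
have n1 : (0 < n)%N by rewrite -(ltr0n R).
have ry : s0 / 2 <= rt (y n) by near: n; exact: rt_tracks_ge.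
have rz : s0 / 2 <= rt (z n) by near: n; exact: rt_tracks_ge.
have ry0 : 0 < rt (y n) by apply: lt_le_trans ry; rewrite divr_gt0.
have rz0 : 0 < rt (z n) by apply: lt_le_trans rz; rewrite divr_gt0.
have rx0 : 0 < rt (x n) by apply: lt_le_trans (rt_bound (xab n)).
move: ry0 rz0 rx0; rewrite !sqrtr_gt0 => py pz px.
have Kz : 0 < K n (z n) (z n) by exact: repro_kernel_gt0.
have Ky : 0 < K n (y n) (y n) by exact: repro_kernel_gt0.
have gx := g_gt0 (xab n).
pose B := pi * (1 - y n ^+ 2) * g (x n) * K n (z n) (z n) / n%:R.
have BE : scaled_kernel n (x n) (z n) * ((1 - y n ^+ 2) / (1 - x n ^+ 2))
     / ((1 - z n ^+ 2) / (1 - x n ^+ 2)) = B.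
  rewrite /scaled_kernel /B; move: pi => P; field.
  by rewrite !gt_eqF.
have B1 : B <= 1 + e.
  have : `|1 - B| <= e by rewrite -BE; near: n; move/cvgrPdist_le : cz; exact.
  by rewrite ler_norml => /andP[]; lra.
pose C := K n (z n) (z n) / K n (y n) (y n).
have C1 : `|C - 1| <= e.
  have <- : B / scaled_kernel n (x n) (y n) = C.
    rewrite /scaled_kernel /B /C; move: (pi_gt0 R); move: pi => P P0; field.
    by rewrite !gt_eqF.
  by rewrite distrC -BE; near: n; move/cvgrPdist_le : cy; exact.
have T : (0 < test_size h n)%N /\
  forall x y, x \in `[a, b] -> `|y - x| < d ->
  let S := test_poly (test_size h n) (n %/ h) y in
  (1 - 2 * e) * n%:R * L (S * S) <= (1 + 2 * e) * (pi * (1 - y ^+ 2) * g x).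
  by near: n.
have yd : `|y n - x n| < d by near: n; exact: tracks_near.
have Sval : `|(test_poly (test_size h n) (n %/ h) (y n)).[z n] - sinc s| <= 3 * (`|s| + 5) * e.
  by near: n; exact: test_value_eventually.
case: T => N0 /(_ (x n) (y n) (xab n) yd) /=; set S := test_poly _ _ _ => T.
have sS : (size S <= n)%N by rewrite -[n](test_sizeK _ h2) size_test_poly.
have Sy : S.[y n] = 1 by rewrite test_poly_center.
have approx := near_extremal_approx size_p orth_p (z n) n1 sS Sy.
have E10 : K n (z n) (z n) * (L (S * S) - (K n (y n) (y n))^-1) <= 10 * e.
  rewrite mulrBr; apply: (excess_arith e4 e16 _ B1 C1).
  apply: (@le_trans _ _ (K n (z n) (z n) / n%:R * ((1 - 2 * e) * n%:R * L (S * S)))).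
    by rewrite le_eqVlt; apply/orP; left; apply/eqP; field; rewrite gt_eqF.
  apply: (le_trans (ler_wpM2l _ T)); first by rewrite divr_ge0// ltW.
  by rewrite le_eqVlt; apply/orP; left; apply/eqP; rewrite /B; move: pi => P; field; rewrite gt_eqF.
set rho := K n (y n) (z n) / K n (y n) (y n) in approx *.
have A4 : `|S.[z n] - rho| <= 4 * eta.
  rewrite -ler_sqr ?nnegrE ?mulr_ge0 ?(ltW eta0)// real_normK ?num_real//.
  apply: (le_trans approx); apply: (le_trans E10); rewrite /e exprMn.
  by rewrite ler_wpM2r ?sqr_ge0// -natrX ler_nat.
have -> : sinc s - rho = (S.[z n] - rho) - (S.[z n] - sinc s) by ring.
rewrite (le_trans (ler_normB _ _))//; apply: le_trans eta_eps.
rewrite /c mulrDl addrC lerD//; apply: (le_trans Sval).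
by rewrite ler_wpM2l// mulr_ge0// addr_ge0.
Unshelve. all: by end_near. Qed.

End Sequences.
End Limits.

(** * Angles, sinc and limits of determinants *)

Section Elementary.
Variable R : realType.

Lemma sincN (t : R) : sinc (- t) = sinc t.
Proof. by rewrite /sinc oppr_eq0 sinN invrN mulrNN. Qed.

Lemma sinc_piE (t : R) : sinc (pi * t) = sinc_pi t.
Proof. by rewrite /sinc /sinc_pi mulf_eq0 gt_eqF ?pi_gt0. Qed.

Lemma acos_mvt (u v : R) : u \in `]-1, 1[ -> v \in `]-1, 1[ ->
  exists2 c, (c - u) * (c - v) <= 0 & acos v - acos u = - (Num.sqrt (1 - c ^+ 2))^-1 * (v - u).
Proof.
rewrite !in_itv/= => /andP[u1 u2] /andP[v1 v2].
apply: (@mvt_between R acos (fun c => - (Num.sqrt (1 - c ^+ 2))^-1)) => c hc.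
by apply: is_derive1_acos; apply/andP; split; nra.
Qed.

Lemma cvg_bigR (I : Type) (op : R -> R -> R) (x0 : R) (r : seq I) (A : I -> nat -> R) (B : I -> R) :
  continuous (fun x : R * R => op x.1 x.2) ->
  (forall i, A i @ \oo --> B i) ->
  (fun n => \big[op/x0]_(i <- r) A i n) @ \oo --> \big[op/x0]_(i <- r) B i.
Proof. by move=> op_cont AB; apply: cvg_big. Qed.

Lemma cvg_det m (A : nat -> 'M[R]_m) (B : 'M[R]_m) :
  (forall i j, (fun n => A n i j) @ \oo --> B i j) -> (fun n => \det (A n)) @ \oo --> \det B.
Proof.
move=> AB; rewrite /determinant; apply: cvg_bigR => [|s]; first exact: add_continuous.
apply: cvgM; first exact: cvg_cst.
by apply: cvg_bigR => [|i]; [exact: mul_continuous|exact: AB].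
Qed.

Lemma near_cvg_eq (f h : nat -> R) (l : R) : (\forall n \near \oo, f n = h n) ->
  h @ \oo --> l -> f @ \oo --> l.
Proof.
move=> fh; apply: cvg_trans; apply: near_eq_cvg.
by apply: filterS fh => n ->.
Qed.

End Elementary.

(** * Scaling limit of the correlation determinant along a sequence *)

Section Correlation.
Variables (R : realType) (p : nat -> {poly R}) (g w : R -> R) (a b s0 : R) (x : nat -> R).
Local Notation K := (repro_kernel p).
Local Notation rt t := (Num.sqrt (1 - t ^+ 2)).
Hypothesis size_p : forall n, size (p n) = n.+1.
Hypothesis s0_gt0 : 0 < s0.
Hypothesis rt_bound : forall x, x \in `[a, b] -> s0 <= rt x.
Hypothesis g_gt0 : forall x, x \in `[a, b] -> 0 < g x.
Hypothesis w_eq : forall t, 0 < rt t -> w t = g t * rt t.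
Hypothesis g_close : forall e, 0 < e < 1 -> exists2 d, 0 < d &
  forall x y, x \in `[a, b] -> `|y - x| < d -> `|g y - g x| <= e * g x.
Hypothesis xab : forall n, x n \in `[a, b].
Hypothesis diag : forall y, tracks x y ->
  (fun n => scaled_kernel p g n (x n) (y n)) @ \oo --> (1 : R).
Hypothesis offdiag : forall y z s, tracks x y -> tracks x z ->
  (fun n => n%:R * (acos (y n) - acos (z n))) @ \oo --> s ->
  (fun n => K n (y n) (z n) / K n (y n) (y n)) @ \oo --> sinc s.
Local Notation kap n := (norm_kernel p w n (x n) (x n)).

Let rx_gt0 n : 0 < rt (x n).
Proof. exact: lt_le_trans (rt_bound (xab n)). Qed.

Let px_gt0 n : 0 < 1 - x n ^+ 2.
Proof. by rewrite -sqrtr_gt0. Qed.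

Let wx_gt0 n : 0 < w (x n).
Proof. by rewrite w_eq// mulr_gt0// g_gt0. Qed.

Let kap_eq n : kap n = w (x n) * K n (x n) (x n).
Proof. by rewrite /norm_kernel -expr2 sqr_sqrtr// ltW. Qed.

(** Mean value theorem for acos: the intermediate points also track x_n, so their semicircle values
    may be replaced by those at x_n. The sign reflects that acos decreases. *)
Lemma angle_limit y z t : tracks x y -> tracks x z ->
  (fun n => n%:R * (y n - z n) / rt (x n)) @ \oo --> t ->
  (fun n => n%:R * (acos (y n) - acos (z n))) @ \oo --> - t.
Proof.
move=> yx zx yz.
(* When y_n or z_n is outside ]-1,1[, which happens for finitely many n only, the default c = y_n
   still satisfies the betweenness condition. *)
have /choice[c Hc] : forall n, exists c, (c - z n) * (c - y n) <= 0 /\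
    (z n \in `]-1, 1[ -> y n \in `]-1, 1[ ->
     acos (y n) - acos (z n) = - (rt c)^-1 * (y n - z n)).
  move=> n; case: (boolP (z n \in `]-1, 1[)) => [zn|_]; last first.
    by exists (y n); rewrite subrr mulr0.
  case: (boolP (y n \in `]-1, 1[)) => [yn|_]; last first.
    by exists (y n); rewrite subrr mulr0.
  by have [c h1 h2] := acos_mvt zn yn; exists c.
have cx : tracks x c.
  have yz0 : (fun n => `|y n - z n| + `|y n - x n|) @ \oo --> (0 : R).
    rewrite -[X in _ --> X]addr0 -{1}(@normr0 _ R) -{2}(@normr0 _ R).
    apply: cvgD; apply: cvg_norm => //.
    rewrite -[X in _ --> X](subrr (0 : R)).
    rewrite (_ : (fun n => y n - z n) = fun n => (y n - x n) - (z n - x n)).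
      exact: cvgB.
    by apply/funext => n; ring.
  apply/cvgrPdist_lt => e e0; move/cvgrPdist_lt : yz0 => /(_ e e0).
  apply: filterS => n; rewrite !sub0r !normrN ger0_norm ?addr_ge0//; apply: le_lt_trans.
  have -> : c n - x n = (c n - y n) + (y n - x n) by ring.
  rewrite (le_trans (ler_normD _ _))// lerD2r.
  by apply: between_dist; case: (Hc n).
have rc := rt_ratio_cvg s0_gt0 rt_bound xab cx.
have lim : (fun n => - (n%:R * (y n - z n) / rt (x n) / (rt (c n) / rt (x n)))) @ \oo --> - t.
  rewrite -[t]divr1; apply: cvgN; apply: cvgM; first exact: yz.
  by apply: cvgV => //; exact: oner_neq0.
apply: near_cvg_eq lim.
have near1 := rt_tracks_ge s0_gt0 rt_bound xab yx.
have near2 := rt_tracks_ge s0_gt0 rt_bound xab zx.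
have near3 := rt_tracks_ge s0_gt0 rt_bound xab cx.
have s2 : 0 < s0 / 2 by rewrite divr_gt0.
near=> n.
have ry : 0 < rt (y n) by apply: (lt_le_trans s2); near: n.
have rz : 0 < rt (z n) by apply: (lt_le_trans s2); near: n.
have rcn : 0 < rt (c n) by apply: (lt_le_trans s2); near: n.
have [_ ->] := Hc n; [|exact: rt_gt0_oo|exact: rt_gt0_oo].
by field; rewrite !gt_eqF.
Unshelve. all: by end_near. Qed.

(** This is where pi enters the sine kernel: a spacing 1/kap near x_n corresponds to an angle of
    about pi / n. *)
Lemma normalizer_cvg : (fun n => n%:R / (kap n * rt (x n))) @ \oo --> (pi : R).
Proof.
have h : (fun n => pi / scaled_kernel p g n (x n) (x n)) @ \oo --> (pi : R).
  rewrite -[X in _ --> X]divr1; apply: cvgM; first exact: cvg_cst.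
  by apply: cvgV; [exact: oner_neq0|exact/diag/tracks_self].
apply: near_cvg_eq h; near=> n.
have n0 : (0 < n)%N by near: n; exact: nbhs_infty_gt.
have Kx : 0 < K n (x n) (x n) by exact: repro_kernel_gt0.
have r2 : 1 - x n ^+ 2 = rt (x n) ^+ 2 by rewrite sqr_sqrtr// ltW.
rewrite kap_eq w_eq// /scaled_kernel.
have r0 := rx_gt0 n; have g0 := g_gt0 (xab n).
move: (rt (x n)) r2 r0 pi (pi_gt0 R) => r -> r0 P P0.
by field; rewrite !gt_eqF ?ltr0n.
Unshelve. all: by end_near. Qed.

Lemma normalizer_inv_cvg : (fun n => (kap n)^-1) @ \oo --> (0 : R).
Proof.
have h : (fun n => n%:R / (kap n * rt (x n)) * n%:R^-1) @ \oo --> (0 : R).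
  by rewrite -[X in _ --> X](mulr0 pi); apply: cvgM; [exact: normalizer_cvg|exact: natV_cvg].
apply/cvgrPdist_lt => e e0; move/cvgrPdist_lt : h => /(_ e e0) h; near=> n.
have n0 : (0 < n)%N by near: n; exact: nbhs_infty_gt.
have : `|0 - n%:R / (kap n * rt (x n)) * n%:R^-1| < e by near: n.
rewrite !sub0r !normrN; apply: le_lt_trans.
have k0 : 0 < kap n by rewrite kap_eq mulr_gt0// repro_kernel_gt0.
have -> : n%:R / (kap n * rt (x n)) * n%:R^-1 = (kap n)^-1 / rt (x n).
  have := rx_gt0 n; move: k0; move: (kap n) => k k0 r0.
  by field; rewrite !gt_eqF ?ltr0n.
have r0 := rx_gt0 n.
rewrite normrM (ger0_norm (ltW _)) ?invr_gt0// ger0_norm ?invr_ge0//.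
rewrite ler_peMr ?invr_ge0 ?(ltW k0)// invf_ge1// -[leRHS]sqrtr1 ler_sqrt//.
by rewrite gerBl sqr_ge0.
Unshelve. all: by end_near. Qed.

Lemma shift_tracks xi : tracks x (fun n => x n + xi / kap n).
Proof.
rewrite /tracks; have -> : (fun n => x n + xi / kap n - x n) = (fun n => xi * (kap n)^-1).
  by apply/funext => n; rewrite addrC addKr.
rewrite -[X in _ --> X](mulr0 xi); apply: cvgM; first exact: cvg_cst.
exact: normalizer_inv_cvg.
Qed.

Lemma kernel_diag_cvg y : tracks x y ->
  (fun n => K n (y n) (y n) / K n (x n) (x n)) @ \oo --> (1 : R).
Proof.
move=> yx.
have h : (fun n => scaled_kernel p g n (x n) (y n) / scaled_kernel p g n (x n) (x n)
    / ((1 - y n ^+ 2) / (1 - x n ^+ 2))) @ \oo --> (1 : R).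
  apply: cvg1_div; last exact: (sqr_ratio_cvg s0_gt0 rt_bound).
  by apply: cvg1_div; apply: diag => //; exact: tracks_self.
apply: near_cvg_eq h.
have near1 := rt_tracks_ge s0_gt0 rt_bound xab yx.
near=> n.
have n0 : (0 < n)%N by near: n; exact: nbhs_infty_gt.
have ry : 0 < rt (y n).
  by apply: (@lt_le_trans _ _ (s0 / 2)); [rewrite divr_gt0|near: n].
move: ry; rewrite sqrtr_gt0 => py.
have Kx : 0 < K n (x n) (x n) by exact: repro_kernel_gt0.
rewrite /scaled_kernel.
have := px_gt0 n; have := g_gt0 (xab n); have := pi_gt0 R; move: pi => P.
by move=> P0 g0 px0; field; rewrite !gt_eqF ?ltr0n.
Unshelve. all: by end_near. Qed.

Lemma weight_cvg y : tracks x y -> (fun n => w (y n) / w (x n)) @ \oo --> (1 : R).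
Proof.
move=> yx.
have gy : (fun n => g (y n) / g (x n)) @ \oo --> (1 : R).
  apply/cvgrPdist_le => e e0.
  have e1 : 0 < Num.min e 2^-1 < 1.
    by rewrite lt_min e0 invr_gt0 ltr0n/= gt_min invf_lt1 ?ltr1n ?orbT.
  have [d d0 H] := g_close e1.
  have := tracks_near yx d0; apply: filterS => n /(H _ _ (xab n)) h.
  have g0 := g_gt0 (xab n).
  rewrite distrC -(divff (lt0r_neq0 g0)) -mulrBl normrM normfV (gtr0_norm g0) ler_pdivrMr//.
  by apply: (le_trans h); rewrite ler_wpM2r ?(ltW g0)// ge_min lexx.
apply: near_cvg_eq (cvg1_mul gy (rt_ratio_cvg s0_gt0 rt_bound xab yx)).
have near1 := rt_tracks_ge s0_gt0 rt_bound xab yx.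
near=> n.
have ry : 0 < rt (y n).
  by apply: (@lt_le_trans _ _ (s0 / 2)); [rewrite divr_gt0|near: n].
rewrite !w_eq//; have := rx_gt0 n; have := g_gt0 (xab n) => g0 r0.
by field; rewrite !gt_eqF.
Unshelve. all: by end_near. Qed.

Lemma sqrt_weight_cvg y : tracks x y ->
  (fun n => Num.sqrt (w (y n)) / Num.sqrt (w (x n))) @ \oo --> (1 : R).
Proof.
move=> /weight_cvg H.
have -> : (fun n => Num.sqrt (w (y n)) / Num.sqrt (w (x n))) =
    Num.sqrt \o (fun n => w (y n) / w (x n)).
  by apply/funext => n /=; rewrite mulrC [in RHS]mulrC sqrtrM ?sqrtrV ?invr_ge0// ltW.
by have := cvg_comp _ _ H (@sqrt_continuous R 1); rewrite sqrtr1.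
Qed.

(** K(y,z)/K(x,x) is K(y,z)/K(y,y) times K(y,y)/K(x,x): the first ratio carries the limit, while the
    second and the ratios of weights tend to 1. Evenness of sinc removes the sign of
    [angle_limit]. *)
Lemma entry_cvg u v :
  (fun n => (kap n)^-1 * norm_kernel p w n (x n + u / kap n) (x n + v / kap n)) @ \oo -->
  sinc_pi (u - v).
Proof.
have ux := shift_tracks u; have vx := shift_tracks v.
set y := (fun n => x n + u / kap n) in ux *.
set z := (fun n => x n + v / kap n) in vx *.
have yz : (fun n => n%:R * (y n - z n) / rt (x n)) @ \oo --> pi * (u - v).
  have -> : (fun n => n%:R * (y n - z n) / rt (x n)) =
      (fun n => n%:R / (kap n * rt (x n)) * (u - v)).
    by apply/funext => n; rewrite /y /z; move: (kap n) => k; rewrite invfM; ring.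
  by apply: cvgM; [exact: normalizer_cvg|exact: cvg_cst].
have lim := offdiag ux vx (angle_limit ux vx yz).
rewrite sincN sinc_piE in lim.
have W := cvg1_mul (cvg1_mul (sqrt_weight_cvg ux) (sqrt_weight_cvg vx)) (kernel_diag_cvg ux).
rewrite -[X in _ --> X]mul1r; apply: near_cvg_eq (cvgM W lim).
near=> n.
have n0 : (0 < n)%N by near: n; exact: nbhs_infty_gt.
have Kx : 0 < K n (x n) (x n) by exact: repro_kernel_gt0.
have Ky : 0 < K n (y n) (y n) by exact: repro_kernel_gt0.
rewrite -[x n + u / _]/(y n) -[x n + v / _]/(z n) kap_eq -[w (x n) in X in X^-1](sqr_sqrtr (ltW (wx_gt0 n))) /norm_kernel.
have := wx_gt0 n; rewrite -sqrtr_gt0 => wx.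
by rewrite /=; field; rewrite !gt_eqF.
Unshelve. all: by end_near. Qed.

(** The power kap^(-m) is spread over the m rows, which reduces the claim to the entries by
    continuity of the determinant. *)
Lemma corr_fun_cvg m (xi : 'I_m -> R) :
  (fun n => corr_fun p w n (fun i => x n + xi i / kap n) / kap n ^+ m) @ \oo -->
  \det (\matrix_(i < m, j < m) sinc_pi (xi i - xi j)).
Proof.
have -> : (fun n => corr_fun p w n (fun i => x n + xi i / kap n) / kap n ^+ m) =
    (fun n => \det ((kap n)^-1 *: \matrix_(i < m, j < m)
       norm_kernel p w n (x n + xi i / kap n) (x n + xi j / kap n))).
  by apply/funext => n; rewrite detZ /corr_fun mulrC exprVn.
apply: cvg_det => i j; rewrite mxE.
under [X in X @ _]eq_fun do rewrite !mxE.
exact: entry_cvg.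
Qed.

End Correlation.

(** * Universality of the correlation functions *)

Theorem corollary1p2 (R : realType)
  (mu : {finite_measure set (measurableTypeR R) -> \bar R})
  (mu_conc : mu (~` `]-1, 1[) = 0%E)
  (mu_supp : infinite_set (msupport mu))
  (mu_reg : regular_measure mu)
  (p : nat -> {poly R}) (p_orth : orthonormal_polys mu p)
  (w : R -> R) (w_dens : ac_density mu w)
  (a b : R) (a_gt : -1 < a) (ab : a <= b) (b_lt : b < 1)
  (mu_ac : exists c d : R, [/\ c < a, b < d
     & mrestr mu (measurable_itv `]c, d[) `<< @lebesgue_measure R])
  (w_pos : forall x, x \in `[a, b] -> 0 < w x)
  (w_cont : forall x, x \in `[a, b] -> {for x, continuous w})
  (m : nat) (m_gt0 : (0 < m)%N) (xi : 'I_m -> R) :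
  {uniform `[a, b],
    (fun n x => corr_fun p w n (fun i => x + xi i / norm_kernel p w n x x)
                / norm_kernel p w n x x ^+ m) @ \oo -->
    (fun=> \det (\matrix_(i < m, j < m) sinc_pi (xi i - xi j)))}.
Proof.
have [s0 [gm [gM [s0_gt0 _ bounds]]]] := segment_bounds a_gt ab b_lt w_pos w_cont.
have rt_bound x : x \in `[a, b] -> s0 <= Num.sqrt (1 - x ^+ 2) by move=> /bounds[].
have g_gt0 x : x \in `[a, b] -> 0 < rel_density w x by exact: rel_density_gt0.
have up := upper_eventually p_orth mu_reg w_dens a_gt ab b_lt mu_ac w_pos w_cont.
have tst := test_eventually w_dens a_gt ab b_lt mu_ac w_pos w_cont.
(* From here on x is a sequence of points of [a, b], one for each n. *)
apply: uniform_cvg_seq => x xab.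
have {}xab n : x n \in `[a, b] by exact: xab.
apply: (@corr_fun_cvg R p (rel_density w) w a b s0 x (p_size p_orth)) => //.
- by move=> t t0; rewrite /rel_density divfK ?gt_eqF.
- move=> e e1; have [d [d0 _ H]] := local_bounds w_dens a_gt ab b_lt mu_ac w_pos w_cont e1.
  by exists d => // t y tab ty; case: (H t y tab ty).
- by move=> y; apply: (scaled_kernel_cvg (p_size p_orth) (p_form p_orth) up tst).
- move=> y z s; apply: (kernel_ratio_limit (p_size p_orth) (p_form p_orth) s0_gt0 rt_bound g_gt0 up tst).
  exact: xab.
Qed.
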